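(* Let $n \geq 3$. If $\mu$ is an even isotropic measure on $S^{n-1}$, then \[ \frac{\kappa_n}{\gamma_n^n} \leq V(S_{\mu}^{*}) \leq \frac{\kappa_n\gamma_n^n}{\alpha_n}, \] with equality in the left inequality if and only if $\mu$ is normalized Lebesgue measure.
   Context: Let $\|\cdot\|$ and $x\cdot y$ denote the Euclidean norm and the standard inner product on $\mathbb{R}^n$, let $S^{n-1}$ be the unit sphere, and let $V$ denote volume (Lebesgue measure) in $\mathbb{R}^n$. A non-negative finite Borel measure $\mu$ on $S^{n-1}$ is isotropic if $\|x\|^2=\int_{S^{n-1}}|x\cdot u|^2\,d\mu(u)$ for all $x\in\mathbb{R}^n$ (so $\mu(S^{n-1})=n$). It is even if it assumes the same value on antipodal Borel sets. Normalized Lebesgue measure is the spherical Lebesgue measure on $S^{n-1}$ scaled so as to be isotropic, i.e. to have total mass $n$. The sine transform of a finite Borel measure $\mu$ on $S^{n-1}$ is \[(\mathcal{S}\mu)(x)=\int_{S^{n-1}}\|x|u^{\perp}\|\,d\mu(u),\qquad x\in\mathbb{R}^n,\] where $x|u^{\perp}=x-(x\cdot u)u$ is the orthogonal projection of $x$ onto the hyperplane $u^\perp$ orthogonal to $u$. For $\mu$ even and isotropic, $\mathcal{S}\mu$ is a norm on $\mathbb{R}^n$. Its unit ball is $S_\mu^*=\{x\in\mathbb{R}^n:(\mathcal{S}\mu)(x)\leq 1\}$, and $S_\mu$ denotes the polar body of $S_\mu^*$, i.e. the convex body with support function $h(S_\mu,\cdot)=\mathcal{S}\mu$. Let $\kappa_m$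 denote the $m$-dimensional volume of the Euclidean unit ball in $\mathbb{R}^m$, and put \[\alpha_n=\frac{n(n-1)^{2n}}{\Gamma(n)^{1/(n-1)}},\qquad \gamma_n=\frac{(n-1)\kappa_{n-1}^2}{\kappa_{n-2}\kappa_n}.\] *)

(* Defs.v *)
From HB Require Import structures.
From mathcomp Require Import all_boot all_order all_algebra.
From mathcomp Require Import all_classical all_reals all_analysis.

Set Implicit Arguments.
Unset Strict Implicit.
Unset Printing Implicit Defensive.

Import Order.TTheory GRing.Theory Num.Theory.
Import numFieldNormedType.Exports.

Local Open Scope classical_set_scope.
Local Open Scope ring_scope.

Section lebesgue_cons.
Local Open Scope ereal_scope.
Context (R : realType) (n : nat).
Local Notation T := (measurableTypeR R).
Variable m : {sigma_finite_measure set (n.-tuple T) -> \bar R}.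

Definition tuple_cons (p : T * n.-tuple T) : n.+1.-tuple T :=
  [tuple of p.1 :: p.2].

Lemma measurable_tuple_cons : measurable_fun setT tuple_cons.
Proof. exact: measurable_cons. Qed.

Definition lebesgue_cons : set (n.+1.-tuple T) -> \bar R :=
  pushforward ((@lebesgue_measure R) \x m) tuple_cons.

Let lebesgue_cons0 : lebesgue_cons set0 = 0.
Proof. by rewrite /lebesgue_cons /pushforward preimage_set0 measure0. Qed.

Let lebesgue_cons_ge0 A : 0 <= lebesgue_cons A.
Proof. by rewrite /lebesgue_cons /pushforward measure_ge0. Qed.

Let lebesgue_cons_sigma_additive : semi_sigma_additive lebesgue_cons.
Proof.
move=> F mF tF mUF; rewrite /lebesgue_cons /pushforward preimage_bigcup.
apply: measure_semi_sigma_additive.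
- by move=> k; rewrite -[X in measurable X]setTI; exact: measurable_tuple_cons.
- apply/trivIsetP => /= i j _ _ ij; rewrite -preimage_setI.
  by move/trivIsetP : tF => -> //; rewrite preimage_set0.
- rewrite -preimage_bigcup -[X in measurable X]setTI.
  exact: measurable_tuple_cons.
Qed.

HB.instance Definition _ := isMeasure.Build _ _ _ lebesgue_cons
  lebesgue_cons0 lebesgue_cons_ge0 lebesgue_cons_sigma_additive.

Let uncons (t : n.+1.-tuple T) : T * n.-tuple T :=
  (thead t, [tuple of behead t]).

Let lebesgue_cons_sigma_finite : sigma_finite setT lebesgue_cons.
Proof.
have muncons : measurable_fun setT uncons.
  apply/measurable_fun_pairP; split.
    exact: measurable_tnth.
  exact: measurable_behead.
have /sigma_finiteP[F [TF ndF Foo]] := sigma_finiteT (@lebesgue_measure R).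
have /sigma_finiteP[G [TG ndG Goo]] := sigma_finiteT m.
exists (fun k => uncons @^-1` (F k `*` G k)).
  rewrite -preimage_bigcup (_ : \bigcup_k _ = setT) ?preimage_setT//.
  apply/seteqP; split => // -[x t] _.
  have [i _ Fix] : (\bigcup_k F k) x by rewrite -TF.
  have [j _ Gjt] : (\bigcup_k G k) t by rewrite -TG.
  exists (maxn i j) => //; split => /=.
    by move: x Fix; exact/subsetPset/ndF/leq_maxl.
  by move: t Gjt; exact/subsetPset/ndG/leq_maxr.
move=> k; have [mFk Fkoo] := Foo k; have [mGk Gkoo] := Goo k; split.
  by rewrite -[X in measurable X]setTI; apply: muncons => //; exact: measurableX.
rewrite /lebesgue_cons /pushforward -comp_preimage.
rewrite (_ : uncons \o tuple_cons = id); last first.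
  by apply/funext => -[x t]; congr pair; exact/val_inj.
by rewrite preimage_id product_measure1E// lte_mul_pinfty// ge0_fin_numE.
Qed.

HB.instance Definition _ := Measure_isSigmaFinite.Build _ _ _ lebesgue_cons
  lebesgue_cons_sigma_finite.

End lebesgue_cons.

(* Lebesgue measure on R^n as the n-fold product of the one on R, the space of
   0-tuples (a point) having measure 1. *)
Fixpoint lebesgue_tuple (R : realType) (n : nat) :
    {sigma_finite_measure set (n.-tuple (measurableTypeR R)) -> \bar R} :=
  match n with
  | 0 => dirac ([tuple] : 0.-tuple (measurableTypeR R))
  | n'.+1 => lebesgue_cons (lebesgue_tuple R n')
  end.

Lemma lebesgue_tuple_box (R : realType) (n : nat)
    (A : 'I_n -> set (measurableTypeR R)) :
  (forall i, measurable (A i)) ->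
  lebesgue_tuple R n [set t | forall i, A i (tnth t i)] =
  (\prod_(i < n) lebesgue_measure (A i))%E.
Proof.
elim: n A => [|n IHn] A mA.
  by rewrite big_ord0 /= diracE mem_set// => -[].
rewrite big_ord_recl -IHn; last by move=> i; exact: mA.
rewrite -product_measure1E//; last first.
  rewrite (_ : [set t | _] = \bigcap_(i in [set: 'I_n])
      ((fun t => tnth t i) @^-1` A (lift ord0 i))); last first.
    by apply/seteqP; split => t /= At i; [move=> _|]; exact: At.
  apply: fin_bigcap_measurable => // i _.
  by rewrite -[X in measurable X]setTI; exact: measurable_tnth.
rewrite /= /lebesgue_cons /pushforward; congr (_ _).
apply/seteqP; split => -[x t] /= H.
  split => [|i]; first by have := H ord0.
  by have := H (lift ord0 i); rewrite tnthS.
case: H => Ax At i; have [j ->|->//] := unliftP ord0 i.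
by rewrite tnthS; exact: At.
Qed.

Section euclidean.
Context (R : realType) (n : nat).
Implicit Types (x y u : 'rV[R]_n) (A : set 'rV[R]_n).

Definition dot x y : R := \sum_(i < n) x 0 i * y 0 i.

Definition enorm x : R := Num.sqrt (dot x x).

(* The row vectors are read as tuples of coordinates. *)
Definition volume A : \bar R :=
  lebesgue_tuple R n [set t | A (\row_i tnth t i)].

(* [x|u^perp] for a unit vector [u] *)
Definition proj_perp u x : 'rV[R]_n := x - dot x u *: u.

End euclidean.

Definition kappa (R : realType) (m : nat) : R :=
  fine (volume [set x : 'rV[R]_m | enorm x <= 1]).

Definition euler_Gamma (R : realType) (a : R) : R :=
  \int[lebesgue_measure]_(t in `]0, +oo[) (t `^ (a - 1) * expR (- t)).

Definition alpha (R : realType) (n : nat) : R :=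
  n%:R * (n%:R - 1) ^+ (2 * n)%N /
  euler_Gamma (n%:R : R) `^ (n%:R - 1)^-1.

Definition gamma (R : realType) (n : nat) : R :=
  (n%:R - 1) * kappa R n.-1 ^+ 2 / (kappa R n.-2 * kappa R n).

(* The unit sphere S^m of R^(m+1); with this indexing it is never empty, as
   measurable types must be. *)
Definition unit_sphere (R : realType) (m : nat) : set 'rV[R]_m.+1 :=
  [set x | enorm x = 1].
Arguments unit_sphere : clear implicits.

Section sphere_structure.
Context (R : realType) (m : nat).

Lemma sphere_delta0 : delta_mx 0 0 \in unit_sphere R m.
Proof.
rewrite inE /unit_sphere /= /enorm /dot big_ord_recl big1 ?addr0.
  by rewrite mxE eqxx mulr1 sqrtr1.
by move=> i _; rewrite mxE mulr0.
Qed.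

HB.instance Definition _ := isPointed.Build (set_type (unit_sphere R m))
  (SigSub sphere_delta0).

Lemma sphereN (u : set_type (unit_sphere R m)) : - set_val u \in unit_sphere R m.
Proof.
rewrite inE; apply: etrans (set_valP u).
by rewrite /enorm /dot; congr Num.sqrt; apply: eq_bigr => i _; rewrite !mxE mulrNN.
Qed.

Definition antipode (u : set_type (unit_sphere R m)) : set_type (unit_sphere R m) :=
  SigSub (sphereN u).

End sphere_structure.

Definition borel_sphere (R : realType) (m : nat) :=
  g_sigma_algebraType (@open (set_type (unit_sphere R m))).

Section sphere_measures.
Local Open Scope ereal_scope.
Context (R : realType) (m : nat).
Local Notation n := m.+1.
Local Notation sphere := (borel_sphere R m).

(* The surface area of a Borel set [A] of S^(n-1) is n times the volume of the
   cone {r u : 0 < r <= 1, u in A}. *)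
Definition spherical_lebesgue (A : set sphere) : \bar R :=
  n%:R%:E * volume [set x : 'rV[R]_n |
    exists2 u, A u & exists2 r : R, (0 < r <= 1)%R & x = r *: set_val u].

Definition normalized_lebesgue (A : set sphere) : \bar R :=
  (n%:R / fine (spherical_lebesgue setT))%:E * spherical_lebesgue A.

Variable mu : {finite_measure set sphere -> \bar R}.

Definition isotropic : Prop := forall x : 'rV[R]_n,
  (enorm x ^+ 2)%:E = \int[mu]_(u in setT) (`|dot x (set_val u)| ^+ 2)%:E.

Definition even_measure : Prop := forall A : set sphere, measurable A ->
  mu (@antipode R m @` A) = mu A.

Definition sine_transform (x : 'rV[R]_n) : \bar R :=
  \int[mu]_(u in setT) (enorm (proj_perp (set_val u) x))%:E.

Definition sine_ball : set 'rV[R]_n := [set x | sine_transform x <= 1].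

End sphere_measures.

(* Main.v *)
(* Write N(x) for the sine transform of mu, B for the unit ball, and r = N/|.|.
   In polar coordinates the volume of {N <= 1} is the integral of r^-n over B,
   and the integral of r over B is kappa_n gamma_n, because for a unit vector u
   the mean of |x|u^perp|/|x| over B does not depend on u.  The tangent line of
   s^-n at s = gamma_n gives the lower bound (Jensen).  By the Cauchy-Schwarz
   inequality n - 1 <= r <= sqrt (n (n - 1)), so the chord of s^-n over that
   interval gives an upper bound; it lies below the stated one by an elementary
   inequality, since gamma_n >= (n - 1)(1 + 1/(2n)).
     In the equality case r = gamma_n, so mu and the normalized Lebesgue measure
   sigma have the same sine transform.  The kernel 1 - |v|u^perp| is
   1 - sqrt (1 - (u.v)^2), a power series in (u.v)^2 whose coefficients other
   than the constant one are positive; integrating it against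
   (mu - sigma) x (mu - sigma), which gives 0, yields a positive combination of
   the squared differences of the even moments of mu and sigma, so that these
   agree.  The odd moments vanish by symmetry, and the moments determine a
   measure on the sphere. *)

Require Import Defs.
From HB Require Import structures.
From mathcomp Require Import all_boot all_order all_algebra.
From mathcomp Require Import all_classical all_reals all_analysis.
From mathcomp Require Import measurable_realfun ring lra zify.

Set Implicit Arguments.
Unset Strict Implicit.
Unset Printing Implicit Defensive.

Import Order.TTheory GRing.Theory Num.Theory.
Import numFieldNormedType.Exports.

Local Open Scope classical_set_scope.
Local Open Scope ring_scope.

(** * Lebesgue measure on row vectors *)

(** A function homogeneous of degree 0 has the same mean over B as over the sphere, so B replaces
    the sphere throughout; sigma itself is handled as the image of the volume on B under x/|x|.
    Tangent and chord are affine in r, so their integrals involve only the mean of r. The chord has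
    negative slope while the stated upper bound grows with gamma_n: a lower bound for gamma_n may
    replace it on both sides, which leaves an inequality in n alone. That lower bound exists because
    gamma_n is n - 1 times a quotient of two consecutive Wallis integrals. After multiplication by
    (n - 1)^n both sides of the inequality in n tend to e^(-1/2), hence the explicit Stirling bound
    and the separate cases n = 3, 4. The kernel integrates to n (n - gamma_n) against each of the
    four products of mu and sigma, since both sine transforms are the same constant on the sphere;
    this is why the integral against the difference is 0. The power series is approached by the
    iteration t -> (s + t^2)/2: its error is bounded uniformly up to s = 1, and its coefficients
    only grow, so each moment keeps a fixed positive weight. *)

Section row_vectors.
Context (R : realType) (n : nat).

Definition row_of_tuple (t : n.-tuple (measurableTypeR R)) : 'rV[R]_n :=
  \row_i tnth t i.

Definition tuple_of_row (x : 'rV[R]_n) : n.-tuple (measurableTypeR R) :=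
  [tuple x 0 i | i < n].

Lemma row_of_tupleK : cancel row_of_tuple tuple_of_row.
Proof.
by move=> t; apply: eq_from_tnth => i; rewrite tnth_mktuple mxE.
Qed.

Lemma tuple_of_rowK : cancel tuple_of_row row_of_tuple.
Proof. by move=> x; apply/rowP => i; rewrite mxE tnth_mktuple. Qed.

(** The sigma-algebra is transported from tuples so that [volume] is, by conversion, the image of
    [lebesgue_tuple], and hence a measure. *)
Definition row_measurable : set_system 'rV[R]_n :=
  [set A | measurable (row_of_tuple @^-1` A)].

Let row_measurable0 : row_measurable set0.
Proof. by rewrite /row_measurable /= preimage_set0. Qed.

Let row_measurableC A : row_measurable A -> row_measurable (~` A).
Proof. by move=> mA; have := measurableC mA. Qed.

Let row_measurable_bigcup (F : (set 'rV[R]_n)^nat) :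
  (forall i, row_measurable (F i)) -> row_measurable (\bigcup_i F i).
Proof.
move=> mF; rewrite /row_measurable /= preimage_bigcup.
by apply: bigcup_measurable => k _; exact: mF.
Qed.

HB.instance Definition _ := @isMeasurable.Build
  default_measure_display 'rV[R]_n row_measurable
  row_measurable0 row_measurableC row_measurable_bigcup.

End row_vectors.

Section row_measurability.
Context (R : realType) (n : nat).

Lemma measurable_row_of_tuple :
  measurable_fun setT (@row_of_tuple R n).
Proof. by move=> _ A mA; rewrite setTI. Qed.

Lemma measurable_tuple_of_row :
  measurable_fun setT (@tuple_of_row R n).
Proof.
move=> _ A mA; rewrite setTI; rewrite /measurable /= /row_measurable /=.
rewrite (_ : _ @^-1` _ = A)//; last first.
  by apply/seteqP; split => t /=; rewrite row_of_tupleK.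
Qed.

Lemma measurable_coord (i : 'I_n) :
  measurable_fun setT (fun x : 'rV[R]_n => x 0 i).
Proof.
rewrite (_ : (fun x => _) = (fun t => tnth t i) \o @tuple_of_row R n).
  by apply: measurableT_comp;
    [exact: measurable_tnth | exact: measurable_tuple_of_row].
by apply/funext => x /=; rewrite tnth_mktuple.
Qed.

Lemma measurable_rowP d (Z : measurableType d) (f : Z -> 'rV[R]_n) :
  (forall i, measurable_fun setT (fun z => f z 0 i)) -> measurable_fun setT f.
Proof.
move=> mf; rewrite (_ : f = @row_of_tuple R n \o (@tuple_of_row R n \o f)).
  apply: measurableT_comp; first exact: measurable_row_of_tuple.
  apply/measurable_fun_tnthP => i.
  by apply: eq_measurable_fun (mf i) => z _ /=; rewrite tnth_mktuple.
by apply/funext => z /=; rewrite tuple_of_rowK.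
Qed.

Lemma measurable_coord_comp d (Z : measurableType d) (f : Z -> 'rV[R]_n) i :
  measurable_fun setT f -> measurable_fun setT (fun z => f z 0 i).
Proof. by move=> mf; exact: (measurableT_comp (measurable_coord i)). Qed.

Lemma measurable_rowD d (Z : measurableType d) (f g : Z -> 'rV[R]_n) :
  measurable_fun setT f -> measurable_fun setT g ->
  measurable_fun setT (fun z => f z + g z).
Proof.
move=> mf mg; apply: measurable_rowP => i.
under eq_fun do rewrite mxE.
by apply: measurable_funD; exact: measurable_coord_comp.
Qed.

Lemma measurable_rowZ d (Z : measurableType d) (k : Z -> R) (f : Z -> 'rV[R]_n) :
  measurable_fun setT k -> measurable_fun setT f ->
  measurable_fun setT (fun z => k z *: f z).
Proof.
move=> mk mf; apply: measurable_rowP => i.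
under eq_fun do rewrite mxE.
by apply: measurable_funM => //; exact: measurable_coord_comp.
Qed.

Lemma measurable_dot d (Z : measurableType d) (f g : Z -> 'rV[R]_n) :
  measurable_fun setT f -> measurable_fun setT g ->
  measurable_fun setT (fun z => dot (f z) (g z)).
Proof.
move=> mf mg; apply: measurable_sum => i.
by apply: measurable_funM; exact: measurable_coord_comp.
Qed.

Lemma measurable_sqrt : measurable_fun setT (@Num.sqrt R).
Proof. exact: (continuous_measurable_fun (@sqrt_continuous R)). Qed.

Lemma measurable_enorm d (Z : measurableType d) (f : Z -> 'rV[R]_n) :
  measurable_fun setT f -> measurable_fun setT (fun z => enorm (f z)).
Proof.
move=> mf; apply: (measurableT_comp measurable_sqrt).
exact: measurable_dot.
Qed.

Let volume0 : @volume R n set0 = 0%E.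
Proof. exact: (measure0 (lebesgue_tuple R n)). Qed.

Let volume_ge0 A : (0 <= @volume R n A)%E.
Proof. exact: measure_ge0. Qed.

Let volume_sigma_additive : semi_sigma_additive (@volume R n).
Proof.
move=> F mF tF mUF; rewrite /volume.
rewrite (_ : [set t | _] = \bigcup_k (@row_of_tuple R n @^-1` F k)); last first.
  by rewrite -preimage_bigcup.
apply: measure_semi_sigma_additive => //.
apply/trivIsetP => /= i j _ _ ij; rewrite -preimage_setI.
by move/trivIsetP : tF => -> //; rewrite preimage_set0.
Qed.

HB.instance Definition _ := isMeasure.Build _ _ _ (@volume R n)
  volume0 volume_ge0 volume_sigma_additive.

Let volume_sigma_finite : sigma_finite setT (@volume R n).
Proof.
have [F TF Foo] := sigma_finiteT (lebesgue_tuple R n).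
exists (fun k => @tuple_of_row R n @^-1` F k).
  by rewrite -preimage_bigcup -TF preimage_setT.
move=> k; have [mFk Fkoo] := Foo k; split.
  by rewrite -[X in measurable X]setTI; exact: measurable_tuple_of_row.
rewrite /volume (_ : [set t | _] = F k)//.
by apply/seteqP; split => t /=; rewrite -/(row_of_tuple t) row_of_tupleK.
Qed.

HB.instance Definition _ := Measure_isSigmaFinite.Build _ _ _ (@volume R n)
  volume_sigma_finite.

Lemma ge0_integral_volumeE (f : 'rV[R]_n -> \bar R) :
  measurable_fun setT f -> (forall x, 0 <= f x)%E ->
  (\int[@volume R n]_x f x = \int[lebesgue_tuple R n]_t f (row_of_tuple t))%E.
Proof.
move=> mf f0; transitivity
  (\int[pushforward (lebesgue_tuple R n) (@row_of_tuple R n)]_x f x)%E.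
  by [].
by rewrite ge0_integral_pushforward//; exact: measurable_row_of_tuple.
Qed.

End row_measurability.

Section slicing.
Context (R : realType) (n : nat).

Definition row_cons (p : R * 'rV[R]_n) : 'rV[R]_n.+1 :=
  \row_i if unlift 0 i is Some j then p.2 0 j else p.1.

Lemma row_cons0 p : row_cons p 0 0 = p.1.
Proof. by rewrite mxE unlift_none. Qed.

Lemma row_consS p i : row_cons p 0 (lift 0 i) = p.2 0 i.
Proof. by rewrite mxE liftK. Qed.

Lemma measurable_row_cons : measurable_fun setT row_cons.
Proof.
apply: measurable_rowP => i; have [j ->|->] := unliftP ord0 i.
  under eq_fun do rewrite row_consS.
  exact: measurable_coord_comp.
under eq_fun do rewrite row_cons0.
exact: measurable_fst.
Qed.

Lemma dot_row_cons p q :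
  dot (row_cons p) (row_cons q) = p.1 * q.1 + dot p.2 q.2.
Proof.
rewrite /dot big_ord_recl !row_cons0; congr (_ + _).
by apply: eq_bigr => i _; rewrite !row_consS.
Qed.

Lemma row_consD p q : row_cons p + row_cons q = row_cons (p.1 + q.1, p.2 + q.2).
Proof.
apply/rowP => i; rewrite mxE; have [j ->|->] := unliftP ord0 i.
  by rewrite !row_consS mxE.
by rewrite !row_cons0.
Qed.

Lemma row_consZ k p : k *: row_cons p = row_cons (k * p.1, k *: p.2).
Proof.
apply/rowP => i; rewrite mxE; have [j ->|->] := unliftP ord0 i.
  by rewrite !row_consS mxE.
by rewrite !row_cons0.
Qed.

Lemma row_cons_eta (x : 'rV[R]_n.+1) :
  x = row_cons (x 0 0, \row_i x 0 (lift 0 i)).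
Proof.
apply/rowP => i; have [j ->|->] := unliftP ord0 i.
  by rewrite row_consS mxE.
by rewrite row_cons0.
Qed.

Local Open Scope ereal_scope.

(** Tonelli's theorem along the recursive definition of [lebesgue_tuple]; it supports every
    induction on the dimension. *)
Lemma ge0_integral_slice (f : 'rV[R]_n.+1 -> \bar R) :
  measurable_fun setT f -> (forall x, 0 <= f x) ->
  \int[@volume R n.+1]_x f x =
  \int[lebesgue_measure]_t \int[@volume R n]_x f (row_cons (t, x)).
Proof.
move=> mf f0; rewrite ge0_integral_volumeE//=.
transitivity (\int[pushforward ((@lebesgue_measure R) \x lebesgue_tuple R n)
   (@tuple_cons R n)]_t f (row_of_tuple t)).
  by [].
have mf' : measurable_fun setT (fun t => f (@row_of_tuple R n.+1 t)).
  by apply: (measurableT_comp mf); exact: measurable_row_of_tuple.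
rewrite ge0_integral_pushforward//=; last exact: measurable_tuple_cons.
rewrite preimage_setT.
rewrite (@fubini_tonelli1 _ _ _ _ _ _ _
  (fun p => f (row_of_tuple (tuple_cons p))))//; last first.
  by apply: (measurableT_comp mf'); exact: measurable_tuple_cons.
apply: eq_integral => t _; rewrite ge0_integral_volumeE//; last first.
  apply: (measurableT_comp mf); apply: (measurableT_comp measurable_row_cons).
  exact: measurable_fun_pair.
apply: eq_integral => /= s _; congr (f _); apply/rowP => i.
have [j ->|->] := unliftP ord0 i; first by rewrite row_consS !mxE tnthS.
by rewrite row_cons0 mxE.
Qed.

End slicing.

Section image_measure.
Context d1 d2 (T1 : measurableType d1) (T2 : measurableType d2) (R : realType).
Variables (m : {measure set T1 -> \bar R}) (f : T1 -> T2).
Hypothesis mf : measurable_fun setT f.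

(* The measure structure of [pushforward m f] depends on a proof that [f] is
   measurable, which unification cannot find; here it is an argument. *)
Definition image_measure : {measure set T2 -> \bar R} :=
  measure_function_pushforward__canonical__measure_function_Measure m mf.

Lemma ge0_integral_image_measure (g : T2 -> \bar R) :
  measurable_fun setT g -> (forall y, 0 <= g y)%E ->
  (\int[image_measure]_y g y = \int[m]_x g (f x))%E.
Proof. by move=> mg g0; rewrite ge0_integral_pushforward. Qed.

End image_measure.

(** * Volume under translations and dilations *)

Section lebesgue_affine.
Context (R : realType).
Local Notation T := (measurableTypeR R).
Local Open Scope ereal_scope.

(** The image of Lebesgue measure under a translation gives half-open intervals their length, which
    determines it. [ge0_integral_lebesgue_scale] argues in the same way. *)
Lemma ge0_integral_lebesgue_shift (f : R -> \bar R) (a : R) :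
  measurable_fun setT f -> (forall x, 0 <= f x) ->
  \int[lebesgue_measure]_x f (x + a)%R = \int[lebesgue_measure]_x f x.
Proof.
move=> mf f0; have ms : measurable_fun setT ((fun x => x + a)%R : T -> T).
  exact: measurable_funD.
rewrite -(ge0_integral_image_measure lebesgue_measure ms)//.
apply: eq_measure_integral => A mA _; apply/esym.
apply: lebesgue_measure_unique => //= _ [[b c] _ <-].
rewrite /pushforward.
rewrite (_ : _ @^-1` _ = `](b - a)%R, (c - a)%R]%classic); last first.
  by apply/seteqP; split => x /=; rewrite !in_itv /= ltrBlDr lerBrDr.
rewrite !lebesgue_measure_itv/= !lte_fin ltrD2r; case: ifPn => // _.
by rewrite -!EFinB; congr _%:E; ring.
Qed.

Lemma ge0_integral_lebesgue_scale (f : R -> \bar R) (r : R) : (0 < r)%R ->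
  measurable_fun setT f -> (forall x, 0 <= f x) ->
  \int[lebesgue_measure]_x f x =
  r%:E * \int[lebesgue_measure]_x f (r * x)%R.
Proof.
move=> r0 mf f0.
have ms : measurable_fun setT ((fun x => r * x)%R : T -> T).
  exact: measurable_funM.
rewrite -(ge0_integral_image_measure lebesgue_measure ms)//.
rewrite -(ge0_integral_mscale _ _ (NngNum (ltW r0)))//.
apply: eq_measure_integral => A mA _.
apply: lebesgue_measure_unique => //= _ [[b c] _ <-].
rewrite /mscale /= /pushforward.
rewrite (_ : _ @^-1` _ = `](b / r)%R, (c / r)%R]%classic); last first.
  by apply/seteqP; split => x /=;
    rewrite !in_itv /= ltr_pdivrMr // ler_pdivlMr // mulrC.
rewrite !lebesgue_measure_itv/= !lte_fin ltr_pM2r ?invr_gt0//; case: ifPn => // _.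
  by rewrite -!EFinB -EFinM; congr _%:E; field; rewrite gt_eqF.
by rewrite mule0.
Qed.

End lebesgue_affine.

Section volume_affine.
Context (R : realType).
Local Open Scope ereal_scope.

Lemma measurable_slice n (f : 'rV[R]_n.+1 -> \bar R) :
  measurable_fun setT f -> (forall x, 0 <= f x) ->
  measurable_fun setT
    (fun t : R => \int[@volume R n]_x f (row_cons (t, x))).
Proof.
move=> mf f0.
apply: (measurable_fun_fubini_tonelli_F (fun p => f (row_cons p))) => //.
by apply: (measurableT_comp mf); exact: measurable_row_cons.
Qed.

Lemma measurable_row_consr n t :
  measurable_fun setT (fun x : 'rV[R]_n => row_cons (t, x)).
Proof. by apply: (measurableT_comp (@measurable_row_cons R n)). Qed.

Lemma ge0_integral_volume_shift n (f : 'rV[R]_n -> \bar R) (a : 'rV[R]_n) :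
  measurable_fun setT f -> (forall x, 0 <= f x) ->
  \int[@volume R n]_x f (x + a)%R = \int[@volume R n]_x f x.
Proof.
elim: n f a => [|n IHn] f a mf f0.
  by apply: eq_integral => x _; congr f; apply/rowP => -[].
have ms : measurable_fun setT (fun x : 'rV[R]_n.+1 => x + a)%R.
  exact: measurable_rowD.
rewrite ge0_integral_slice//; last by apply: (measurableT_comp mf).
rewrite [RHS]ge0_integral_slice//.
rewrite -[RHS](ge0_integral_lebesgue_shift (a 0 0)%R); last 2 first.
- exact: measurable_slice.
- by move=> t; apply: integral_ge0.
apply: eq_integral => t _.
rewrite -[RHS](IHn (fun x => f (row_cons (t + a 0 0, x)%R))
  (\row_i a 0 (lift 0 i))%R)//; last first.
  by apply: (measurableT_comp mf); exact: measurable_row_consr.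
by apply: eq_integral => x _; rewrite {1}(row_cons_eta a) row_consD.
Qed.

(** Each coordinate sliced off in the induction contributes one factor [r]. *)
Lemma ge0_integral_volume_scale n (f : 'rV[R]_n -> \bar R) (r : R) : (0 < r)%R ->
  measurable_fun setT f -> (forall x, 0 <= f x) ->
  \int[@volume R n]_x f x = (r ^+ n)%:E * \int[@volume R n]_x f (r *: x)%R.
Proof.
move=> r0; elim: n f => [|n IHn] f mf f0.
  by rewrite expr0 mul1e; apply: eq_integral => x _; congr f; apply/rowP => -[].
have ms : measurable_fun setT (fun x : 'rV[R]_n.+1 => r *: x)%R.
  exact: measurable_rowZ.
have mfr : measurable_fun setT (fun x : 'rV[R]_n.+1 => f (r *: x)%R).
  exact: (measurableT_comp mf).
rewrite ge0_integral_slice// (ge0_integral_lebesgue_scale r0); last 2 first.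
- exact: measurable_slice.
- by move=> t; apply: integral_ge0.
rewrite [in RHS]ge0_integral_slice// exprS EFinM -muleA; congr (_ * _).
rewrite -ge0_integralZl//; last 3 first.
- exact: (measurable_slice mfr).
- by move=> t _; apply: integral_ge0.
- by rewrite lee_fin exprn_ge0// ltW.
apply: eq_integral => t _.
rewrite (IHn (fun x => f (row_cons (r * t, x)%R)))//; last first.
  by apply: (measurableT_comp mf); exact: measurable_row_consr.
by congr (_ * _); apply: eq_integral => x _; rewrite row_consZ.
Qed.

End volume_affine.

(** * Inner product, unit ball and orthogonal maps *)

Section orthogonal.
Context (R : realType) (n : nat).
Implicit Types (x y : 'rV[R]_n) (M : 'M[R]_n).

Lemma dotE x y : dot x y = (x *m y^T) 0 0.
Proof. by rewrite mxE; apply: eq_bigr => i _; rewrite mxE. Qed.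

Lemma dotC x y : dot x y = dot y x.
Proof. by apply: eq_bigr => i _; rewrite mulrC. Qed.

Lemma dotDl x y z : dot (x + y) z = dot x z + dot y z.
Proof.
by rewrite /dot -big_split; apply: eq_bigr => i _; rewrite /= mxE mulrDl.
Qed.

Lemma dotDr x y z : dot x (y + z) = dot x y + dot x z.
Proof. by rewrite ![dot x _]dotC dotDl. Qed.

Lemma dotZl k x y : dot (k *: x) y = k * dot x y.
Proof.
by rewrite /dot mulr_sumr; apply: eq_bigr => i _; rewrite mxE mulrA.
Qed.

Lemma dotZr k x y : dot x (k *: y) = k * dot x y.
Proof. by rewrite dotC dotZl dotC. Qed.

Lemma dot0l x : dot 0 x = 0.
Proof. by rewrite -(scale0r 0) dotZl mul0r. Qed.

Lemma dot_ge0 x : 0 <= dot x x.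
Proof. by apply: sumr_ge0 => i _; rewrite -expr2 sqr_ge0. Qed.

Lemma dot_eq0 x : (dot x x == 0) = (x == 0).
Proof.
apply/idP/eqP => [|->]; last by rewrite dot0l.
rewrite psumr_eq0 => [/allP x0|i _]; last by rewrite -expr2 sqr_ge0.
apply/rowP => i; rewrite mxE.
by apply/eqP; have := x0 i (mem_index_enum _); rewrite mulf_eq0 orbb.
Qed.

Lemma enorm_ge0 x : 0 <= enorm x.
Proof. exact: sqrtr_ge0. Qed.

Lemma enorm_sqr x : enorm x ^+ 2 = dot x x.
Proof. by rewrite sqr_sqrtr// dot_ge0. Qed.

Lemma enorm_eq0 x : (enorm x == 0) = (x == 0).
Proof. by rewrite -dot_eq0 -enorm_sqr sqrf_eq0. Qed.

Lemma enorm0 : enorm (0 : 'rV[R]_n) = 0.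
Proof. by apply/eqP; rewrite enorm_eq0. Qed.

Lemma enorm_gt0 x : (0 < enorm x) = (x != 0).
Proof. by rewrite lt_neqAle enorm_ge0 andbT eq_sym enorm_eq0. Qed.

Lemma enormZ k x : enorm (k *: x) = `|k| * enorm x.
Proof.
by rewrite /enorm dotZl dotZr mulrA -expr2 sqrtrM ?sqr_ge0// sqrtr_sqr.
Qed.

Lemma enormN x : enorm (- x) = enorm x.
Proof. by rewrite -scaleN1r enormZ normrN1 mul1r. Qed.

Lemma dot_mulmx M x y : M *m M^T = 1%:M -> dot (x *m M) (y *m M) = dot x y.
Proof.
by move=> MM; rewrite !dotE trmx_mul mulmxA -(mulmxA x) MM mulmx1.
Qed.

Lemma enorm_mulmx M x : M *m M^T = 1%:M -> enorm (x *m M) = enorm x.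
Proof. by move=> MM; rewrite /enorm dot_mulmx. Qed.

Lemma measurable_mulmx M : measurable_fun setT (fun x : 'rV[R]_n => x *m M).
Proof.
apply: measurable_rowP => i; under eq_fun do rewrite mxE.
by apply: measurable_sum => j; apply: measurable_funM => //; exact: measurable_coord.
Qed.

Definition uball : set 'rV[R]_n := [set x | enorm x <= 1].

Lemma measurable_uball : measurable uball.
Proof.
rewrite (_ : uball = (@enorm R n) @^-1` `]-oo, 1]).
  rewrite -[X in measurable X]setTI; apply: measurable_enorm => //.
by apply/seteqP; split => x /=; rewrite in_itv.
Qed.

Lemma measurable_cube (r : R) :
  measurable [set x : 'rV[R]_n | forall i, `|x 0 i| <= r].
Proof.
rewrite (_ : [set x | _] = \bigcap_(i in [set: 'I_n])
    ((fun x : 'rV[R]_n => x 0 i) @^-1` `[- r, r])); last first.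
  apply/seteqP; split => x xr i.
    by move=> _; rewrite /= in_itv /= -ler_norml; exact: xr.
  by have := xr i I; rewrite /= in_itv /= -ler_norml.
apply: fin_bigcap_measurable => // i _.
by rewrite -[X in measurable X]setTI; exact: measurable_coord.
Qed.

Lemma volume_cube (r : R) : 0 <= r ->
  volume [set x : 'rV[R]_n | forall i, `|x 0 i| <= r] = ((2 * r) ^+ n)%:E.
Proof.
move=> r0; rewrite /volume.
rewrite (_ : [set t | _] =
  [set t | forall i, (fun=> `[- r, r]%classic) i (tnth t i)]); last first.
  apply/seteqP; split => t /= H i; have := H i; rewrite mxE /= in_itv /=.
    by rewrite ler_norml.
  by rewrite ler_norml.
rewrite (@lebesgue_tuple_box R n (fun=> `[- r, r]%classic))//.
rewrite lebesgue_measure_itv /= lte_fin.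
have -> : (if - r < r then (r%:E - (- r)%:E)%E else 0%E) = (2 * r)%:E.
  rewrite -EFinB; case: ifPn => [_|]; first by congr _%:E; ring.
  by rewrite -leNgt => rr; congr _%:E; lra.
by rewrite prodEFin big_const_ord iter_mulr_1.
Qed.

Lemma coord_le_enorm x i : `|x 0 i| <= enorm x.
Proof.
rewrite -sqrtr_sqr ler_wsqrtr// /dot (bigD1 i)//= -expr2 lerDl.
by apply: sumr_ge0 => j _; rewrite -expr2 sqr_ge0.
Qed.

Lemma volume_uball_lty : (volume uball < +oo)%E.
Proof.
apply: (@le_lt_trans _ _ (volume [set x : 'rV[R]_n | forall i, `|x 0 i| <= 1])).
  apply: le_measure; rewrite ?inE; first exact: measurable_uball.
    exact: measurable_cube.
  by move=> x /= x1 i; exact: le_trans (coord_le_enorm x i) x1.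
by rewrite volume_cube// ltry.
Qed.

Lemma volume_uball_gt0 : (0 < volume uball)%E.
Proof.
(* A cube of half-side 1/(n+1) lies in the ball, as n/(n+1)^2 <= 1; taking n+1 instead of n keeps
   [r] positive in dimension 0. *)
pose r : R := n.+1%:R^-1.
have r0 : 0 < r by rewrite invr_gt0 ltr0n.
apply: (@lt_le_trans _ _ (volume [set x : 'rV[R]_n | forall i, `|x 0 i| <= r])).
  by rewrite volume_cube ?ltW// lte_fin exprn_gt0// mulr_gt0.
apply: le_measure; rewrite ?inE; [exact: measurable_cube|exact: measurable_uball|].
move=> x /= xr; rewrite /uball /= /enorm -sqrtr1 ler_wsqrtr//.
apply: (@le_trans _ _ (\sum_(i < n) r ^+ 2)).
  by apply: ler_sum => i _; rewrite -expr2 -real_normK ?num_real// lerXn2r ?nnegrE// ltW.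
rewrite sumr_const card_ord -mulr_natl /r expr2 mulrA.
have n1 : n%:R * n.+1%:R^-1 <= 1 :> R by rewrite ler_pdivrMr// mul1r ler_nat.
apply: (le_trans (ler_wpM2r _ n1)); first exact: ltW.
by rewrite mul1r invf_le1// ler1n.
Qed.

Lemma volume_uball : volume uball = (kappa R n)%:E.
Proof.
by rewrite fineK// ge0_fin_numE// ?volume_uball_lty.
Qed.

Lemma kappa_gt0 : 0 < kappa R n.
Proof. by rewrite -lte_fin -volume_uball volume_uball_gt0. Qed.

(* Integrating [1_B(x) g(x + y *m M)] over both variables in the two possible
   orders: translating [x] away gives [kappa * int g], translating [y] away gives
   [kappa * int g(y *m M)]. *)
Lemma ge0_integral_volume_mulmx M (g : 'rV[R]_n -> \bar R) :
  M *m M^T = 1%:M -> measurable_fun setT g -> (forall x, 0 <= g x)%E ->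
  (\int[@volume R n]_x g (x *m M) = \int[@volume R n]_x g x)%E.
Proof.
move=> MM mg g0.
pose b x : \bar R := (\1_uball x)%:E.
have b0 x : (0 <= b x)%E by rewrite lee_fin.
have mb : measurable_fun setT b.
  by apply/measurable_EFinP/measurable_indic; exact: measurable_uball.
have bN x : b (- x) = b x.
  rewrite /b !indicE (_ : (- x \in uball) = (x \in uball))//.
  by apply/idP/idP; rewrite !inE /uball /= enormN.
have bM x : b (x *m M) = b x.
  rewrite /b !indicE (_ : (x *m M \in uball) = (x \in uball))//.
  by apply/idP/idP; rewrite !inE /uball /= enorm_mulmx.
have ib : (\int[@volume R n]_x b x = (kappa R n)%:E)%E.
  rewrite /b (integral_indic _ measurableT measurable_uball) setIT.
  exact: volume_uball.
have MtM : M^T *m M = 1%:M by apply: mulmx1C.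
have mgM : measurable_fun setT (fun x => g (x *m M)).
  by apply: (measurableT_comp mg); exact: measurable_mulmx.
pose F (p : 'rV[R]_n * 'rV[R]_n) := (b p.1 * g (p.1 + p.2 *m M)%R)%E.
have mF : measurable_fun setT F.
  apply: emeasurable_funM; first exact: (measurableT_comp mb).
  apply: (measurableT_comp mg); apply: measurable_rowD => //.
  exact: (measurableT_comp (measurable_mulmx M)).
have F0 p : (0 <= F p)%E by rewrite mule_ge0.
suff kE : ((kappa R n)%:E * \int[@volume R n]_x g (x *m M) =
           (kappa R n)%:E * \int[@volume R n]_x g x)%E.
  have kk : ((kappa R n)^-1%:E * (kappa R n)%:E = 1)%E.
    by rewrite -EFinM mulVf// gt_eqF// kappa_gt0.
  by rewrite -[LHS]mul1e -kk -muleA kE muleA kk mul1e.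
have := @fubini_tonelli _ _ _ _ _ (@volume R n) (@volume R n) F mF F0.
rewrite /F /=.
under eq_integral => x _.
  rewrite ge0_integralZl//; last first.
    apply: (measurableT_comp mg); apply: measurable_rowD => //.
    exact: measurable_mulmx.
  under eq_integral => y _.
    rewrite (_ : x + y *m M = (y + x *m M^T) *m M); last first.
      by rewrite mulmxDl -mulmxA MtM mulmx1 addrC.
    over.
  rewrite (ge0_integral_volume_shift _ mgM)//.
  over.
rewrite ge0_integralZr//; last by apply: integral_ge0.
rewrite ib => ->.
under eq_integral => y _.
  rewrite -(ge0_integral_volume_shift (- (y *m M))); last 2 first.
  - apply: emeasurable_funM => //.
    by apply: (measurableT_comp mg); exact: measurable_rowD.
  - by move=> x; rewrite mule_ge0.
  under eq_integral => x _.
    rewrite subrK (_ : x - y *m M = - ((y - x *m M^T) *m M)); last first.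
      by rewrite mulmxBl -mulmxA MtM mulmx1 opprB.
    rewrite bN bM.
    over.
  over.
pose G (p : 'rV[R]_n * 'rV[R]_n) := (b (p.1 - p.2 *m M^T)%R * g p.2)%E.
have msh (z : 'rV[R]_n) : measurable_fun setT (fun y => b (y - z)).
  by apply: (measurableT_comp mb); exact: measurable_rowD.
have mG : measurable_fun setT G.
  apply: emeasurable_funM; last first.
    by apply: measurableT_comp mg _.
  apply: (measurableT_comp mb).
  under eq_fun => p do rewrite -mulmxN.
  apply: measurable_rowD => //.
  exact: (measurableT_comp (measurable_mulmx (- M^T))).
have G0 p : (0 <= G p)%E by rewrite mule_ge0.
have := @fubini_tonelli _ _ _ _ _ (@volume R n) (@volume R n) G mG G0.
rewrite /G /= => ->.
under eq_integral => x _.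
  rewrite ge0_integralZr// (ge0_integral_volume_shift _ mb)// ib.
  over.
by rewrite ge0_integralZl// lee_fin ltW// kappa_gt0.
Qed.

End orthogonal.

(** * Integration in polar coordinates *)

Section power_integrals.
Context (R : realType).
Local Open Scope ereal_scope.

Lemma continuous_exprn (k : nat) : continuous (fun x : R => x ^+ k)%R.
Proof. exact: exprn_continuous. Qed.

Lemma ge0_integral_pow0 (m : nat) (b : R) : (0 <= b)%R ->
  \int[lebesgue_measure]_(s in `[0%R, b]) (m.+1%:R * s ^+ m)%:E =
  (b ^+ m.+1)%:E :> \bar R.
Proof.
rewrite le_eqVlt => /predU1P[<-|b0].
  by rewrite set_itv1 integral_set1 expr0n.
rewrite (@continuous_FTC2 _ _ (fun x => x ^+ m.+1)%R _ _ b0).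
- by rewrite expr0n /= sube0.
- apply: continuous_subspaceT => x; apply: cvgM; first exact: cvg_cst.
  exact: continuous_exprn.
- split.
  + by move=> x _; exact: exprn_derivable.
  + by apply/cvg_at_right_filter; exact: continuous_exprn.
  + by apply/cvg_at_left_filter; exact: continuous_exprn.
- by move=> x _; exact: exp_derive1.
Qed.

Lemma ge0_integral_powy (m : nat) (a : R) : (0 < a)%R ->
  \int[lebesgue_measure]_(s in `[a, +oo[) (m.+1%:R * s ^- m.+2)%:E =
  (a ^- m.+1)%:E :> \bar R.
Proof.
move=> a0.
have dF (x : R) : (a <= x)%R ->
    is_derive x 1%R (fun x => - x ^- m.+1)%R (m.+1%:R * x ^- m.+2)%R.
  move=> ax; have x0 : (0 < x)%R := lt_le_trans a0 ax.
  have xm0 : (x ^+ m.+1 != 0)%R by rewrite expf_neq0// gt_eqF.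
  have dX : is_derive x 1%R (fun x : R => x ^+ m.+1)%R (m.+1%:R * x ^+ m)%R.
    apply: DeriveDef; first exact: exprn_derivable.
    by rewrite exp_derive [LHS]mulr1.
  apply: (is_derive_eq (is_deriveN (@is_deriveV _ (fun x => x ^+ m.+1)%R x _ _ xm0 dX))).
  rewrite scaleNr opprK /GRing.scale /= !exprS expr0.
  by field; rewrite expf_neq0 gt_eqF.
have cX k (x : R) : (a <= x)%R -> {for x, continuous (fun s : R => s ^- k)%R}.
  move=> ax; have x0 : (0 < x)%R := lt_le_trans a0 ax.
  apply: cvgV; first by rewrite expf_neq0// gt_eqF.
  exact: continuous_exprn.
rewrite (@ge0_continuous_FTC2y _ _ (fun x => - x ^- m.+1)%R _ 0%R).
- by rewrite sub0e EFinN oppeK.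
- move=> x ax; rewrite mulr_ge0// invr_ge0 exprn_ge0//.
  by rewrite (le_trans (ltW a0)).
- apply: continuous_in_subspaceT => x; rewrite inE /= in_itv /= andbT => ax.
  by apply: cvgM; [exact: cvg_cst|exact: cX].
- rewrite -oppr0; apply: cvgN.
  apply/gtr0_cvgV0; first by near=> x; rewrite exprn_gt0.
  apply/cvgryPge => A; near=> x.
  have x1 : (1 <= x)%R by near: x; exact: (nbhs_pinfty_ge (num_real _)).
  apply: (@le_trans _ _ x); first by near: x; exact: (nbhs_pinfty_ge (num_real _)).
  have x0 : (0 <= x)%R := le_trans ler01 x1.
  by rewrite exprS ler_peMr// exprn_ege1.
- by move=> x ax; case: (dF x (ltW ax)).
- by apply/cvg_at_right_filter; apply: cvgN; apply: cX.
- move=> x; rewrite in_itv /= andbT => ax; rewrite derive1E.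
  by case: (dF x (ltW ax)).
Unshelve. all: by end_near. Qed.

End power_integrals.

(** * The Gamma function at positive integers *)

Section gamma_function.
Context (R : realType).

(** This is m! times the Taylor polynomial of degree m of the exponential, so that
    [- (expR (- t) * gamma_poly m t)] is a primitive of [t ^+ m * expR (- t)]. *)
Fixpoint gamma_poly (m : nat) (t : R) : R :=
  if m is m'.+1 then m%:R * gamma_poly m' t + t ^+ m else 1.

Lemma gamma_poly0 m : gamma_poly m 0 = m`!%:R.
Proof.
elim: m => //= m ->; rewrite expr0n /= addr0 factS natrM//.
Qed.

Lemma is_derive_gamma_poly m t :
  is_derive t (1 : R) (gamma_poly m) (gamma_poly m t - t ^+ m).
Proof.
elim: m => [|m IHm] /=; first by rewrite expr0 subrr; exact: is_derive_cst.
have dX : is_derive t (1 : R) (fun x : R => x ^+ m.+1) (m.+1%:R * t ^+ m).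
  apply: DeriveDef; first exact: exprn_derivable.
  by rewrite exp_derive [LHS]mulr1.
apply: (is_derive_eq (is_deriveD (is_deriveZ m.+1%:R IHm) dX)).
by rewrite /GRing.scale /=; ring.
Qed.

(** Since e^t >= t^(m+1)/(m+1)!, the function is at most (m+1)!/t. *)
Lemma cvg_pow_expRN m : t ^+ m * expR (- t) @[t --> +oo] --> (0 : R).
Proof.
apply: (@squeeze_cvgr _ _ _ _ (cst 0) (fun t => m.+1`!%:R * t^-1)).
- near=> t; have t0 : 0 < t by near: t; exact: (nbhs_pinfty_gt (num_real _)).
  rewrite /cst mulr_ge0 ?expR_ge0 ?exprn_ge0 ?(ltW t0)//=.
  rewrite expRN ler_pdivrMr ?expR_gt0// mulrAC.
  rewrite ler_pdivlMr// -exprSr -ler_pdivrMl ?ltr0n ?fact_gt0// mulrC.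
  by apply: le_trans (expR_ge1Dxn m (ltW t0)); rewrite lerDr.
- exact: cvg_cst.
- rewrite -(mulr0 (m.+1`!%:R)); apply: cvgM; first exact: cvg_cst.
  apply/gtr0_cvgV0; last exact: cvg_id.
  exact: (nbhs_pinfty_gt (num_real _)).
Unshelve. all: by end_near. Qed.

Lemma cvg_gamma_poly m : expR (- t) * gamma_poly m t @[t --> +oo] --> (0 : R).
Proof.
elim: m => [|m IHm] /=.
  by under eq_fun do rewrite mulr1; exact: cvgr_expR.
under eq_fun => t do rewrite mulrDr mulrCA [expR _ * _ ^+ _]mulrC.
rewrite -[0]addr0; apply: cvgD; last exact: cvg_pow_expRN.
by rewrite -(mulr0 (m.+1%:R : R)); apply: cvgM IHm; exact: cvg_cst.
Qed.

Lemma ge0_integral_pow_expRN m :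
  (\int[lebesgue_measure]_(t in `[0%R, +oo[) (t ^+ m * expR (- t))%:E =
   (m`!%:R : R)%:E)%E.
Proof.
have dF (t : R) : is_derive t (1 : R)
    (fun t => - (expR (- t) * gamma_poly m t)) (t ^+ m * expR (- t)).
  have dN : is_derive t (1 : R) (fun t : R => expR (- t)) (- expR (- t)).
    apply: (is_derive_eq (@is_derive1_comp _ expR -%R t _ _ _ _)).
    by rewrite mulrN1.
  apply: (is_derive_eq (is_deriveN (is_deriveM dN (is_derive_gamma_poly m t)))).
  by rewrite /GRing.scale /=; ring.
have cF (t : R) : {for t, continuous (fun t => - (expR (- t) * gamma_poly m t))}.
  by apply/differentiable_continuous/derivable1_diffP; case: (dF t).
rewrite (@ge0_continuous_FTC2y _ _
  (fun t => - (expR (- t) * gamma_poly m t)) _ 0).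
- by rewrite oppr0 expR0 mul1r gamma_poly0 sub0e EFinN oppeK.
- by move=> t t0; rewrite mulr_ge0 ?expR_ge0// exprn_ge0.
- apply: continuous_subspaceT => t; apply: cvgM.
    exact: exprn_continuous.
  apply: (@continuous_comp _ _ _ -%R expR); first exact: oppr_continuous.
  exact: continuous_expR.
- by rewrite -[X in _ --> X]oppr0; apply: cvgN; exact: cvg_gamma_poly.
- by move=> t _; case: (dF t).
- exact/cvg_at_right_filter/cF.
- by move=> t _; rewrite derive1E; case: (dF t).
Qed.

Lemma euler_Gamma_fact m : euler_Gamma (m.+1%:R : R) = m`!%:R.
Proof.
rewrite /euler_Gamma /Rintegral.
rewrite (_ : integral _ _ _ = (m`!%:R)%:E)//.
rewrite -(ge0_integral_pow_expRN m).
rewrite -integral_itv_obnd_cbnd.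
  apply: eq_integral => t; rewrite inE /= in_itv /= andbT => t0.
  by rewrite -natr1 addrK powR_mulrn// ltW.
apply: measurable_funTS; apply/measurable_EFinP/measurable_funM.
  exact: measurable_funX.
by apply: (measurableT_comp (@measurable_expR R)); exact: measurable_funN.
Qed.

End gamma_function.

Section measurable_misc.
Context (R : realType).

Lemma measurable_fun_natb d (Z : measurableType d) (f : Z -> bool) :
  measurable_fun setT f -> measurable_fun setT (fun z => (f z)%:R : R).
Proof.
move=> mf; rewrite (_ : (fun _ => _) = fun z => if f z then 1 else 0 : R).
  exact: measurable_fun_ifT.
by apply/funext => z; case: (f z).
Qed.

(** Inversion is discontinuous at 0, so it is assembled from real powers on the two half-lines and
    the value 0 at 0. *)
Lemma measurable_inv : measurable_fun setT (@GRing.inv R).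
Proof.
rewrite (_ : GRing.inv = fun x : R => if 0 < x then x `^ (-1)
    else if x < 0 then - ((- x) `^ (-1)) else 0).
  apply: measurable_fun_ifT; first exact: measurable_fun_ltr.
    exact: measurable_powR.
  apply: measurable_fun_ifT; first exact: measurable_fun_ltr.
    apply: measurable_funN.
    by apply: (measurableT_comp (@measurable_powR R (-1))); exact: measurable_funN.
  exact: measurable_cst.
apply/funext => x; case: ltgtP => [x0|x0|<-]; last by rewrite invr0.
  by rewrite powR_inv1 ?ltW.
by rewrite powR_inv1 ?oppr_ge0 ?ltW// invrN opprK.
Qed.

Lemma measurable_expVn d (Z : measurableType d) (f : Z -> R) k :
  measurable_fun setT f -> measurable_fun setT (fun z => f z ^- k).
Proof.
move=> mf; apply: (measurableT_comp measurable_inv); exact: measurable_funX.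
Qed.

(** Tonelli's theorem and the substitutions are applied on whole spaces; this turns a domain of
    integration into a boolean factor. *)
Lemma integral_mkcondb d (Z : measurableType d) (mu : {measure set Z -> \bar R})
    (P : Z -> bool) (D : set Z) (f : Z -> \bar R) :
  (forall z, P z <-> D z) ->
  (\int[mu]_(z in D) f z = \int[mu]_z ((P z)%:R%:E * f z))%E.
Proof.
move=> PD; rewrite integral_mkcond; apply: eq_integral => z _.
rewrite patchE; case: (boolP (P z)) => Pz.
  by rewrite mul1e mem_set//; apply/PD.
by rewrite mul0e memNset// => /PD; exact/negP.
Qed.

End measurable_misc.

(** * Polar coordinates and homogeneous integrands *)

Section polar.
Context (R : realType) (m : nat).
Local Notation n := m.+1.
Local Notation V := 'rV[R]_n.
Local Open Scope ereal_scope.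

(* With [|y|^n \int_{s >= |y|} n s^(-n-1) ds = 1] inserted in the integral of
   [F], exchange the integrals, dilate by [s], and exchange back. *)
Lemma ge0_integral_polar (F : V -> \bar R) :
  measurable_fun setT F -> (forall x, 0 <= F x) -> F 0%R = 0 ->
  \int[@volume R n]_y F y =
  \int[@volume R n]_(x in @uball R n) ((enorm x ^+ n)%:E *
     \int[lebesgue_measure]_(s in `]0%R, +oo[) ((n%:R * s ^+ m)%:E * F (s *: x)%R)).
Proof.
move=> mF F0 F00.
pose H (p : R * V) : \bar R := (((0 < p.1) && (enorm p.2 <= p.1))%:R *
  (n%:R * p.1 ^- n.+1) * enorm p.2 ^+ n)%:E * F p.2.
pose K (p : R * V) : \bar R := (((0 < p.1) && (enorm p.2 <= 1))%:R *
  (n%:R * p.1 ^+ m) * enorm p.2 ^+ n)%:E * F (p.1 *: p.2)%R.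
have H0 p : 0 <= H p.
  rewrite /H; case: (ltP 0%R p.1) => [s0|_]; last by rewrite !mul0r mul0e.
  by rewrite mule_ge0// lee_fin !mulr_ge0// ?invr_ge0 exprn_ge0 ?enorm_ge0// ltW.
have K0 p : 0 <= K p.
  rewrite /K; case: (ltP 0%R p.1) => [s0|_]; last by rewrite !mul0r mul0e.
  by rewrite mule_ge0// lee_fin !mulr_ge0// exprn_ge0 ?enorm_ge0// ltW.
have mH : measurable_fun setT H.
  apply: emeasurable_funM; last exact: (measurableT_comp mF measurable_snd).
  apply/measurable_EFinP; apply: measurable_funM; last first.
    by apply: measurable_funX; exact: measurable_enorm.
  apply: measurable_funM.
    apply: measurable_fun_natb; apply: measurable_and.
      exact: measurable_fun_ltr.
    by apply: measurable_fun_ler => //; exact: measurable_enorm.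
  by apply: measurable_funM => //; exact: measurable_expVn.
have mK : measurable_fun setT K.
  apply: emeasurable_funM; last first.
    by apply: (measurableT_comp mF); exact: measurable_rowZ.
  apply/measurable_EFinP; apply: measurable_funM; last first.
    by apply: measurable_funX; exact: measurable_enorm.
  apply: measurable_funM.
    apply: measurable_fun_natb; apply: measurable_and.
      exact: measurable_fun_ltr.
    by apply: measurable_fun_ler => //; exact: measurable_enorm.
  by apply: measurable_funM => //; exact: measurable_funX.
transitivity (\int[@volume R n]_y \int[lebesgue_measure]_s H (s, y)).
  apply: eq_integral => y _; have [->|y0] := eqVneq y 0%R.
    by rewrite F00 integral0_eq// => s _; rewrite /H /= F00 mule0.
  have yp : (0 < enorm y)%R by rewrite enorm_gt0.
  under eq_integral do rewrite /H /= EFinM -muleA.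
  rewrite ge0_integralZr//; last 3 first.
  - apply/measurable_EFinP; apply: measurable_funM.
      apply: measurable_fun_natb; apply: measurable_and.
        exact: measurable_fun_ltr.
      exact: measurable_fun_ler.
    by apply: measurable_funM => //; exact: measurable_expVn.
  - move=> s _; case: (ltP 0%R s) => [s0|_]; last by rewrite !mul0r.
    by rewrite lee_fin !mulr_ge0// invr_ge0 exprn_ge0// ltW.
  - by rewrite mule_ge0// lee_fin exprn_ge0// ltW.
  under eq_integral do rewrite EFinM.
  rewrite [X in X * _](_ : _ = \int[lebesgue_measure]_(s in `[enorm y, +oo[)
      (n%:R * s ^- n.+1)%:E); last first.
    apply/esym/(@integral_mkcondb _ _ _ lebesgue_measure
      (fun s : R => (0 < s) && (enorm y <= s))%R) => s.
    rewrite /= in_itv /= andbT; split => [/andP[]//|ys].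
    by rewrite ys andbT (lt_le_trans yp).
  rewrite ge0_integral_powy// muleA -EFinM mulVf ?mul1e//.
  by rewrite expf_neq0// gt_eqF.
transitivity (\int[lebesgue_measure]_s \int[@volume R n]_y H (s, y)).
  by apply/esym/fubini_tonelli.
transitivity (\int[lebesgue_measure]_s \int[@volume R n]_x K (s, x)).
  apply: eq_integral => s _; have [s0|s0] := ltP 0%R s; last first.
    rewrite !integral0_eq// => x _; rewrite /K /H /= ltNge s0 /=.
      by rewrite !mul0r mul0e.
    by rewrite !mul0r mul0e.
  have mHs : measurable_fun setT (fun y => H (s, y)).
    exact: (measurableT_comp mH).
  rewrite (ge0_integral_volume_scale s0 mHs)//.
  rewrite -ge0_integralZl//; last 2 first.
  - apply: (measurableT_comp mHs); exact: measurable_rowZ.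
  - by rewrite lee_fin exprn_ge0// ltW.
  (* The Jacobian [s ^+ n] and the factor [s ^+ n] from [enorm (s *: x) ^+ n] turn [s ^- n.+1] into
     [s ^+ m], and [enorm y <= s] becomes [enorm x <= 1]. *)
  apply: eq_integral => x _; rewrite /H /K /= muleA -EFinM; congr (_%:E * _).
  rewrite enormZ gtr0_norm// s0 /= -[X in (_ <= X)%R]mulr1 ler_pM2l//.
  case: (_ <= _)%R; rewrite ?mul0r ?mulr0// !mul1r exprMn !exprS.
  by field; rewrite expf_neq0 ?gt_eqF.
transitivity (\int[@volume R n]_x \int[lebesgue_measure]_s K (s, x)).
  exact: fubini_tonelli.
rewrite [RHS](@integral_mkcondb _ _ _ (@volume R n) (fun x : V => enorm x <= 1)%R
  (@uball R n))//.
apply: eq_integral => x _; rewrite muleA -EFinM.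
rewrite (@integral_mkcondb _ _ _ lebesgue_measure (fun s : R => 0 < s)%R
  `]0%R, +oo[%classic); last first.
  by move=> s; rewrite /= in_itv /= andbT.
rewrite -ge0_integralZl//; last 3 first.
- apply: emeasurable_funM.
    by apply/measurable_EFinP/measurable_fun_natb; exact: measurable_fun_ltr.
  apply: emeasurable_funM.
    by apply/measurable_EFinP/measurable_funM => //; exact: measurable_funX.
  by apply: (measurableT_comp mF); exact: measurable_rowZ.
- move=> s _; case: (ltP 0%R s) => [s0|_]; last by rewrite mul0e.
  by rewrite !mule_ge0// lee_fin mulr_ge0// exprn_ge0// ltW.
- by rewrite lee_fin mulr_ge0// exprn_ge0// enorm_ge0.
apply: eq_integral => s _; rewrite /K /= !muleA -!EFinM; congr (_%:E * _).
by case: (0 < s)%R; case: (_ <= _)%R; rewrite /=; ring.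
Qed.

End polar.

Section polar_homogeneous.
Context (R : realType) (m : nat).
Local Notation n := m.+1.
Local Notation V := 'rV[R]_n.
Local Open Scope ereal_scope.

Lemma measurable_set1_row (a : V) : measurable [set a].
Proof.
rewrite (_ : [set a] = \bigcap_(i in [set: 'I_n])
    ((fun x : V => x 0%R i) @^-1` [set a 0%R i])); last first.
  apply/seteqP; split => [x -> i _ //|x H /=].
  by apply/rowP => i; exact: H.
apply: fin_bigcap_measurable => // i _.
by rewrite -[X in measurable X]setTI; exact: measurable_coord.
Qed.

(** Dilation by 2 fixes the origin and multiplies volume by 2^n > 1, so the finite volume of this
    set must vanish. *)
Lemma volume_set1_0 : volume [set 0%R : V] = 0.
Proof.
have m0 : measurable_fun setT (fun x : V => (\1_[set 0%R : V] x)%:E : \bar R).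
  by apply/measurable_EFinP/measurable_indic; exact: measurable_set1_row.
have E : \int[@volume R n]_x (\1_[set 0%R : V] x)%:E = volume [set 0%R : V].
  by rewrite integral_indic ?setIT//; exact: measurable_set1_row.
have vfin : volume [set 0%R : V] \is a fin_num.
  rewrite ge0_fin_numE//; apply: le_lt_trans (volume_uball_lty R n).
  apply: le_measure; rewrite ?inE; [exact: measurable_set1_row|exact: measurable_uball|].
  by move=> x ->; rewrite /uball /= enorm0.
have two0 : (0 < 2 :> R)%R by rewrite ltr0n.
have E2 : \int[@volume R n]_x (\1_[set 0%R : V] (2 *: x)%R)%:E = volume [set 0%R : V].
  rewrite -E; apply: eq_integral => x _; rewrite !indicE.
  rewrite (_ : (2 *: x \in [set 0])%R = (x \in [set 0]))%R//.
  apply/idP/idP; rewrite !inE /=; last by move->; rewrite scaler0.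
  by move=> /eqP; rewrite scaler_eq0 pnatr_eq0 => /eqP.
have i0 (x : V) : 0 <= (\1_[set 0%R : V] x)%:E :> \bar R by rewrite lee_fin.
have /eqP := ge0_integral_volume_scale two0 m0 i0.
rewrite E2 E -(fineK vfin) -EFinM eqe -subr_eq0 => vE; congr (_%:E).
have : (fine (volume [set 0 : V]) * (1 - 2 ^+ n) == 0)%R.
  by rewrite mulrBr mulr1 [X in (_ - X)%R]mulrC.
rewrite mulf_eq0 => /orP[/eqP//|].
by rewrite subr_eq0 eq_sym gt_eqF// exprn_egt1// ltr1n.
Qed.

(** On the ray through x the condition [N <= 1] reads [s <= (N x)^-1], so the radial integral is
    that of a power of [s]. With [G = 1] this gives the volume of a sublevel set; with [N] the
    Euclidean norm it changes the degree of [G]. *)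
Lemma ge0_integral_polar_homog (d : nat) (N G : V -> R) :
  measurable_fun setT N -> measurable_fun setT G ->
  (forall x, x != 0%R -> 0 < N x)%R -> (forall x, 0 <= G x)%R ->
  (forall s x, 0 < s -> N (s *: x) = s * N x)%R ->
  (forall s x, 0 < s -> G (s *: x) = s ^+ d * G x)%R ->
  \int[@volume R n]_(x in [set x | N x <= 1]%R) (G x)%:E =
  \int[@volume R n]_(x in @uball R n)
    (n%:R / (n + d)%:R * (enorm x ^+ n * N x ^- (n + d) * G x))%:E.
Proof.
move=> mN mG N0 G0 NZ GZ.
(* [ge0_integral_polar] asks for an integrand vanishing at 0; the change concerns a null set. *)
pose F (x : V) : \bar R := (((N x <= 1) && (x != 0))%:R * G x)%:E.
have mN1 : measurable [set x | N x <= 1]%R.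
  rewrite -[X in measurable X]setTI (_ : [set x | _] = N @^-1` `]-oo, 1%R]).
    exact: mN.
  by apply/seteqP; split => x /=; rewrite in_itv.
have mx0 : measurable_fun setT (fun x : V => x != 0%R).
  apply: (measurable_fun_bool true).
  rewrite setTI (_ : _ @^-1` _ = ~` [set 0%R : V]).
    by apply: measurableC; exact: measurable_set1_row.
  by apply/seteqP; split => x /=; [move=> /eqP|move=> /eqP ->].
have mF : measurable_fun setT F.
  apply/measurable_EFinP; apply: measurable_funM => //.
  apply: measurable_fun_natb; apply: measurable_and => //.
  by apply: measurable_fun_ler.
have F0 x : 0 <= F x by rewrite lee_fin mulr_ge0.
transitivity (\int[@volume R n]_x F x).
  rewrite (@integral_mkcondb _ _ _ (@volume R n) (fun x : V => N x <= 1)%R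
    [set x | N x <= 1]%R)//.
  apply: ge0_ae_eq_integral => //.
  - apply: emeasurable_funM.
      by apply/measurable_EFinP/measurable_fun_natb; exact: measurable_fun_ler.
    exact/measurable_EFinP.
  - by move=> x _; rewrite -EFinM lee_fin mulr_ge0.
  - exists [set 0%R]; split; [exact: measurable_set1_row|exact: volume_set1_0|].
    move=> x /=; apply: contra_notP => /eqP x0 _.
    by rewrite /F x0 andbT -EFinM.
rewrite (ge0_integral_polar mF F0); last by rewrite /F eqxx andbF mul0r.
apply: eq_integral => x _; have [->|x0] := eqVneq x 0%R.
  by rewrite enorm0 expr0n /= !mul0r mulr0 mul0e.
have Nx := N0 x x0.
rewrite [X in _ * X](_ : _ = \int[lebesgue_measure]_(s in `[0%R, (N x)^-1%R])
    ((n%:R / (n + d)%:R * G x)%:E * ((m + d).+1%:R * s ^+ (m + d))%:E)); last first.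
  rewrite -integral_itv_obnd_cbnd; last first.
    apply/measurable_EFinP; apply: measurable_funM => //.
    by apply: measurable_funM => //; exact: measurable_funX.
  rewrite (@integral_mkcondb _ _ _ lebesgue_measure (fun s : R => 0 < s)%R
    `]0%R, +oo[%classic); last first.
    by move=> s; rewrite /= in_itv /= andbT.
  rewrite (@integral_mkcondb _ _ _ lebesgue_measure
    (fun s : R => (0 < s) && (s <= (N x)^-1))%R
    `]0%R, (N x)^-1%R]%classic); last first.
    by move=> s; rewrite /= in_itv.
  apply: eq_integral => s _; rewrite -!EFinM; congr _%:E.
  case: (ltP 0%R s) => s0 /=; last by rewrite !mul0r.
  rewrite NZ// GZ// scaler_eq0 negb_or x0 gt_eqF//= andbT.
  rewrite -ler_pdivlMr// div1r; case: (_ <= _)%R; last by rewrite !mul0r !mulr0.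
  have : (m + d).+1%:R != 0%R :> R by rewrite pnatr_eq0.
  by rewrite !mul1r exprD addSn; move: ((m + d).+1%:R : R) => c c0; field.
rewrite ge0_integralZl//; last 3 first.
- by apply/measurable_EFinP; apply: measurable_funM => //; exact: measurable_funX.
- move=> s; rewrite /= in_itv /= => /andP[s0 _].
  by rewrite lee_fin mulr_ge0// exprn_ge0.
- by rewrite lee_fin !mulr_ge0// invr_ge0.
rewrite ge0_integral_pow0; last by rewrite invr_ge0 ltW.
rewrite -!EFinM; congr _%:E; rewrite exprVn addSn.
ring.
Qed.

Lemma volume_sublevel (N : V -> R) : measurable_fun setT N ->
  (forall x, x != 0%R -> 0 < N x)%R ->
  (forall s x, 0 < s -> N (s *: x) = s * N x)%R ->
  volume [set x | N x <= 1]%R =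
  \int[@volume R n]_(x in @uball R n) (enorm x ^+ n * N x ^- n)%:E.
Proof.
move=> mN N0 NZ.
have mN1 : measurable [set x | N x <= 1]%R.
  rewrite -[X in measurable X]setTI (_ : [set x | _] = N @^-1` `]-oo, 1%R]).
    exact: mN.
  by apply/seteqP; split => x /=; rewrite in_itv.
transitivity (\int[@volume R n]_(x in [set x | N x <= 1]%R) 1%:E).
  by rewrite integral_cst// mul1e.
rewrite (@ge0_integral_polar_homog 0 N (fun=> 1%R))//; last first.
  by move=> s x _; rewrite expr0 mul1r.
by apply: eq_integral => x _; rewrite addn0 divff// mul1r mulr1.
Qed.

(** Slicing evaluates integrals of homogeneous functions such as |x|u^perp|, whereas the means
    wanted are of their quotients by |x|^d; only a dimensional constant separates the two. *)
Lemma ge0_integral_uball_homog (d : nat) (G : V -> R) :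
  measurable_fun setT G -> (forall x, 0 <= G x)%R ->
  (forall s x, 0 < s -> G (s *: x) = s ^+ d * G x)%R ->
  \int[@volume R n]_(x in @uball R n) (G x)%:E =
  (n%:R / (n + d)%:R)%:E *
  \int[@volume R n]_(x in @uball R n) (enorm x ^- d * G x)%:E.
Proof.
move=> mG G0 GZ.
have mE : measurable_fun setT (fun x : V => enorm x) by exact: measurable_enorm.
rewrite (@ge0_integral_polar_homog d (@enorm R n) G)//; last 2 first.
- by move=> x; rewrite enorm_gt0.
- by move=> s x s0; rewrite enormZ gtr0_norm.
rewrite -ge0_integralZl//; last 3 first.
- exact: measurable_uball.
- apply: measurable_funTS; apply/measurable_EFinP/measurable_funM => //.
  exact: measurable_expVn.
- by move=> x _; rewrite lee_fin mulr_ge0// invr_ge0 exprn_ge0// enorm_ge0.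
have mf1 : measurable_fun setT (fun x : V =>
    (n%:R / (n + d)%:R * (enorm x ^+ n * enorm x ^- (n + d) * G x))%:E).
  apply/measurable_EFinP/measurable_funM => //; apply: measurable_funM => //.
  by apply: measurable_funM; [exact: measurable_funX|exact: measurable_expVn].
have mf2 : measurable_fun setT (fun x : V =>
    (n%:R / (n + d)%:R)%:E * (enorm x ^- d * G x)%:E).
  apply: emeasurable_funM => //; apply/measurable_EFinP/measurable_funM => //.
  exact: measurable_expVn.
apply: ge0_ae_eq_integral => //.
- exact: measurable_uball.
- exact: measurable_funTS.
- exact: measurable_funTS.
- move=> x _; rewrite lee_fin !mulr_ge0// ?invr_ge0 ?exprn_ge0 ?enorm_ge0//.
- move=> x _; rewrite -EFinM lee_fin !mulr_ge0// ?invr_ge0 ?exprn_ge0 ?enorm_ge0//.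
exists [set 0%R]; split; [exact: measurable_set1_row|exact: volume_set1_0|].
move=> x /=; apply: contra_notP => /eqP x0 _.
have xn : (enorm x ^+ n != 0)%R by rewrite expf_neq0// enorm_eq0.
have xd : (enorm x ^+ d != 0)%R by rewrite expf_neq0// enorm_eq0.
rewrite -EFinM exprD; congr (_ * (_ * _))%:E.
by field; rewrite xn xd.
Qed.

End polar_homogeneous.

(** * Slices of the unit ball *)

Section ball_slices.
Context (R : realType).
Local Open Scope ereal_scope.

Lemma enorm_le1 n (x : 'rV[R]_n) : (enorm x <= 1)%R = (dot x x <= 1)%R.
Proof. by rewrite -{1}sqrtr1 ler_sqrt. Qed.

Lemma measurable_sqrt1B (k : nat) :
  measurable_fun setT (fun t : R => Num.sqrt (1 - t ^+ 2) ^+ k)%R.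
Proof.
apply: measurable_funX; apply: (measurableT_comp (@measurable_sqrt R)).
by apply: measurable_funB => //; exact: measurable_funX.
Qed.

Lemma sqrt1B_gt0 (t : R) : t \in `]-1, 1[%R -> (0 < Num.sqrt (1 - t ^+ 2))%R.
Proof.
rewrite in_itv /= => /andP[t1 t2]; rewrite sqrtr_gt0 subr_gt0.
by rewrite -[ltRHS](expr1n _ 2) -[ltLHS]real_normK ?num_real// ltr_pXn2r ?nnegrE// ltr_norml t1.
Qed.

(** The slice at height [t] is a ball of radius r = sqrt (1 - t^2); dilating it to the unit ball
    yields r^n from the volume and r^d from [g]. *)
Lemma ge0_integral_uball_slice n (d : nat) (phi : R -> R) (g : 'rV[R]_n -> R) :
  measurable_fun setT phi -> measurable_fun setT g ->
  (forall t, 0 <= phi t)%R -> (forall x, 0 <= g x)%R ->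
  (forall s x, 0 < s -> g (s *: x) = s ^+ d * g x)%R ->
  \int[@volume R n.+1]_(x in @uball R n.+1)
    (phi (x 0 0) * g (\row_i x 0 (lift 0 i)))%:E =
  \int[lebesgue_measure]_(t in `](-1)%R, 1%R[)
    (phi t * Num.sqrt (1 - t ^+ 2) ^+ (n + d))%:E *
  \int[@volume R n]_(x in @uball R n) (g x)%:E.
Proof.
move=> mphi mg phi0 g0 gZ.
pose F (x : 'rV[R]_n.+1) : \bar R := ((enorm x <= 1)%R%:R)%:E *
  (phi (x 0%R 0%R) * g (\row_i x 0 (lift 0 i)))%:E.
have mF : measurable_fun setT F.
  apply: emeasurable_funM.
    apply/measurable_EFinP/measurable_fun_natb; apply: measurable_fun_ler => //.
    exact: measurable_enorm.
  apply/measurable_EFinP/measurable_funM.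
    by apply: (measurableT_comp mphi); exact: measurable_coord.
  apply: (measurableT_comp mg); apply: measurable_rowP => i.
  by under eq_fun do rewrite mxE; exact: measurable_coord.
have F0 x : 0 <= F x by rewrite /F -EFinM lee_fin !mulr_ge0.
rewrite (@integral_mkcondb _ _ _ (@volume R n.+1) (fun x : 'rV[R]_n.+1 => enorm x <= 1)%R
  (@uball R n.+1))//.
rewrite [LHS](ge0_integral_slice mF F0).
rewrite -ge0_integralZr//; last 3 first.
- apply: measurable_funTS; apply/measurable_EFinP/measurable_funM => //.
  exact: measurable_sqrt1B.
- by move=> t _; rewrite lee_fin mulr_ge0// exprn_ge0// sqrtr_ge0.
- by apply: integral_ge0 => x _; rewrite lee_fin.
transitivity (\int[lebesgue_measure]_(t in `[(-1)%R, 1%R])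
   \int[@volume R n]_y F (row_cons (t, y))).
  rewrite [RHS](@integral_mkcondb _ _ _ lebesgue_measure
    (fun t : R => `|t| <= 1)%R)//; last first.
    by move=> t; rewrite /= in_itv /= ler_norml.
  apply: eq_integral => t _; have [t1|t1] := leP `|t|%R 1%R; rewrite ?mul1e//.
  rewrite mul0e integral0_eq// => y _; rewrite /F enorm_le1 dot_row_cons /=.
  rewrite [(_ <= 1)%R]lt_geF ?mul0e// ltr_wpDr ?dot_ge0//.
  by rewrite -expr2 -real_normK ?num_real// exprn_egt1.
(* Without the endpoints the radius is positive, as the dilation requires. *)
rewrite integral_itv_bndoo; last first.
  apply: measurable_funTS; exact: (measurable_slice mF F0).
apply: eq_integral => t; rewrite inE => t1.
have r0 := sqrt1B_gt0 t1; set r := Num.sqrt _ in r0 *.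
have rE : (r ^+ 2 = 1 - t ^+ 2)%R by rewrite sqr_sqrtr// ltW// -sqrtr_gt0.
have mFt : measurable_fun setT (fun y => F (row_cons (t, y))).
  by apply: (measurableT_comp mF); exact: measurable_row_consr.
rewrite (ge0_integral_volume_scale r0 mFt)//.
rewrite (@integral_mkcondb _ _ _ (@volume R n) (fun x : 'rV[R]_n => enorm x <= 1)%R
  (@uball R n))//.
rewrite (_ : (phi t * r ^+ (n + d))%:E = (r ^+ n)%:E * (phi t * r ^+ d)%:E); last first.
  by rewrite -EFinM exprD; congr _%:E; ring.
rewrite -muleA; congr (_ * _).
have mgb : measurable_fun setT (fun y : 'rV[R]_n => ((enorm y <= 1)%R%:R)%:E * (g y)%:E).
  apply: emeasurable_funM; last exact/measurable_EFinP.
  apply/measurable_EFinP/measurable_fun_natb; apply: measurable_fun_ler => //.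
  exact: measurable_enorm.
have gb0 y : 0 <= ((enorm y <= 1)%R%:R)%:E * (g y)%:E by rewrite -EFinM lee_fin mulr_ge0.
rewrite -ge0_integralZl//; last first.
  by rewrite lee_fin mulr_ge0// exprn_ge0// ltW.
apply: eq_integral => x _; rewrite /F enorm_le1 dot_row_cons /= row_cons0 /=.
rewrite dotZl dotZr (_ : (\row_i _)%R = r *: x)%R; last first.
  by apply/rowP => i; rewrite mxE row_consS.
rewrite gZ// -!EFinM; congr _%:E.
rewrite mulrA -!expr2 rE -lerBrDl ger_pMr; last by rewrite -rE exprn_gt0.
by rewrite enorm_le1; ring.
Qed.

(** Slicing the unit ball itself. All that is needed about [kappa] follows from these integrals,
    with no closed formula for it. *)
Lemma integral_sqrt1B (k : nat) :
  \int[lebesgue_measure]_(t in `](-1)%R, 1%R[) (Num.sqrt (1 - t ^+ 2) ^+ k)%:E =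
  (kappa R k.+1 / kappa R k)%:E.
Proof.
have H : \int[@volume R k.+1]_(x in @uball R k.+1) (1 * 1)%:E =
    \int[lebesgue_measure]_(t in `](-1)%R, 1%R[)
      (1 * Num.sqrt (1 - t ^+ 2) ^+ (k + 0))%:E *
    \int[@volume R k]_(x in @uball R k) 1%:E.
  apply: (@ge0_integral_uball_slice k 0 (fun=> 1%R) (fun=> 1%R)) => //.
  by move=> s x _; rewrite mulr1.
have {}H : (kappa R k.+1)%:E =
   \int[lebesgue_measure]_(t in `](-1)%R, 1%R[) (Num.sqrt (1 - t ^+ 2) ^+ k)%:E *
   (kappa R k)%:E.
  move: H; rewrite mulr1 !integral_cst; [|exact: measurable_uball..].
  rewrite /= !mul1e !volume_uball addn0 => ->; congr (_ * _).
  by apply: eq_integral => t _; rewrite mul1r.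
have k0 := kappa_gt0 R k.
by rewrite EFinM H -muleA -EFinM mulfV ?mule1// gt_eqF.
Qed.

(** The radius sqrt (1 - t^2) is at most 1, so its powers decrease. *)
Lemma kappa_ratio_le k :
  (kappa R k.+2 / kappa R k.+1 <= kappa R k.+1 / kappa R k)%R.
Proof.
have ms j : measurable_fun (`](-1)%R, 1%R[%classic : set R)
    (fun t : R => (Num.sqrt (1 - t ^+ 2) ^+ j)%:E : \bar R).
  by apply: measurable_funTS; apply/measurable_EFinP; exact: measurable_sqrt1B.
rewrite -lee_fin -!integral_sqrt1B.
apply: ge0_le_integral => //; [exact: ms|exact: ms|].
move=> t _; rewrite lee_fin exprS ler_piMl ?exprn_ge0 ?sqrtr_ge0//.
by rewrite -[leRHS]sqrtr1 ler_wsqrtr// gerBl sqr_ge0.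
Qed.

(** Writing t^2 = 1 - (1 - t^2) leaves the difference of two Wallis integrals, of exponents n and n
    + 2. *)
Lemma ge0_integral_uball_coord0_sqr n :
  \int[@volume R n.+1]_(x in @uball R n.+1) (x 0 0 ^+ 2)%:E =
  (kappa R n.+1 - kappa R n.+3 / kappa R n.+2 * kappa R n)%:E.
Proof.
have mt2 : measurable_fun setT (fun t : R => t ^+ 2)%R by exact: measurable_funX.
have H : \int[@volume R n.+1]_(x in @uball R n.+1) (x 0 0 ^+ 2 * 1)%:E =
    \int[lebesgue_measure]_(t in `](-1)%R, 1%R[)
      (t ^+ 2 * Num.sqrt (1 - t ^+ 2) ^+ (n + 0))%:E *
    \int[@volume R n]_(x in @uball R n) 1%:E.
  apply: (@ge0_integral_uball_slice n 0 (fun t => t ^+ 2)%R (fun=> 1%R)) => //.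
    by move=> t; exact: sqr_ge0.
  by move=> s x _; rewrite mulr1.
rewrite integral_cst in H; last exact: measurable_uball.
rewrite /= mul1e volume_uball addn0 in H.
under eq_integral do rewrite -[X in X%:E]mulr1.
rewrite {}H.
have ms k : measurable_fun setT
    (fun t : R => (Num.sqrt (1 - t ^+ 2) ^+ k)%:E : \bar R).
  by apply/measurable_EFinP; exact: measurable_sqrt1B.
have E : \int[lebesgue_measure]_(t in `](-1)%R, 1%R[)
      (t ^+ 2 * Num.sqrt (1 - t ^+ 2) ^+ n)%:E + (kappa R n.+3 / kappa R n.+2)%:E
    = (kappa R n.+1 / kappa R n)%:E.
  rewrite -!integral_sqrt1B -ge0_integralD//; last 3 first.
  - by move=> t _; rewrite lee_fin mulr_ge0 ?sqr_ge0// exprn_ge0// sqrtr_ge0.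
  - apply: measurable_funTS; apply/measurable_EFinP/measurable_funM => //.
    exact: measurable_sqrt1B.
  - exact: (measurable_funTS (ms n.+2)).
  apply: eq_integral => t; rewrite inE => /sqrt1B_gt0 r0.
  have rE : (Num.sqrt (1 - t ^+ 2) ^+ 2 = 1 - t ^+ 2)%R.
    by rewrite sqr_sqrtr// ltW// -sqrtr_gt0.
  by rewrite -EFinD; congr _%:E; rewrite (exprD (Num.sqrt _) 2 n) rE; ring.
have k0 := kappa_gt0 R n.
rewrite -[X in X * _](@addeK _ (kappa R n.+3 / kappa R n.+2)%:E)// E.
by rewrite -EFinB -EFinM mulrBl divfK// gt_eqF.
Qed.

End ball_slices.

(** * Reflections and rotation invariance *)

Section rotations.
Context (R : realType) (n : nat).
Implicit Types (e u x : 'rV[R]_n).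

(** The reflection in the hyperplane orthogonal to u - e exchanges the two unit vectors; if they
    coincide, the identity serves. *)
Lemma householder e u : dot e e = 1 -> dot u u = 1 ->
  exists2 M : 'M[R]_n, M *m M^T = 1%:M & e *m M = u.
Proof.
move=> e1 u1; pose w := u - e.
have wwE : dot w w = 2 - 2 * dot e u.
  by rewrite /w dotDl !dotDr -scaleN1r !dotZl !dotZr e1 u1 (dotC u e); ring.
have [w0|w0] := eqVneq w 0.
  exists 1%:M; first by rewrite trmx1 mulmx1.
  by rewrite mulmx1; apply/esym/eqP; rewrite -subr_eq0; exact/eqP.
have ww0 : dot w w != 0 by rewrite dot_eq0.
have wew x : x *m (w^T *m w) = dot x w *: w.
  by rewrite mulmxA [x *m _]mx11_scalar mul_scalar_mx -dotE.
pose c := 2 / dot w w.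
pose W := w^T *m w.
have WT : W^T = W by rewrite /W trmx_mul trmxK.
have WW : W *m W = dot w w *: W.
  by rewrite {1}/W -mulmxA /W wew -scalemxAr.
exists (1%:M - c *: W); last first.
  rewrite mulmxBr mulmx1 -scalemxAr wew scalerA.
  have -> : c * dot e w = -1.
    have -> : dot e w = - (dot w w / 2).
      by rewrite wwE /w dotDr -scaleN1r dotZr e1; field.
    by rewrite /c; field.
  by rewrite scaleN1r opprK /w addrC subrK.
have -> : (1%:M - c *: W)^T = 1%:M - c *: W.
  by rewrite [LHS]raddfB /= trmx1 [X in _ - X]linearZ /= -/W WT.
rewrite mulmxBr mulmx1 mulmxBl mul1mx.
rewrite -scalemxAl -scalemxAr WW !scalerA.
have -> : c * c * dot w w = c + c by rewrite /c; field.
by rewrite scalerDl opprB addrK subrK.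
Qed.

Local Open Scope ereal_scope.

(** The length |x|u^perp| is a function of |x| and x.u, and an orthogonal map taking e to u
    preserves the ball and its volume. *)
Lemma ge0_integral_uball_rotation (h : R -> R -> \bar R) e u :
  dot e e = 1%R -> dot u u = 1%R -> (forall a b, 0 <= h a b) ->
  (forall v, measurable_fun setT (fun x : 'rV[R]_n => h (enorm x) (dot x v))) ->
  \int[@volume R n]_(x in @uball R n) h (enorm x) (dot x u) =
  \int[@volume R n]_(x in @uball R n) h (enorm x) (dot x e).
Proof.
move=> e1 u1 h0 mh; have [M MM eM] := householder e1 u1.
rewrite !(@integral_mkcondb _ _ _ (@volume R n)
  (fun x : 'rV[R]_n => enorm x <= 1)%R (@uball R n))//.
rewrite -(ge0_integral_volume_mulmx MM); last 2 first.
- apply: emeasurable_funM; last exact: mh.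
  apply/measurable_EFinP/measurable_fun_natb; apply: measurable_fun_ler => //.
  exact: measurable_enorm.
- by move=> x; rewrite mule_ge0.
by apply: eq_integral => x _; rewrite enorm_mulmx// -eM dot_mulmx.
Qed.

End rotations.

(** * Wallis' recursion for the volumes of balls *)

Section kappa_recursion.
Context (R : realType).
Local Open Scope ereal_scope.

Lemma ge0_integral_uball_neq0 n (f g : 'rV[R]_n.+1 -> \bar R) :
  measurable_fun setT f -> measurable_fun setT g ->
  (forall x, 0 <= f x) -> (forall x, 0 <= g x) ->
  (forall x, x != 0%R -> f x = g x) ->
  \int[@volume R n.+1]_(x in @uball R n.+1) f x =
  \int[@volume R n.+1]_(x in @uball R n.+1) g x.
Proof.
move=> mf mg f0 g0 fg; apply: ge0_ae_eq_integral => //.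
- exact: measurable_uball.
- exact: measurable_funTS.
- exact: measurable_funTS.
exists [set 0%R]; split; [exact: measurable_set1_row|exact: volume_set1_0|].
by move=> x /=; apply: contra_notP => /eqP x0 _; exact: fg.
Qed.

Lemma ge0_integral_uball_enorm n d :
  \int[@volume R n.+1]_(x in @uball R n.+1) (enorm x ^+ d)%:E =
  (n.+1%:R / (n.+1 + d)%:R * kappa R n.+1)%:E.
Proof.
have mE k : measurable_fun setT (fun x : 'rV[R]_n.+1 => enorm x ^+ k)%R.
  by apply: measurable_funX; exact: measurable_enorm.
rewrite (@ge0_integral_uball_homog _ _ d)//.
- rewrite [RHS]EFinM; congr (_ * _).
  rewrite (@ge0_integral_uball_neq0 _ _ (cst 1%:E)).
  + rewrite integral_cst; last exact: measurable_uball.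
    by rewrite /= mul1e volume_uball.
  + apply/measurable_EFinP/measurable_funM => //.
    by apply: measurable_expVn; exact: measurable_enorm.
  + exact: measurable_cst.
  + by move=> x; rewrite lee_fin mulr_ge0// ?invr_ge0 exprn_ge0// enorm_ge0.
  + by move=> x; rewrite lee_fin.
  + by move=> x x0; rewrite mulVf// expf_neq0// enorm_eq0.
- by move=> x; rewrite exprn_ge0// enorm_ge0.
- by move=> s x s0; rewrite enormZ gtr0_norm// exprMn.
Qed.

Lemma dot_delta n (x : 'rV[R]_n) i : dot x (delta_mx 0 i)%R = x 0%R i.
Proof.
rewrite /dot (bigD1 i)//= big1 => [|j /negPf ji].
  by rewrite mxE !eqxx mulr1 addr0.
by rewrite mxE ji andbF mulr0.
Qed.

(** By rotation invariance all coordinates have the same second moment, and these add up to the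
    integral of |x|^2. *)
Lemma ge0_integral_uball_coord_sqr n :
  \int[@volume R n.+1]_(x in @uball R n.+1) (x 0 0 ^+ 2)%:E =
  (kappa R n.+1 / n.+3%:R)%:E.
Proof.
set I := (X in X = _).
have mc v : measurable_fun setT (fun x : 'rV[R]_n.+1 => (dot x v ^+ 2)%:E : \bar R).
  by apply/measurable_EFinP/measurable_funX; exact: measurable_dot.
have Ii (i : 'I_n.+1) :
    \int[@volume R n.+1]_(x in @uball R n.+1) (x 0 i ^+ 2)%:E = I.
  under eq_integral do rewrite -dot_delta.
  rewrite (@ge0_integral_uball_rotation _ _ (fun _ b => (b ^+ 2)%:E) (delta_mx 0 0)%R).
  - by apply: eq_integral => x _; rewrite dot_delta.
  - by rewrite dot_delta mxE !eqxx.
  - by rewrite dot_delta mxE !eqxx.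
  - by move=> a b; rewrite lee_fin sqr_ge0.
  - exact: mc.
have : n.+1%:R%:E * I = (n.+1%:R / (n.+1 + 2)%:R * kappa R n.+1)%:E.
  rewrite -ge0_integral_uball_enorm.
  under [RHS]eq_integral do rewrite enorm_sqr /dot -sumEFin.
  rewrite ge0_integral_sum//; last 3 first.
  - exact: measurable_uball.
  - move=> i; apply: measurable_funTS; apply/measurable_EFinP.
    by apply: measurable_funM; exact: measurable_coord.
  - by move=> i x _; rewrite lee_fin -expr2 sqr_ge0.
  under [RHS]eq_bigr do under eq_integral do rewrite -expr2.
  under [RHS]eq_bigr do rewrite Ii.
  (* The value found by slicing only serves to add the equal terms as real numbers. *)
  rewrite /I ge0_integral_uball_coord0_sqr.
  by rewrite sumEFin sumr_const card_ord -EFinM mulr_natl.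
move=> /(congr1 (fun z => n.+1%:R^-1%:E * z)).
rewrite muleA -!EFinM mulVf ?pnatr_eq0// mul1e => ->; congr _%:E.
by rewrite !mulrA mulVf ?pnatr_eq0// mul1r addn2 mulrC.
Qed.

Local Open Scope ring_scope.

Definition kappa_ratio k : R := kappa R k.+1 / kappa R k.
Local Notation b := kappa_ratio.

(** The second moment of a coordinate was computed by slicing and by symmetry; equating the two
    results gives the recursion. *)
Lemma kappa_wallis k : b k.+2 = k.+2%:R / k.+3%:R * b k.
Proof.
have := ge0_integral_uball_coord_sqr k.
rewrite ge0_integral_uball_coord0_sqr => -[].
rewrite -/(kappa_ratio k.+2) => E; have k0 : kappa R k != 0 by rewrite gt_eqF// kappa_gt0.
have k3 : k.+3%:R != 0 :> R by rewrite pnatr_eq0.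
have -> : b k.+2 = (kappa R k.+1 - kappa R k.+1 / k.+3%:R) / kappa R k.
  by rewrite -E opprB addrC subrK mulfK.
rewrite /kappa_ratio; move: (kappa R k.+1) (kappa R k) k0 => x y y0.
have -> : k.+2%:R = k.+3%:R - 1 :> R by rewrite -[k.+3%:R]natr1 addrK.
by move: k.+3%:R k3 => c c0; field; rewrite y0 c0.
Qed.

Lemma kappa_ratio_gt0 k : 0 < b k.
Proof. by rewrite divr_gt0// kappa_gt0. Qed.

(* By Wallis' recursion [r k / c k], where [c k <= r k] is the claim,
   decreases when [k] grows by two, while [r k >= 1] and [c k] tends to 1. *)
Lemma kappa_ratio_lb k : 1 + (2 * k.+2%:R)^-1 <= b k / b k.+1.
Proof.
pose r j := b j / b j.+1; pose c (j : nat) : R := 1 + (2 * j.+2%:R)^-1.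
have r1 j : 1 <= r j.
  by rewrite /r ler_pdivlMr ?kappa_ratio_gt0// mul1r; exact: kappa_ratio_le.
have c0 j : 0 < c j by rewrite addr_gt0// invr_gt0 mulr_gt0.
have rS j : r j.+2 <= r j * (c j.+2 / c j).
  have -> : r j.+2 = r j * (j.+2%:R * j.+4%:R / j.+3%:R ^+ 2).
    rewrite /r (kappa_wallis j) (kappa_wallis j.+1).
    have := kappa_ratio_gt0 j; have := kappa_ratio_gt0 j.+1.
    move: (b j) (b j.+1) => x y x0 y0.
    by field; rewrite ?pnatr_eq0 !gt_eqF.
  rewrite ler_pM2l; last exact: lt_le_trans (r1 j).
  rewrite /c -[j.+4]addn4 -[j.+3]addn3 -[j.+2]addn2 !natrD.
  have : 0 <= j%:R :> R by [].
  move: (j%:R : R) => x x0; rewrite -subr_ge0.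
  have -> : (1 + (2 * (x + 4))^-1) / (1 + (2 * (x + 2))^-1) -
     (x + 2) * (x + 4) / (x + 3) ^+ 2 =
     (x + 2) / ((x + 4) * (2 * x + 5) * (x + 3) ^+ 2).
    by field; rewrite !gt_eqF//; lra.
  rewrite divr_ge0 ?mulr_ge0 ?sqr_ge0//; lra.
rewrite leNgt; apply/negP => rc.
pose q := r k / c k.
have q1 : q < 1 by rewrite /q ltr_pdivrMr// mul1r.
have q0 : 0 < q by rewrite divr_gt0// (lt_le_trans ltr01).
have rq j : r (k + j.*2)%N <= q * c (k + j.*2)%N.
  elim: j => [|j IHj]; first by rewrite addn0 /q divfK// gt_eqF.
  rewrite doubleS !addnS; apply: le_trans (rS _) _.
  have -> : q * c (k + j.*2)%N.+2 =
      q * c (k + j.*2)%N * (c (k + j.*2)%N.+2 / c (k + j.*2)%N).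
    by rewrite -mulrA; congr (_ * _); rewrite mulrCA divff ?mulr1// gt_eqF.
  by rewrite ler_pM2r// divr_gt0.
(* For [j] beyond q/(1-q) the bound [q * c (k + j.*2)] drops below 1, against [r1]. *)
have := Num.Theory.archi_boundP (ltW (divr_gt0 q0 (_ : 0 < 1 - q))).
rewrite subr_gt0 => /(_ q1); set j := Num.bound _ => jq.
have := le_trans (r1 (k + j.*2)%N) (rq j); apply/negP; rewrite -ltNge.
rewrite /c mulrDr mulr1 -ltrBrDl ltr_pdivrMr ?mulr_gt0//.
move: jq; rewrite ltr_pdivrMr ?subr_gt0// => /lt_le_trans; apply.
rewrite mulrC ler_pM2l ?subr_gt0// -natrM ler_nat.
by rewrite mulnS; lia.
Qed.

End kappa_recursion.

Lemma enorm_proj_perp (R : realType) n (u x : 'rV[R]_n) : dot u u = 1 ->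
  enorm (proj_perp u x) = Num.sqrt (enorm x ^+ 2 - dot x u ^+ 2).
Proof.
move=> u1; rewrite enorm_sqr /enorm /proj_perp; congr Num.sqrt.
rewrite -scaleNr !(dotDl, dotDr, dotZl, dotZr) u1 (dotC u x); ring.
Qed.

(** * The mean of |x|u^perp|/|x| over the ball *)

Section projection_mean.
Context (R : realType) (m : nat).
Local Notation n := m.+2.
Local Notation V := 'rV[R]_n.

(** The quotient is the one that [kappa_ratio_lb] bounds from below. *)
Lemma gammaE : gamma R n =
  m.+1%:R * ((kappa R m.+1 / kappa R m) / (kappa R n / kappa R m.+1)).
Proof.
rewrite /gamma /= -[n%:R]natr1 addrK.
have := kappa_gt0 R m; have := kappa_gt0 R m.+1; have := kappa_gt0 R n.
move: (kappa R n) (kappa R m.+1) (kappa R m) => x y z x0 y0 z0.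
by field; rewrite !gt_eqF.
Qed.

Lemma gamma_lb : m.+1%:R * (1 + (2 * n%:R)^-1) <= gamma R n.
Proof. by rewrite gammaE ler_pM2l// kappa_ratio_lb. Qed.

Local Open Scope ereal_scope.

(** After a rotation of u to the first basis vector the projection forgets the first coordinate, so
    slicing evaluates the integral of |x|u^perp|; passing to degree 0 accounts for the division by
    |x|. *)
Lemma ge0_integral_proj_perp (u : V) : dot u u = 1%R ->
  \int[@volume R n]_(x in @uball R n) (enorm (proj_perp u x) / enorm x)%:E =
  (kappa R n * gamma R n / n%:R)%:E.
Proof.
move=> u1.
pose e : V := delta_mx 0%R 0%R.
have e1 : dot e e = 1%R by rewrite dot_delta mxE !eqxx.
(* The absolute value makes [h] nonnegative at all real arguments, as the rotation lemma demands. *)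
pose h (a b : R) : \bar R := (Num.sqrt (a ^+ 2 - b ^+ 2) / `|a|)%:E.
have mn : measurable_fun setT (fun x : V => enorm x) by exact: measurable_enorm.
pose G (v x : V) := Num.sqrt (enorm x ^+ 2 - dot x v ^+ 2)%R.
have mG v : measurable_fun setT (G v).
  apply: (measurableT_comp (@measurable_sqrt R)); apply: measurable_funB.
    exact: measurable_funX.
  by apply: measurable_funX; exact: measurable_dot.
have hE v x : h (enorm x) (dot x v) = ((enorm x) ^- 1 * G v x)%:E.
  by rewrite /h ger0_norm ?enorm_ge0// mulrC expr1.
have mh v : measurable_fun setT (fun x : V => h (enorm x) (dot x v)).
  under eq_fun do rewrite hE.
  by apply/measurable_EFinP; apply: measurable_funM => //; exact: measurable_expVn.
transitivity (\int[@volume R n]_(x in @uball R n) h (enorm x) (dot x u)).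
  by apply: eq_integral => x _; rewrite enorm_proj_perp// hE expr1 mulrC.
rewrite (ge0_integral_uball_rotation e1 u1)//; last first.
  by move=> a b; rewrite lee_fin mulr_ge0// ?invr_ge0// sqrtr_ge0.
under eq_integral do rewrite hE.
have GE x : G e x = enorm (\row_i x 0%R (lift 0%R i) : 'rV[R]_m.+1).
  rewrite /G enorm_sqr dot_delta {1 2}(row_cons_eta x) dot_row_cons /=.
  by rewrite addrAC -expr2 subrr add0r.
have := @ge0_integral_uball_homog R m.+1 1 (G e) (mG e).
have -> : \int[@volume R n]_(x in @uball R n) (G e x)%:E =
    (kappa R m.+3 / kappa R n * (m.+1%:R / n%:R * kappa R m.+1))%:E.
  transitivity (\int[@volume R n]_(x in @uball R n)
      (1 * enorm (\row_i x 0 (lift 0 i) : 'rV[R]_m.+1))%:E).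
    by apply: eq_integral => x _; rewrite GE mul1r.
  rewrite (@ge0_integral_uball_slice R m.+1 1 (fun=> 1%R) (@enorm R m.+1))//.
  - under eq_integral do rewrite mul1r addn1.
    rewrite integral_sqrt1B [RHS]EFinM; congr (_ * _).
    under eq_integral do rewrite -[enorm _]expr1.
    by rewrite ge0_integral_uball_enorm addn1.
  - exact: measurable_enorm.
  - by move=> x; exact: enorm_ge0.
  - by move=> s x s0; rewrite enormZ gtr0_norm.
move=> /(_ (fun x => sqrtr_ge0 _)) H.
have {}H := H _; move: H => /(_ _)/esym H.
have GZ s x : (0 < s)%R -> G e (s *: x)%R = (s ^+ 1 * G e x)%R.
  move=> s0; rewrite /G enormZ gtr0_norm// dotZl !exprMn -mulrBr.
  by rewrite sqrtrM ?sqr_ge0// sqrtr_sqr gtr0_norm.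
move: (H GZ); set I := integral _ _ _ => {}H.
have c0 : (n%:R / (n + 1)%:R != 0 :> R)%R by rewrite mulf_neq0// ?invr_eq0 pnatr_eq0.
have -> : I = ((n%:R / (n + 1)%:R)^-1)%:E * ((n%:R / (n + 1)%:R)%:E * I).
  by rewrite muleA -EFinM mulVf// mul1e.
rewrite H -EFinM; congr _%:E.
(* Wallis' recursion replaces [kappa R m.+3 / kappa R n] by a multiple of
   [kappa R m.+1 / kappa R m], the numerator of [gamma]. *)
rewrite gammaE addn1; have := kappa_wallis R m; rewrite /kappa_ratio.
have := kappa_gt0 R m; have := kappa_gt0 R m.+1; have := kappa_gt0 R n.
move: (kappa R m.+3) (kappa R n) (kappa R m.+1) (kappa R m).
move=> w x y z x0 y0 z0 ->.
have m3 : m.+3%:R != 0%R :> R by rewrite pnatr_eq0.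
have m2 : m.+2%:R != 0%R :> R by rewrite pnatr_eq0.
move: (m.+3%:R : R) (m.+2%:R : R) (m.+1%:R : R) m3 m2 => p q r p0 q0.
by field; rewrite p0 q0 !gt_eqF.
Qed.

End projection_mean.

(** * Measures on the sphere and the sine transform *)

Section open_rows.
Context (R : realType) (n : nat).
Local Notation V := 'rV[R]_n.

Let box (p : {ffun 'I_n -> rat} * nat) : set V :=
  [set y | forall i, `|ratr (p.1 i) - y 0 i| < p.2.+1%:R^-1].

Let measurable_box p : measurable (box p).
Proof.
rewrite (_ : box p = \bigcap_(i in [set: 'I_n]) ((fun x : V => x 0 i) @^-1`
    `](ratr (p.1 i) - p.2.+1%:R^-1), (ratr (p.1 i) + p.2.+1%:R^-1)[)); last first.
  apply/seteqP; split => [x H i _|x H i]; have := H i.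
    by rewrite /= distrC ltr_distl in_itv.
  by rewrite /= distrC ltr_distl in_itv => /(_ I).
apply: fin_bigcap_measurable => // i _.
by rewrite -[X in measurable X]setTI; exact: measurable_coord.
Qed.

(** An open set is the countable union of the rational boxes it contains. This links the topology of
    rows, which defines the Borel sets of the sphere, with the sigma-algebra transported from
    tuples. *)
Lemma measurable_open_row (W : set V) : open W -> measurable W.
Proof.
move=> oW; pose F (k : nat) : set V :=
  if unpickle k is Some p then (if `[< box p `<=` W >] then box p else set0)
  else set0.
suff -> : W = \bigcup_k F k.
  apply: bigcupT_measurable => k; rewrite /F; case: unpickle => // p.
  by case: ifP => // _; exact: measurable_box.
apply/seteqP; split => [x Wx|x [k _]]; last first.
  rewrite /F; case: unpickle => // p; case: ifPn => //.
  by move=> /asboolP pW px; exact: pW.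
have : nbhs x W by apply: open_nbhs_nbhs.
rewrite -filter_from_ballE => -[e /= e0 eW].
have e20 : 0 < e / 2 by rewrite divr_gt0.
have := archi_boundP (ltW (_ : 0 < (e / 2)^-1)); rewrite invr_gt0 => /(_ e20).
set k := Num.bound _ => ke.
have kE : k.+1%:R^-1 < e / 2 :> R.
  rewrite invf_plt ?posrE//; apply: lt_le_trans ke _.
  by rewrite ler_nat.
have qP (i : 'I_n) : exists q : rat, `|ratr q - x 0 i| < k.+1%:R^-1.
  have k0 : 0 < k.+1%:R^-1 :> R by [].
  have : x 0 i - k.+1%:R^-1 < x 0 i + k.+1%:R^-1.
    by rewrite ltrBlDr -addrA ltrDl addr_gt0.
  by move=> /rat_in_itvoo[q]; rewrite in_itv /= => qx; exists q; rewrite ltr_distl.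
have [q qE] := choice qP.
pose p := ([ffun i => q i], k).
exists (pickle p) => //; rewrite /F pickleK; rewrite asboolT.
  by move=> i /=; rewrite ffunE; exact: qE.
move=> y yp; apply: eW; split => // i j; rewrite (ord1 i).
have := yp j; rewrite /= ffunE => yq.
rewrite /ball /= (splitr e).
rewrite -(subrKA (ratr (q j)) (x 0 j)).
apply: le_lt_trans (ler_normD _ _) _; apply: ltrD.
  by rewrite distrC; exact: lt_trans (qE j) kE.
exact: lt_trans yq kE.
Qed.

End open_rows.

Section sphere.
Context (R : realType) (m : nat).
Local Notation n := m.+1.
Local Notation V := 'rV[R]_n.
Local Notation sphere := (borel_sphere R m).

Definition sphere_row (u : sphere) : V := set_val u.

Lemma dot_sphere (u : sphere) : dot (sphere_row u) (sphere_row u) = 1.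
Proof.
have := set_valP u; rewrite /unit_sphere /= => u1.
by rewrite -enorm_sqr u1 expr1n.
Qed.

Lemma measurable_sphere_row : measurable_fun setT sphere_row.
Proof.
apply: measurable_rowP => i.
apply: (measurability _ (RGenInftyO.measurableE R)) => //.
move=> _ [_ [a ->] <-]; rewrite setTI; apply: sub_sigma_algebra.
exists [set x : V | x 0 i < a] => //.
apply: (@open_comp _ _ (fun x : V => x 0 i) `]-oo, a[%classic).
  by move=> x _; exact: coord_continuous.
exact: interval_open.
Qed.

Lemma open_sphereP (U : set sphere) : @open (set_type (unit_sphere R m)) U ->
  exists2 W : set V, open W & U = sphere_row @^-1` W.
Proof. by move=> [W oW <-]; exists W. Qed.

Lemma measurable_to_sphere d (Z : measurableType d) (f : Z -> sphere) :
  measurable_fun setT (fun z => sphere_row (f z)) -> measurable_fun setT f.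
Proof.
move=> mf; apply: (@measurability _ _ _ sphere setT f
  (@open (set_type (unit_sphere R m)))) => //.
move=> _ [_ /open_sphereP[W oW ->] <-].
rewrite -comp_preimage; apply: mf => //; exact: measurable_open_row.
Qed.

Let halfspaces : set (set sphere) := [set A | exists a : 'I_n -> R,
  A = [set u | forall i, sphere_row u 0 i < a i]].

Lemma sphere_coord_le1 (u : sphere) i : `|sphere_row u 0 i| <= 1.
Proof.
by have := coord_le_enorm (sphere_row u) i; rewrite /enorm dot_sphere sqrtr1.
Qed.

(** The traces of the lower orthants are stable under intersection and generate the Borel sets of
    the sphere. *)
Lemma sphere_measure_unique (m1 m2 : {finite_measure set sphere -> \bar R}) :
  (forall a : 'I_n -> R, m1 [set u | forall i, sphere_row u 0 i < a i] =
                         m2 [set u | forall i, sphere_row u 0 i < a i]) ->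
  forall A, measurable A -> m1 A = m2 A.
Proof.
move=> m12 A mA.
have Hm : halfspaces `<=` measurable.
  move=> _ [a ->].
  rewrite (_ : [set u | _] = \bigcap_(i in [set: 'I_n])
     ((fun u => sphere_row u 0 i) @^-1` `]-oo, a i[)); last first.
    apply/seteqP; split => [u H i _|u H i]; have := H i; rewrite /= in_itv //=.
    exact.
  apply: fin_bigcap_measurable => // i _.
  rewrite -[X in measurable X]setTI.
  apply: (@measurable_coord_comp R n _ _ sphere_row) => //.
  exact: measurable_sphere_row.
apply: (@g_sigma_algebra_measure_unique _ _ _ halfspaces Hm (fun=> setT)) => //.
(* Coordinates on the sphere are at most 1, so the bound 2 excludes nothing. *)
- move=> _; exists (fun=> 2); apply/seteqP; split => // u _ i.
  have := sphere_coord_le1 u i; rewrite ler_norml => /andP[_ /le_lt_trans]; apply.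
  by rewrite ltr1n.
- by rewrite bigcup_const.
- move=> _ _ [a ->] [b ->]; exists (fun i => Num.min (a i) (b i)).
  apply/seteqP; split => [u /= [ua ub] i|u H]; first by rewrite lt_min ua ub.
  by split => i; have := H i; rewrite /= lt_min => /andP[ua ub].
- by move=> _ [a ->]; exact: m12.
- by move=> _; exact: fin_num_fun_lty.
(* [Z] is the sphere with the sigma-algebra generated by the orthants. Its inclusion into the row
   vectors is measurable, so that this sigma-algebra contains the traces of open sets. *)
pose Z := g_sigma_algebraType halfspaces.
have mZ : measurable_fun setT (sphere_row : Z -> V).
  apply: measurable_rowP => i.
  apply: (measurability _ (RGenInftyO.measurableE R)) => //.
  move=> _ [_ [a ->] <-]; rewrite setTI; apply: sub_sigma_algebra.
  exists (fun j => if j == i then a else 2); apply/seteqP; split => [u ua j|u].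
    case: eqP => [->|_]; first by have := ua; rewrite /= in_itv.
    have := sphere_coord_le1 u j; rewrite ler_norml => /andP[_ /le_lt_trans]; apply.
    by rewrite ltr1n.
  by move=> /(_ i); rewrite eqxx /= in_itv.
have : @open (set_type (unit_sphere R m)) `<=` <<s halfspaces >>.
  move=> _ /open_sphereP[W oW ->].
  have := mZ measurableT W (measurable_open_row oW).
  by rewrite setTI.
move=> /(smallest_sub (smallest_sigma_algebra _ _)); exact.
Qed.

End sphere.

(** * Bounded measurable functions under a finite measure *)

Section bounded_measurable.
Context d (T : measurableType d) (R : realType).
Implicit Types (D : set T) (f g : T -> R).

(** On a set of finite measure this implies integrability and, unlike integrability, it is stable
    under products. *)
Definition bounded_measurable D f :=
  measurable_fun D f /\ exists M, forall x, D x -> `|f x| <= M.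

Lemma bounded_measurable_cst D r : bounded_measurable D (cst r).
Proof. by split => //; exists `|r|. Qed.

Lemma bounded_measurableD D f g : bounded_measurable D f ->
  bounded_measurable D g -> bounded_measurable D (fun x => f x + g x).
Proof.
move=> [mf [M fM]] [mg [L gL]]; split; first exact: measurable_funD.
by exists (M + L) => x Dx; rewrite (le_trans (ler_normD _ _))// lerD ?fM ?gL.
Qed.

Lemma bounded_measurableN D f : bounded_measurable D f ->
  bounded_measurable D (fun x => - f x).
Proof.
move=> [mf [M fM]]; split; first exact: measurable_funN.
by exists M => x Dx; rewrite normrN fM.
Qed.

Lemma bounded_measurableB D f g : bounded_measurable D f ->
  bounded_measurable D g -> bounded_measurable D (fun x => f x - g x).
Proof. by move=> bf bg; apply: bounded_measurableD => //; exact: bounded_measurableN. Qed.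

Lemma bounded_measurableM D f g : bounded_measurable D f ->
  bounded_measurable D g -> bounded_measurable D (fun x => f x * g x).
Proof.
move=> [mf [M fM]] [mg [L gL]]; split; first exact: measurable_funM.
exists (M * L) => x Dx; rewrite normrM ler_pM// ?fM ?gL//.
Qed.

Lemma bounded_measurableZ D r f : bounded_measurable D f ->
  bounded_measurable D (fun x => r * f x).
Proof. by apply: bounded_measurableM; exact: bounded_measurable_cst. Qed.

Lemma bounded_measurableX D f k : bounded_measurable D f ->
  bounded_measurable D (fun x => f x ^+ k).
Proof.
move=> bf; elim: k => [|k IHk].
  exact: bounded_measurable_cst.
under eq_fun do rewrite exprS; exact: bounded_measurableM.
Qed.

Lemma bounded_measurable_sum D (I : Type) (s : seq I) (F : I -> T -> R) :
  (forall i, bounded_measurable D (F i)) ->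
  bounded_measurable D (fun x => \sum_(i <- s) F i x).
Proof.
move=> bF; elim: s => [|i s IHs].
  under eq_fun do rewrite big_nil; exact: bounded_measurable_cst.
by under eq_fun do rewrite big_cons; exact: bounded_measurableD.
Qed.

Lemma bounded_measurable_prod D (I : Type) (s : seq I) (F : I -> T -> R) :
  (forall i, bounded_measurable D (F i)) ->
  bounded_measurable D (fun x => \prod_(i <- s) F i x).
Proof.
move=> bF; elim: s => [|i s IHs].
  under eq_fun do rewrite big_nil; exact: bounded_measurable_cst.
by under eq_fun do rewrite big_cons; exact: bounded_measurableM.
Qed.

Section integrals.
Variables (mu : {measure set T -> \bar R}) (D : set T).
Hypotheses (mD : measurable D) (muD : (mu D < +oo)%E).

Lemma bounded_measurable_integrable f :
  bounded_measurable D f -> mu.-integrable D (EFin \o f).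
Proof.
move=> [mf [M fM]]; apply: measurable_bounded_integrable => //.
exists M; split; first exact: num_real.
by move=> N MN x Dx; exact: le_trans (fM x Dx) (ltW MN).
Qed.

Lemma EFin_Rintegral f : bounded_measurable D f ->
  ((\int[mu]_(x in D) f x)%R%:E = \int[mu]_(x in D) (f x)%:E)%E.
Proof.
move=> bf; rewrite fineK//; apply: integrable_fin_num => //.
exact: bounded_measurable_integrable.
Qed.

Lemma Rintegral_sum (I : Type) (s : seq I) (F : I -> T -> R) :
  (forall i, bounded_measurable D (F i)) ->
  \int[mu]_(x in D) (\sum_(i <- s) F i x) = \sum_(i <- s) \int[mu]_(x in D) F i x.
Proof.
move=> bF; elim: s => [|i s IHs].
  under eq_Rintegral do rewrite big_nil.
  by rewrite Rintegral_cst// mul0r big_nil.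
under eq_Rintegral do rewrite big_cons.
rewrite RintegralD//; last 2 first.
- exact: bounded_measurable_integrable.
- by apply: bounded_measurable_integrable; exact: bounded_measurable_sum.
by rewrite IHs big_cons.
Qed.

End integrals.
End bounded_measurable.

Section cauchy_schwarz.
Context (R : realType) (n : nat).
Implicit Types x y : 'rV[R]_n.

Lemma cauchy_schwarz x y : dot x y ^+ 2 <= dot x x * dot y y.
Proof.
have [->|y0] := eqVneq y 0.
  by rewrite dotC !dot0l expr0n mulr0.
have yy0 : 0 < dot y y by rewrite lt_neqAle dot_ge0 eq_sym dot_eq0 y0.
have := dot_ge0 (dot y y *: x - dot x y *: y).
have -> : dot (dot y y *: x - dot x y *: y) (dot y y *: x - dot x y *: y) =
    dot y y * (dot x x * dot y y - dot x y ^+ 2).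
  by rewrite -scaleNr !(dotDl, dotDr, dotZl, dotZr) (dotC y x); ring.
by rewrite pmulr_rge0// subr_ge0.
Qed.

Lemma ler_enormD x y : enorm (x + y) <= enorm x + enorm y.
Proof.
rewrite -(@ler_pXn2r _ 2) ?nnegrE ?addr_ge0 ?enorm_ge0//.
rewrite sqrrD !enorm_sqr dotDl !dotDr (dotC y x).
have : dot x y <= enorm x * enorm y.
  apply: le_trans (ler_norm _) _.
  rewrite -(@ler_pXn2r _ 2) ?nnegrE ?mulr_ge0 ?enorm_ge0//.
  by rewrite real_normK ?num_real// exprMn !enorm_sqr cauchy_schwarz.
move: (enorm x * enorm y) (dot x y) (dot x x) (dot y y) => a b c e; lra.
Qed.

Lemma proj_perpD u x y : proj_perp u (x + y) = proj_perp u x + proj_perp u y.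
Proof. by rewrite /proj_perp dotDl scalerDl opprD addrACA. Qed.

Lemma proj_perpZ u k x : proj_perp u (k *: x) = k *: proj_perp u x.
Proof. by rewrite /proj_perp dotZl scalerBr scalerA. Qed.

End cauchy_schwarz.

(** * The sine transform and its bounds *)

Section sine_transform.
Context (R : realType) (m : nat).
Local Notation n := m.+1.
Local Notation V := 'rV[R]_n.
Local Notation sphere := (borel_sphere R m).
Variable mu : {finite_measure set sphere -> \bar R}.
Implicit Types (x y : V) (u : sphere).

Let mT : measurable (@setT sphere). Proof. exact: measurableT. Qed.
Let muT : (mu setT < +oo)%E. Proof. exact: fin_num_fun_lty. Qed.

Lemma bounded_measurable_coord i :
  bounded_measurable setT (fun u => sphere_row u 0 i).
Proof.
split; last by exists 1 => u _; exact: sphere_coord_le1.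
by apply: measurable_coord_comp; exact: measurable_sphere_row.
Qed.

Lemma bounded_measurable_dot x :
  bounded_measurable setT (fun u => dot x (sphere_row u)).
Proof.
apply: bounded_measurable_sum => i.
by apply: bounded_measurableZ; exact: bounded_measurable_coord.
Qed.

Lemma dot_sphere_le x u : dot x (sphere_row u) ^+ 2 <= enorm x ^+ 2.
Proof.
by have := cauchy_schwarz x (sphere_row u); rewrite dot_sphere mulr1 enorm_sqr.
Qed.

Definition sine x : R :=
  \int[mu]_(u in setT) enorm (proj_perp (sphere_row u) x).

Lemma enorm_proj_perp_le x u : enorm (proj_perp (sphere_row u) x) <= enorm x.
Proof.
rewrite -(@ler_pXn2r _ 2) ?nnegrE ?enorm_ge0// enorm_proj_perp ?dot_sphere//.
rewrite sqr_sqrtr ?subr_ge0 ?dot_sphere_le//.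
by rewrite gerBl sqr_ge0.
Qed.

Lemma bounded_measurable_proj x :
  bounded_measurable setT (fun u => enorm (proj_perp (sphere_row u) x)).
Proof.
split; last first.
  by exists (enorm x) => u _; rewrite ger0_norm ?enorm_ge0// enorm_proj_perp_le.
under eq_fun do rewrite enorm_proj_perp ?dot_sphere//.
apply: (measurableT_comp (@measurable_sqrt R)); apply: measurable_funB => //.
by apply: measurable_funX; have [] := bounded_measurable_dot x.
Qed.

Lemma sine_transformE x : sine_transform mu x = (sine x)%:E.
Proof. by rewrite /sine EFin_Rintegral//; exact: bounded_measurable_proj. Qed.

Lemma sine_ge0 x : 0 <= sine x.
Proof. by apply: Rintegral_ge0 => u _; exact: enorm_ge0. Qed.

Lemma sineZ s x : 0 < s -> sine (s *: x) = s * sine x.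
Proof.
move=> s0; rewrite /sine -RintegralZl//; last first.
  by apply: bounded_measurable_integrable => //; exact: bounded_measurable_proj.
by apply: eq_Rintegral => u _; rewrite proj_perpZ enormZ gtr0_norm.
Qed.

Lemma sineD x y : sine (x + y) <= sine x + sine y.
Proof.
have bp z := bounded_measurable_integrable mT muT (bounded_measurable_proj z).
rewrite /sine -RintegralD//; apply: le_Rintegral => //.
- apply: bounded_measurable_integrable => //.
  by apply: bounded_measurableD; exact: bounded_measurable_proj.
- by move=> u _; rewrite proj_perpD ler_enormD.
Qed.

Lemma measurable_sine : measurable_fun setT sine.
Proof.
have mf : measurable_fun setT (fun p : V * sphere =>
    (enorm (proj_perp (sphere_row p.2) p.1))%:E : \bar R).
  have m2 : measurable_fun setT (fun p : V * sphere => sphere_row p.2).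
    apply: (measurableT_comp (@measurable_sphere_row R m)).
    exact: measurable_snd.
  apply/measurable_EFinP; under eq_fun do rewrite enorm_proj_perp ?dot_sphere//.
  apply: (measurableT_comp (@measurable_sqrt R)); apply: measurable_funB.
    by apply: measurable_funX; exact: measurable_enorm.
  by apply: measurable_funX; exact: measurable_dot.
have f0 (p : V * sphere) : (0 <= (enorm (proj_perp (sphere_row p.2) p.1))%:E)%E.
  by rewrite lee_fin enorm_ge0.
apply/measurable_EFinP.
rewrite (_ : EFin \o sine = fubini_F mu (fun p : V * sphere =>
    (enorm (proj_perp (sphere_row p.2) p.1))%:E : \bar R)); last first.
  apply/funext => x; rewrite /= EFin_Rintegral//.
  exact: bounded_measurable_proj.
exact: measurable_fun_fubini_tonelli_F.
Qed.

Hypothesis mu_isotropic : isotropic mu.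

Lemma Rintegral_dot_sqr x :
  \int[mu]_(u in setT) (dot x (sphere_row u) ^+ 2) = enorm x ^+ 2.
Proof.
apply: EFin_inj; rewrite mu_isotropic EFin_Rintegral//; last first.
  by apply: bounded_measurableX; exact: bounded_measurable_dot.
by apply: eq_integral => u _; rewrite real_normK// num_real.
Qed.

(** Isotropy is summed over the basis vectors: the squared coordinates of a unit vector add up to
    1. *)
Lemma isotropic_mass : mu setT = n%:R%:E.
Proof.
have -> : mu setT = (\int[mu]_(u in setT) 1)%:E.
  by rewrite Rintegral_cst// mul1r fineK// fin_num_measure.
congr _%:E.
transitivity (\int[mu]_(u in setT) \sum_(i < n) dot (delta_mx 0 i) (sphere_row u) ^+ 2).
  apply: eq_Rintegral => u _; rewrite -(dot_sphere u) /dot.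
  by apply: eq_bigr => i _; rewrite -/(dot _ _) dotC dot_delta expr2.
rewrite Rintegral_sum//; last first.
  by move=> i; apply: bounded_measurableX; exact: bounded_measurable_dot.
under eq_bigr do rewrite Rintegral_dot_sqr enorm_sqr dot_delta mxE !eqxx.
by rewrite sumr_const card_ord.
Qed.

Lemma Rintegral_proj_perp_sqr x :
  \int[mu]_(u in setT) (enorm (proj_perp (sphere_row u) x) ^+ 2) =
  m%:R * enorm x ^+ 2.
Proof.
transitivity (\int[mu]_(u in setT) (enorm x ^+ 2 - dot x (sphere_row u) ^+ 2)).
  apply: eq_Rintegral => u _; rewrite enorm_proj_perp ?dot_sphere//.
  by rewrite sqr_sqrtr// subr_ge0 dot_sphere_le.
rewrite RintegralB//; last 2 first.
- by apply: bounded_measurable_integrable => //; exact: bounded_measurable_cst.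
- apply: bounded_measurable_integrable => //.
  by apply: bounded_measurableX; exact: bounded_measurable_dot.
by rewrite Rintegral_cst//= isotropic_mass Rintegral_dot_sqr /= -[n%:R]natr1; ring.
Qed.

Let ibX2 x := bounded_measurable_integrable mT muT
  (bounded_measurableX 2 (bounded_measurable_proj x)).
Let ib x := bounded_measurable_integrable mT muT (bounded_measurable_proj x).

(** As |x|u^perp| <= |x|, its square is at most |x| times itself, and the square has the known
    integral [m%:R * enorm x ^+ 2]. *)
Lemma sine_lb x : m%:R * enorm x <= sine x.
Proof.
have [->|x0] := eqVneq x 0; first by rewrite enorm0 mulr0 sine_ge0.
have xp : 0 < enorm x by rewrite enorm_gt0.
rewrite -(ler_pM2l xp) mulrCA -expr2 -Rintegral_proj_perp_sqr /sine -RintegralZl//.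
apply: le_Rintegral => //.
  apply: bounded_measurable_integrable => //.
  by apply: bounded_measurableZ; exact: bounded_measurable_proj.
by move=> u _; rewrite expr2 ler_wpM2r ?enorm_ge0// enorm_proj_perp_le.
Qed.

(* AM-GM: [2 c a <= a^2 + c^2] with the optimal [c = |x| sqrt (m / n)] *)
Lemma sine_ub x : (0 < m)%N -> sine x <= Num.sqrt (m%:R * n%:R) * enorm x.
Proof.
move=> m0; have mR : 0 < m%:R :> R by rewrite ltr0n.
have [->|x0] := eqVneq x 0.
  rewrite enorm0 mulr0 /sine; under eq_Rintegral do
    rewrite -(scale0r 0) proj_perpZ scale0r enorm0.
  by rewrite Rintegral_cst// mul0r.
have xp : 0 < enorm x by rewrite enorm_gt0.
pose K : R := Num.sqrt (m%:R * n%:R).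
have KK : K ^+ 2 = m%:R * n%:R by rewrite sqr_sqrtr// mulr_ge0.
have K0 : 0 < K by rewrite sqrtr_gt0 mulr_gt0.
pose c := K * enorm x / n%:R.
have c0 : 0 < c by rewrite divr_gt0// mulr_gt0.
have H : (2 * c) * sine x <= m%:R * enorm x ^+ 2 + c ^+ 2 * n%:R.
  have <- : \int[mu]_(u in setT) (enorm (proj_perp (sphere_row u) x) ^+ 2 + c ^+ 2) =
      m%:R * enorm x ^+ 2 + c ^+ 2 * n%:R.
    rewrite RintegralD//; last first.
      by apply: bounded_measurable_integrable => //; exact: bounded_measurable_cst.
    by rewrite Rintegral_cst//= isotropic_mass Rintegral_proj_perp_sqr.
  rewrite /sine -RintegralZl//; apply: le_Rintegral => //.
  - apply: bounded_measurable_integrable => //.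
    by apply: bounded_measurableZ; exact: bounded_measurable_proj.
  - apply: bounded_measurable_integrable => //.
    apply: bounded_measurableD; last exact: bounded_measurable_cst.
    by apply: bounded_measurableX; exact: bounded_measurable_proj.
  - move=> u _; move: (enorm _) => a.
    by have := sqr_ge0 (a - c); rewrite sqrrB; move: (a ^+ 2) (c ^+ 2) => b e; lra.
have cE : c ^+ 2 * n%:R = m%:R * enorm x ^+ 2.
  have n0 : n%:R != 0 :> R by rewrite pnatr_eq0.
  by rewrite /c exprMn exprMn KK; move: (n%:R : R) n0 => p p0; field.
have {}H : c * sine x <= m%:R * enorm x ^+ 2.
  by move: H; rewrite cE -mulrA; move: (c * sine x) (m%:R * enorm x ^+ 2) => a b; lra.
have -> : Num.sqrt (m%:R * n%:R) * enorm x = m%:R * enorm x ^+ 2 / c.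
  rewrite -/K /c; apply/eqP; rewrite eq_sym; apply/eqP.
  have n0 : n%:R != 0 :> R by rewrite pnatr_eq0.
  have -> : m%:R = K ^+ 2 / n%:R by rewrite KK mulfK.
  by move: (n%:R : R) n0 => p p0; field; rewrite p0 !gt_eqF.
by rewrite ler_pdivlMr// mulrC.
Qed.

(** Subadditivity and the upper bound at [x - y]; the equality case uses this to pass from almost
    everywhere to everywhere. *)
Lemma sine_lip x y : (0 < m)%N ->
  sine x - sine y <= Num.sqrt (m%:R * n%:R) * enorm (x - y).
Proof.
move=> m0; rewrite lerBlDr -{1}(subrK y x).
by apply: le_trans (sineD _ _) _; rewrite lerD2r sine_ub.
Qed.

End sine_transform.

Section sine_mean.
Context (R : realType) (m : nat).
Local Notation n := m.+2.
Local Notation V := 'rV[R]_n.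
Local Notation sphere := (borel_sphere R m.+1).
Variable mu : {finite_measure set sphere -> \bar R}.
Hypothesis mu_mass : mu setT = n%:R%:E.
Local Open Scope ereal_scope.

(** By Tonelli's theorem the ball is integrated first; the result is the same for all u, and the
    total mass n cancels its denominator. *)
Lemma ge0_integral_sine_uball :
  \int[@volume R n]_(x in @uball R n) (sine mu x / enorm x)%:E =
  (kappa R n * gamma R n)%:E.
Proof.
pose F (p : V * sphere) : \bar R := ((enorm p.1 <= 1)%R%:R *
  (enorm (proj_perp (sphere_row p.2) p.1) / enorm p.1))%:E.
have F0 p : 0 <= F p by rewrite lee_fin !mulr_ge0// ?invr_ge0 ?enorm_ge0.
have mF : measurable_fun setT F.
  have m2 : measurable_fun setT (fun p : V * sphere => sphere_row p.2).
    apply: (measurableT_comp (@measurable_sphere_row R m.+1)).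
    exact: measurable_snd.
  have m1 : measurable_fun setT (fun p : V * sphere => enorm p.1).
    exact: measurable_enorm.
  apply/measurable_EFinP/measurable_funM.
    by apply: measurable_fun_natb; exact: measurable_fun_ler.
  apply: measurable_funM; last exact: (measurableT_comp (@measurable_inv R) m1).
  under eq_fun do rewrite enorm_proj_perp ?dot_sphere//.
  apply: (measurableT_comp (@measurable_sqrt R)); apply: measurable_funB.
    exact: measurable_funX.
  by apply: measurable_funX; exact: measurable_dot.
transitivity (\int[@volume R n]_x \int[mu]_u F (x, u)).
  rewrite (@integral_mkcondb _ _ _ (@volume R n) (fun x : V => enorm x <= 1)%R
    (@uball R n))//.
  apply: eq_integral => x _; rewrite -EFinM /F /=.
  rewrite -EFin_Rintegral//; last 2 first.
  - exact: fin_num_fun_lty.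
  - apply: bounded_measurableZ; apply: bounded_measurableM.
      exact: bounded_measurable_proj.
    exact: bounded_measurable_cst.
  congr _%:E; rewrite /=.
  under [RHS]eq_Rintegral do rewrite mulrA mulrAC.
  rewrite RintegralZl//; last first.
    apply: bounded_measurable_integrable => //; first exact: fin_num_fun_lty.
    exact: bounded_measurable_proj.
  by rewrite /sine; ring.
rewrite (@fubini_tonelli _ _ _ _ _ (@volume R n) mu F mF F0).
transitivity (\int[mu]_(u in setT) (kappa R n * gamma R n / n%:R)%:E).
  apply: eq_integral => u _.
  rewrite -(ge0_integral_proj_perp (dot_sphere u)).
  rewrite [RHS](@integral_mkcondb _ _ _ (@volume R n) (fun x : V => enorm x <= 1)%R
    (@uball R n))//.
rewrite integral_cst//= mu_mass -EFinM; congr _%:E.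
by rewrite divfK// pnatr_eq0.
Qed.

End sine_mean.

(** * The volume inequalities *)

Section elementary_inequalities.
Context (R : realType).
Implicit Types (x y s : R).

Lemma bernoulli_ineq (h : R) n : -1 <= h -> 1 + n%:R * h <= (1 + h) ^+ n.
Proof.
move=> h1; elim: n => [|n IHn]; first by rewrite mul0r addr0 expr0.
have h0 : 0 <= 1 + h by rewrite -lerBlDl sub0r.
rewrite exprS; apply: le_trans (ler_wpM2l h0 IHn).
rewrite -subr_ge0 -[n.+1%:R]natr1.
have -> : (1 + h) * (1 + n%:R * h) - (1 + (n%:R + 1) * h) = n%:R * h ^+ 2 by ring.
by rewrite mulr_ge0// sqr_ge0.
Qed.

Lemma tangent_expVn_aux (z : R) n : 0 < z -> 1 + n%:R * (z^-1 - 1) <= z ^- n.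
Proof.
move=> z0; have -> : z ^- n = (1 + (z^-1 - 1)) ^+ n by rewrite subrKC exprVn.
by apply: bernoulli_ineq; rewrite lerBrDr addNr invr_ge0 ltW.
Qed.

(** In terms of z = y/s, Bernoulli's inequality for 1/z - 1 gives 1 + n (1/z - 1) <= z^-n, and 1/z -
    1 exceeds 1 - z by (z - 1)^2/z. This excess decides the equality case. *)
Lemma tangent_expVn s y n : 0 < s -> 0 < y ->
  s ^- n - n%:R * s ^- n.+1 * (y - s) <= y ^- n
  ?= iff ((y == s) || (n == 0%N)).
Proof.
move=> s0 y0; have z0 : 0 < y / s by rewrite divr_gt0.
have sn0 : 0 < s ^- n by rewrite invr_gt0 exprn_gt0.
have -> : y ^- n = s ^- n * (y / s) ^- n.
  by rewrite -invfM exprMn exprVn mulrCA mulfV ?mulr1// expf_neq0// gt_eqF.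
have -> : s ^- n - n%:R * s ^- n.+1 * (y - s) = s ^- n * (1 + n%:R * (1 - y / s)).
  by rewrite exprS; field; rewrite expf_neq0 gt_eqF.
have -> : (y == s) = (y / s == 1).
  apply/idP/idP => /eqP; first by move=> ->; rewrite divff// gt_eqF.
  by move=> ys; rewrite -[y](divfK (lt0r_neq0 s0)) ys mul1r.
move: (y / s) z0 => z z0; have h := tangent_expVn_aux n z0.
have zE : z^-1 - 1 - (1 - z) = (z - 1) ^+ 2 / z by field; rewrite gt_eqF.
have zd : 0 <= (z - 1) ^+ 2 / z by rewrite divr_ge0 ?sqr_ge0// ltW.
split.
  rewrite ler_pM2l//; apply: le_trans h; rewrite lerD2l ler_wpM2l//.
  by rewrite -subr_ge0 zE.
rewrite (inj_eq (mulfI (lt0r_neq0 sn0))).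
have [->|z1] /= := eqVneq z 1.
  by rewrite subrr mulr0 addr0 expr1n invr1 eqxx.
have [->|n0] /= := eqVneq n 0%N; first by rewrite mul0r addr0 expr0 invr1 eqxx.
apply/negbTE; rewrite lt_eqF//; apply: lt_le_trans h.
rewrite ltrD2l ltr_pM2l ?ltr0n ?lt0n// -subr_gt0 zE divr_gt0//.
by rewrite lt_neqAle sqr_ge0 andbT eq_sym sqrf_eq0 subr_eq0.
Qed.

(** Convexity from tangents: the tangent at [s] lies below the function at [a] and at [b], and the
    weighted mean of these two inequalities is the claim. *)
Lemma chord_expVn (a b s : R) n : 0 < a -> a <= s -> s <= b -> a < b ->
  s ^- n <= b ^- n * ((s - a) / (b - a)) + a ^- n * ((b - s) / (b - a)).
Proof.
move=> a0 as_ sb ab; have s0 := lt_le_trans a0 as_; have b0 := lt_trans a0 ab.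
have [Ha _] := tangent_expVn n s0 a0; have [Hb _] := tangent_expVn n s0 b0.
have ba : 0 < b - a by rewrite subr_gt0.
pose t := (s - a) / (b - a); pose r := (b - s) / (b - a).
have t0 : 0 <= t by rewrite divr_ge0 ?subr_ge0 ?(ltW ab).
have r0 : 0 <= r by rewrite divr_ge0 ?subr_ge0 ?(ltW ab).
apply: le_trans (lerD (ler_wpM2r t0 Hb) (ler_wpM2r r0 Ha)).
rewrite le_eqVlt; apply/orP; left; apply/eqP.
rewrite /t /r; move: (s ^- n) (s ^- n.+1) => u v.
by field; rewrite gt_eqF.
Qed.

(** Its derivative is x^2/(1 + x), so it increases through 0 at 0; the two signs give the two bounds
    for ln below. *)
Let lnf x := ln (1 + x) - x + x ^+ 2 / 2.

Let lnf_homo : {in `]-1, 2[ &, {homo lnf : x y / x <= y}}.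
Proof.
have dlnf x : x \in `]-1, 2[ -> is_derive x 1 lnf (x ^+ 2 / (1 + x)).
  rewrite in_itv /= => /andP[x1 _].
  have x10 : 0 < 1 + x by rewrite -ltrBlDl sub0r.
  have d1 : is_derive x 1 (fun y => 1 + y) (1 : R).
    have -> : (fun y => 1 + y) = cst 1 + id :> (R -> R) by [].
    by apply: is_derive_eq; rewrite add0r.
  have dl := is_derive1_ln x10.
  have dc := @is_derive1_comp _ (@ln R) (fun y => 1 + y) x _ _ dl d1.
  have d2 : is_derive x 1 (fun y : R => y ^+ 2) (2 * x).
    apply: DeriveDef; first exact: exprn_derivable.
    by rewrite exp_derive [LHS]mulr1 expr1.
  have -> : lnf = (@ln R \o (fun y => 1 + y)) - id + 2^-1 *: (fun y => y ^+ 2).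
    by apply/funext => y; rewrite /lnf [_ / 2]mulrC.
  apply: (is_derive_eq (is_deriveD (is_deriveB dc (is_derive_id x 1))
    (is_deriveZ 2^-1 d2))).
  by rewrite /GRing.scale /=; field; rewrite gt_eqF.
apply: ger0_derive1_le_oo.
- by move=> x xi; case: (dlnf x xi).
- move=> x xi; rewrite derive1E; case: (dlnf x xi) => _ ->.
  move: xi; rewrite in_itv /= => /andP[x1 _].
  by rewrite divr_ge0 ?sqr_ge0// -lerBlDl sub0r ltW.
- move=> x xi; apply/differentiable_continuous/derivable1_diffP.
  by rewrite inE in xi; case: (dlnf x xi).
Qed.

Lemma ln1D_lb x : 0 <= x < 2 -> x - x ^+ 2 / 2 <= ln (1 + x).
Proof.
move=> /andP[x0 x2].
have : lnf 0 <= lnf x.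
  by apply: lnf_homo; rewrite ?in_itv /= ?oppr_lt0 ?ltr01 ?ltr0n ?x2 ?(lt_le_trans _ x0)// ltrN10.
rewrite /lnf addr0 ln1; lra.
Qed.

Lemma ln1B_ub x : 0 <= x < 1 -> ln (1 - x) <= - x - x ^+ 2 / 2.
Proof.
move=> /andP[x0 x1].
have : lnf (- x) <= lnf 0.
  apply: lnf_homo; rewrite ?in_itv /= ?oppr_le0//; apply/andP; split; lra.
rewrite /lnf addr0 ln1 sqrrN; lra.
Qed.

End elementary_inequalities.

(** * The inequality in n behind the upper bound *)

Section numeric_bound.
Context (R : realType).

(** The number 32/3 is 4^4/4!: this is the base case of [ln_fact_lb]. *)
Lemma expR_5_2_lb : 32 / 3 <= expR (5 / 2) :> R.
Proof.
have e1 : 11 / 10 <= expR (1 / 10) :> R by apply: le_trans (expR_ge1Dx _); lra.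
have -> : 5 / 2 = (1 / 10) * 25 :> R by field.
rewrite expRM_natr.
apply: (@le_trans _ _ ((11 / 10) ^+ 25)); last first.
  by apply: lerXn2r => //; rewrite nnegrE ?expR_ge0//; lra.
have h5 : 161 / 100 <= (11 / 10) ^+ 5 :> R by rewrite !exprS expr0; lra.
have -> : (11 / 10) ^+ 25 = ((11 / 10) ^+ 5) ^+ 5 :> R by rewrite -exprM.
apply: (@le_trans _ _ ((161 / 100) ^+ 5)); first by rewrite !exprS expr0; lra.
by apply: lerXn2r => //; rewrite nnegrE ?exprn_ge0//; lra.
Qed.

(** Stirling's formula with ln (2 pi m)/2 lowered to 3/2, which fails at m = 3. The induction step
    is m (ln (m+1) - ln m) <= 1. *)
Lemma ln_fact_lb m : (4 <= m)%N ->
  m%:R * ln m%:R - m%:R + 3 / 2 <= ln (m`!%:R : R).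
Proof.
move=> /subnK <-; elim: (m - 4)%N => [|k IHk].
  have -> : (0 + 4)`!%:R = 24 :> R by [].
  have -> : ((0 + 4)%N%:R : R) * ln (0 + 4)%:R = ln (24 * (32 / 3)).
    rewrite (_ : 24 * (32 / 3) = 4 ^+ 4)%R; last by field.
    by rewrite lnXn// mulr_natl.
  rewrite lnM ?posrE ?divr_gt0//.
  have : ln (32 / 3 : R) <= 5 / 2.
    by rewrite -[leRHS]expRK ler_ln ?posrE ?expR_gt0 ?divr_gt0// expR_5_2_lb.
  have -> : ((0 + 4)%N%:R : R) = 4 by [].
  lra.
rewrite addSn; move: (k + 4)%N (leq_addl k 4) IHk => m' m4 IH.
have m0 : 0 < m'%:R :> R by rewrite ltr0n (leq_trans _ m4).
rewrite factS natrM lnM ?posrE ?ltr0n ?fact_gt0//.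
have H : m'%:R * (ln m'.+1%:R - ln m'%:R) <= 1 :> R.
  have -> : ln m'.+1%:R = ln m'%:R + ln (1 + m'%:R^-1) :> R.
    rewrite -lnM ?posrE ?addr_gt0 ?invr_gt0//; congr ln.
    by rewrite mulrDr mulr1 mulfV ?gt_eqF// natr1.
  rewrite addrAC subrr add0r.
  rewrite -ler_pdivlMl// mulr1; apply: le_ln1Dx.
  by rewrite (lt_trans _ (_ : 0 < _)) ?ltrN10 ?invr_gt0.
move: IH H; rewrite -[m'.+1%:R]natr1.
by move: (ln _) (ln _) (ln _) => l1 l2 l3; nra.
Qed.

(** Exponentiating [ln_fact_lb] divided by m leaves m e^(3/(2m) - 1), and e^(3/(2m)) >= 1 +
    3/(2m). *)
Lemma powR_fact_lb m : (4 <= m)%N ->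
  (m%:R + 3 / 2) * expR (- 1) <= m`!%:R `^ m%:R^-1 :> R.
Proof.
move=> m4; have m0 : 0 < m%:R :> R by rewrite ltr0n (leq_trans _ m4).
have -> : m`!%:R `^ m%:R^-1 = expR (m%:R^-1 * ln (m`!%:R : R)).
  by rewrite /powR pnatr_eq0 gtn_eqF ?fact_gt0.
have h : ln m%:R + (3 / 2 * m%:R^-1 - 1) <= m%:R^-1 * ln (m`!%:R : R).
  rewrite ler_pdivlMl//; apply: le_trans (ln_fact_lb m4).
  by rewrite le_eqVlt; apply/orP; left; apply/eqP; field; rewrite gt_eqF.
apply: le_trans (_ : expR (ln m%:R + (3 / 2 * m%:R^-1 - 1)) <= _); last first.
  by rewrite ler_expR.
rewrite expRD lnK ?posrE// expRD mulrA ler_pM2r ?expR_gt0//.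
rewrite -[X in X <= _]mulr1 -ler_pdivrMl// .
apply: le_trans (expR_ge1Dx _).
by rewrite le_eqVlt; apply/orP; left; apply/eqP; field; rewrite gt_eqF.
Qed.

Lemma expR_half_ub : expR (1 / 2) <= 42 / 25 :> R.
Proof.
have h : 15 / 16 <= expR (- (1 / 16)) :> R by apply: le_trans (expR_ge1Dx _); lra.
have h8 : 59 / 100 < 596 / 1000 :> R by lra.
have e8 : expR (- (1 / 2)) = expR (- (1 / 16)) ^+ 8 :> R.
  by rewrite -expRM_natr; congr expR; field.
have : 596 / 1000 <= expR (- (1 / 2)) :> R.
  rewrite e8; apply: (@le_trans _ _ ((15 / 16) ^+ 8)).
    by rewrite !exprS expr0; lra.
  by apply: lerXn2r => //; rewrite nnegrE ?expR_ge0//; lra.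
rewrite expRN => H; have e0 := expR_gt0 (1 / 2 : R).
have := ler_wpM2r (ltW e0) H; rewrite mulVf ?gt_eqF//.
move: (expR _) e0 => e e0; lra.
Qed.

Lemma le_powRV (y F : R) m : 0 <= y -> (0 < m)%N -> y ^+ m <= F ->
  y <= F `^ m%:R^-1.
Proof.
move=> y0 m0 yF; have mR : m%:R != 0 :> R by rewrite pnatr_eq0 -lt0n.
have {1}-> : y = (y ^+ m) `^ m%:R^-1.
  by rewrite -powR_mulrn// -powRrM mulfV// powRr1.
by apply: ge0_ler_powR; rewrite ?invr_ge0// nnegrE ?exprn_ge0// (le_trans _ yF)// exprn_ge0.
Qed.

Lemma sqrt_lb (y z : R) : 0 <= y -> y ^+ 2 <= z -> y <= Num.sqrt z.
Proof.
by move=> y0 yz; rewrite -[leLHS]ger0_norm// -sqrtr_sqr ler_wsqrtr.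
Qed.

Lemma weighted_average_le (Q Q' v v' : R) : 0 <= Q <= Q' -> Q' <= 1 ->
  0 <= v' <= v ->
  Q * v + (1 - v) <= Q' * v' + (1 - v').
Proof.
move=> /andP[Q0 QQ] Q1 /andP[v0 vv].
have : 0 <= (1 - Q) * (v - v') by rewrite mulr_ge0// subr_ge0// (le_trans QQ).
have : 0 <= (Q' - Q) * v' by rewrite mulr_ge0// subr_ge0.
lra.
Qed.

(** The left side is a^n times the chord of s^-n over [a, M] at a (1 + 1/(2n)); the right side is
    a^n times the stated bound with that number in place of gamma_n. Both tend to e^(-1/2), so the
    estimates keep the terms of order x = 1/n, and a polynomial inequality on x <= 1/5 remains. *)
Lemma upper_core_ge5 n (a M : R) : (5 <= n)%N ->
  a = n.-1%:R -> M = Num.sqrt (a * n%:R) ->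
  (a / M) ^+ n * ((M + a) / (2 * n%:R)) + (1 - (M + a) / (2 * n%:R)) <=
  (1 + (2 * n%:R)^-1) ^+ n * (n.-1`!%:R `^ a^-1) / n%:R.
Proof.
move=> n5 a_def M_def.
have n0 : 0 < n%:R :> R by rewrite ltr0n (leq_trans _ n5).
have n4 : (4 <= n.-1)%N by lia.
have nE : n%:R = a + 1 :> R by rewrite a_def natr1 prednK// (leq_trans _ n5).
have a4 : 4 <= a by rewrite a_def ler_nat.
pose x : R := n%:R^-1.
have x0 : 0 < x by rewrite invr_gt0.
have x5 : x <= 1 / 5.
  by rewrite /x div1r lef_pV2 ?posrE// nE; lra.
have aE : a = (1 - x) / x by rewrite /x invrK mulrBl mulVf ?gt_eqF// nE; lra.
have xn : n%:R = x^-1 by rewrite /x invrK.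
have MM : M ^+ 2 = a * n%:R by rewrite M_def sqr_sqrtr// mulr_ge0//; lra.
have M0 : 0 < M by rewrite M_def sqrtr_gt0 mulr_gt0//; lra.
have Mlb : a * (1 + x / 2) <= M.
  rewrite M_def; apply: sqrt_lb; first by rewrite mulr_ge0 ?addr_ge0 ?divr_ge0// ?ltW//; lra.
  rewrite aE xn -subr_ge0.
  have -> : (1 - x) / x * x^-1 - ((1 - x) / x * (1 + x / 2)) ^+ 2 =
    (1 - x) * (3 + x) / 4.
    by field; rewrite gt_eqF.
  by rewrite divr_ge0// mulr_ge0//; lra.
pose v := (M + a) / (2 * n%:R).
(* This is [v] with [M] replaced by its lower bound [a * (1 + x / 2)]. *)
pose v' := 1 - x * (3 + x) / 4.
have v'v : 0 <= v' <= v.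
  apply/andP; split; first by rewrite /v'; nra.
  rewrite /v ler_pdivlMr ?mulr_gt0//; apply: le_trans (_ : a * (1 + x / 2) + a <= _).
    rewrite aE xn /v' le_eqVlt; apply/orP; left; apply/eqP.
    by field; rewrite gt_eqF.
  by rewrite lerD2r.
pose E : R := expR (- (1 / 2)).
have E0 : 0 < E by exact: expR_gt0.
have EE : E * expR (1 / 2) = 1 by rewrite /E -expRD addNr expR0.
have E1 : 1 <= E * (42 / 25).
  by have := ler_wpM2l (ltW E0) expR_half_ub; rewrite EE.
have Eh : E <= 2 / 3.
  by have := ler_wpM2l (ltW E0) (expR_ge1Dx (1 / 2 : R)); rewrite EE; lra.
pose Q' := E / (1 + x / 4).
have x40 : 0 < 1 + x / 4 by lra.
(* Since (a/M)^2 = 1 - x, the bound ln (1 - x) <= - x - x^2/2 gives (a/M)^(2n) <= e^(-1 - x/2). *)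
have QQ : (a / M) ^+ n <= Q'.
  apply: (@le_trans _ _ (E * expR (- (x / 4)))); last first.
    rewrite ler_pM2l// expRN lef_pV2 ?posrE ?expR_gt0//.
    exact: expR_ge1Dx.
  rewrite -(@ler_pXn2r _ 2) ?nnegrE ?exprn_ge0 ?divr_ge0 ?mulr_ge0 ?expR_ge0 ?(ltW M0)//; last lra.
  rewrite -exprM mulnC exprM expr_div_n MM.
  have -> : a ^+ 2 / (a * n%:R) = 1 - x.
    by rewrite aE xn; field; rewrite gt_eqF//=; lra.
  apply: (@le_trans _ _ (expR (- x - x ^+ 2 / 2) ^+ n)).
    have lx : 0 <= 1 - x by lra.
    apply: lerXn2r; rewrite ?nnegrE ?expR_ge0//.
    rewrite -[leLHS]lnK ?posrE; last by lra.
    by rewrite ler_expR ln1B_ub// (ltW x0); lra.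
  rewrite -expRM_natr -expRD -expRM_natr ler_expR xn.
  rewrite le_eqVlt; apply/orP; left; apply/eqP.
  by field; rewrite gt_eqF.
have Q'1 : Q' <= 1 by rewrite ler_pdivrMr//; lra.
have Q0 : 0 <= (a / M) ^+ n by rewrite exprn_ge0// divr_ge0// ltW//; lra.
apply: (@le_trans _ _ (Q' * v' + (1 - v'))).
  by apply: weighted_average_le => //; rewrite Q0.
pose P : R := (1 + (2 * n%:R)^-1) ^+ n.
have PE : expR (1 / 2 - x / 8) <= P.
  have -> : 1 / 2 - x / 8 = (x / 2 - (x / 2) ^+ 2 / 2) * n%:R :> R.
    by rewrite xn; field; rewrite gt_eqF.
  rewrite expRM_natr /P invfM [2^-1 * _]mulrC -/x.
  have lx : 0 < 1 + x / 2 by lra.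
  apply: lerXn2r; rewrite ?nnegrE ?expR_ge0 ?(ltW lx)//.
  rewrite -[leRHS]lnK ?posrE// ler_expR; apply: ln1D_lb; apply/andP; split; lra.
apply: (@le_trans _ _ (expR (1 / 2 - x / 8) * ((a + 3 / 2) * expR (- 1)) / n%:R)); last first.
  rewrite ler_pM2r ?invr_gt0//; apply: ler_pM => //; rewrite ?expR_ge0//.
    by rewrite mulr_ge0 ?expR_ge0//; lra.
  by rewrite a_def; exact: powR_fact_lb.
have -> : expR (1 / 2 - x / 8) * ((a + 3 / 2) * expR (- 1)) / n%:R =
    E * expR (- (x / 8)) * (1 + x / 2).
  have -> : E * expR (- (x / 8)) = expR (1 / 2 - x / 8) * expR (- 1).
    by rewrite -!expRD; congr expR; lra.
  by rewrite aE xn; field; rewrite gt_eqF.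
apply: (@le_trans _ _ (E * (1 - x / 8) * (1 + x / 2))); last first.
  rewrite ler_pM2r; last by lra.
  by rewrite ler_pM2l//; apply: le_trans (expR_ge1Dx _); lra.
(* The factor [E * (42 / 25) >= 1] lets [E] be divided out of all terms, leaving rational functions
   of [x]. *)
apply: (@le_trans _ _ (Q' * v' + E * (42 / 25) * (1 - v'))).
  rewrite lerD2l -[leLHS]mul1r ler_wpM2r//.
  by rewrite /v' opprB addrC subrK divr_ge0// mulr_ge0 ?ltW//; lra.
rewrite /Q' mulrAC -mulrA -[E * (42 / 25) * _]mulrA -mulrDr -mulrA ler_pM2l//.
rewrite -lerBrDr ler_pdivrMr// -subr_ge0.
have -> : ((1 - x / 8) * (1 + x / 2) - 42 / 25 * (1 - v')) * (1 + x / 4) - v' =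
  x * (23 / 200 - 363 / 800 * x - 193 / 1600 * x ^+ 2) by rewrite /v'; field.
have xx : x ^+ 2 <= x * (1 / 5) by rewrite expr2 ler_pM2l.
apply: mulr_ge0; first exact: ltW.
by move: (x ^+ 2) xx => y xy; lra.
Qed.

Lemma upper_core n (a M : R) : (3 <= n)%N ->
  a = n.-1%:R -> M = Num.sqrt (a * n%:R) ->
  (a / M) ^+ n * ((M + a) / (2 * n%:R)) + (1 - (M + a) / (2 * n%:R)) <=
  (1 + (2 * n%:R)^-1) ^+ n * (n.-1`!%:R `^ a^-1) / n%:R.
Proof.
move=> n3; have [|n5] := leqP 5 n; first exact: upper_core_ge5.
(* [powR_fact_lb] starts at n - 1 = 4. Here M is sqrt 6 or sqrt 12, and rational bounds for the
   roots are sharp enough. *)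
have [->|->] : n = 3%N \/ n = 4%N by lia.
- move=> -> M_def.
  have M0 : 24 / 10 <= M by rewrite M_def; apply: sqrt_lb; rewrite /=; lra.
  have MM : M * M = 6 by rewrite -expr2 M_def sqr_sqrtr /=; lra.
  have F2 : 2`!%:R = 2 :> R by [].
  have G0 : 14 / 10 <= 2`!%:R `^ 2%:R^-1 :> R.
    by apply: le_powRV => //; rewrite ?F2; lra.
  have -> : (2%:R / M) ^+ 3 = 2 * M / 9.
    have -> : 2 * M / 9 = 2 / 9 * (6 / M).
      by rewrite -MM; field; rewrite gt_eqF//; lra.
    have -> : (2%:R / M) ^+ 3 = 8 / (M * M * M) by field; rewrite gt_eqF//; lra.
    by rewrite MM; field; rewrite gt_eqF//; lra.
  have -> : (1 + (2 * 3)^-1) ^+ 3 = 343 / 216 :> R by field.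
  have -> : 2 * M / 9 * ((M + 2) / (2 * 3)) + (1 - (M + 2) / (2 * 3)) =
    (2 * (M * M) + 36 - 5 * M) / 54 by field.
  rewrite MM /=; lra.
- move=> -> M_def.
  have M0 : 34 / 10 <= M by rewrite M_def; apply: sqrt_lb; rewrite /=; lra.
  have MM : M * M = 12 by rewrite -expr2 M_def sqr_sqrtr /=; lra.
  have G0 : 18 / 10 <= 6 `^ 3%:R^-1 :> R.
    by apply: le_powRV => //; rewrite ?exprS ?expr0; lra.
  have -> : (3%:R / M) ^+ 4 = 9 / 16.
    have -> : (3%:R / M) ^+ 4 = 81 / ((M * M) * (M * M)) by field; rewrite gt_eqF//; lra.
    by rewrite MM; field.
  have -> : (1 + (2 * 4)^-1) ^+ 4 = 6561 / 4096 :> R by field.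
  have -> : 4.-1`!%:R = 6 :> R by [].
  rewrite /=; lra.
Qed.

End numeric_bound.

Section euclidean_balls.
Context (R : realType) (n : nat).
Implicit Types x y : 'rV[R]_n.

Lemma measurable_closed_enorm_ball x (e : R) :
  measurable [set y : 'rV[R]_n | enorm (y - x) <= e].
Proof.
rewrite -[X in measurable X]setTI.
rewrite (_ : [set y | _] = (fun y : 'rV[R]_n => enorm (y - x)) @^-1` `]-oo, e]).
  by apply: measurable_enorm => //; exact: measurable_rowD.
by apply/seteqP; split => y; rewrite /= in_itv.
Qed.

(** Consequently the complement of a null set is dense, which the equality case needs. *)
Lemma volume_ball_gt0 x (e : R) : 0 < e ->
  (0 < volume [set y : 'rV[R]_n | enorm (y - x) <= e]%R)%E.
Proof.
move=> e0; set S := [set y | _].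
have mS : measurable S by exact: measurable_closed_enorm_ball.
have mi : measurable_fun setT (fun y : 'rV[R]_n => (\1_S y)%:E : \bar R).
  exact/measurable_EFinP/measurable_indic.
have i0 y : (0 <= (\1_S y)%:E :> \bar R)%E by rewrite lee_fin.
have mix : measurable_fun setT (fun y : 'rV[R]_n => (\1_S (y + x))%:E : \bar R).
  by apply: (measurableT_comp mi); exact: measurable_rowD.
rewrite -[ltRHS](_ : (\int[@volume R n]_y (\1_S y)%:E)%E = _); last first.
  by rewrite integral_indic// setIT.
rewrite -(ge0_integral_volume_shift x mi i0).
rewrite (ge0_integral_volume_scale e0 mix)//.
rewrite [X in (_ * X)%E](_ : _ = (kappa R n)%:E); last first.
  transitivity (\int[@volume R n]_y (\1_(@uball R n) y)%:E)%E; last first.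
    rewrite (integral_indic _ measurableT (@measurable_uball R n)) setIT.
    exact: volume_uball.
  apply: eq_integral => y _; rewrite !indicE.
  rewrite (_ : (e *: y + x \in S) = (y \in @uball R n))//.
  apply/idP/idP; rewrite !inE /S /uball /= addrK enormZ gtr0_norm//.
    by rewrite -[X in _ <= X -> _]mulr1 ler_pM2l.
  by rewrite -[X in _ -> _ <= X]mulr1 ler_pM2l.
by rewrite -EFinM lte_fin mulr_gt0 ?exprn_gt0// kappa_gt0.
Qed.

Lemma ler_enormB_dist x y : enorm x - enorm y <= enorm (x - y).
Proof. by rewrite lerBlDr -{1}(subrK y x) ler_enormD. Qed.

Lemma enormB x y : enorm (x - y) = enorm (y - x).
Proof. by rewrite -opprB enormN. Qed.

End euclidean_balls.

Lemma measurable_row_neq0 (R : realType) (n : nat) :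
  measurable_fun setT (fun x : 'rV[R]_n.+1 => x == 0).
Proof.
apply: (measurable_fun_bool true); rewrite setTI.
rewrite (_ : _ @^-1` _ = [set 0]); first exact: measurable_set1_row.
by apply/seteqP; split => x /=; [move=> /eqP|move=> ->; rewrite eqxx].
Qed.

(** * The two volume bounds and minimal volume *)

Section volume_bounds.
Context (R : realType) (m : nat).
Local Notation n := m.+2.
Local Notation V := 'rV[R]_n.
Local Notation sphere := (borel_sphere R m.+1).
Variable mu : {finite_measure set sphere -> \bar R}.
Hypothesis mu_isotropic : isotropic mu.

Local Notation N := (sine mu).
Local Notation a := (m.+1%:R : R).
Local Notation M := (Num.sqrt (m.+1%:R * n%:R) : R).
Local Notation k := (kappa R n).
Local Notation g := (gamma R n).
Local Notation B := (@uball R n).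

Let mB : measurable B. Proof. exact: measurable_uball. Qed.
Let B_fin : (volume B < +oo)%E. Proof. exact: volume_uball_lty. Qed.

Let a0 : 0 < a. Proof. by []. Qed.

Let n0 : 0 < n%:R :> R. Proof. by []. Qed.

Lemma gamma_gt0 : 0 < g.
Proof.
apply: lt_le_trans (gamma_lb R m).
by rewrite mulr_gt0// addr_gt0// invr_gt0 mulr_gt0.
Qed.

Let g0 : 0 < g. Proof. exact: gamma_gt0. Qed.

Let aM : a < M.
Proof.
rewrite -[X in X < _]ger0_norm// -sqrtr_sqr ltr_sqrt ?mulr_gt0//.
by rewrite expr2 ltr_pM2l// ltr_nat.
Qed.

(* The value at 0 is irrelevant; [a] keeps it within the bounds below. *)
Definition sine_ratio (x : V) : R := if x == 0 then a else N x / enorm x.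
Local Notation r := sine_ratio.

Lemma sine_ratio_bounds x : a <= r x <= M.
Proof.
rewrite /r; have [_|x0] := eqVneq x 0; first by rewrite lexx ltW.
have x1 : 0 < enorm x by rewrite enorm_gt0.
by rewrite ler_pdivlMr// ler_pdivrMr// sine_lb//= sine_ub.
Qed.

Let r0 x : 0 < r x.
Proof. by case/andP: (sine_ratio_bounds x) => + _; exact: lt_le_trans. Qed.

Let mr : measurable_fun setT r.
Proof.
apply: measurable_fun_ifT => //; first exact: measurable_row_neq0.
apply: measurable_funM; first exact: measurable_sine.
by apply: (measurableT_comp (@measurable_inv R)); exact: measurable_enorm.
Qed.

Let br : bounded_measurable B r.
Proof.
split; first exact: measurable_funTS.
exists M => x _; rewrite ger0_norm ?(ltW (r0 x))//.
by case/andP: (sine_ratio_bounds x).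
Qed.

Let brV : bounded_measurable B (fun x => r x ^- n).
Proof.
split; first by apply: measurable_funTS; exact: measurable_expVn.
exists (a ^- n) => x _; rewrite ger0_norm ?invr_ge0 ?exprn_ge0 ?(ltW (r0 x))//.
rewrite lef_pV2 ?posrE ?exprn_gt0//; apply: lerXn2r; rewrite ?nnegrE ?(ltW (r0 x))//.
by case/andP: (sine_ratio_bounds x).
Qed.

Lemma Rintegral_sine_ratio : \int[@volume R n]_(x in B) r x = k * g.
Proof.
apply: EFin_inj; rewrite EFin_Rintegral//.
rewrite -(ge0_integral_sine_uball (isotropic_mass mu_isotropic)).
apply: ge0_integral_uball_neq0.
- exact/measurable_EFinP.
- apply/measurable_EFinP/measurable_funM; first exact: measurable_sine.
  by apply: (measurableT_comp (@measurable_inv R)); exact: measurable_enorm.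
- by move=> x; rewrite lee_fin ltW.
- by move=> x; rewrite lee_fin divr_ge0 ?sine_ge0 ?enorm_ge0.
- by move=> x x0; rewrite /r (negbTE x0).
Qed.

Lemma volume_sine_ball :
  volume (sine_ball mu) = (\int[@volume R n]_(x in B) (r x ^- n))%:E.
Proof.
rewrite EFin_Rintegral//.
have -> : sine_ball mu = [set x | N x <= 1].
  by apply/seteqP; split => x; rewrite /sine_ball /= sine_transformE lee_fin.
rewrite volume_sublevel; first last.
- by move=> s x; exact: sineZ.
- move=> x x0; apply: lt_le_trans (sine_lb mu_isotropic x).
  by rewrite mulr_gt0// enorm_gt0.
- exact: measurable_sine.
apply: ge0_integral_uball_neq0.
- apply/measurable_EFinP/measurable_funM.
    by apply: measurable_funX; exact: measurable_enorm.
  by apply: measurable_expVn; exact: measurable_sine.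
- by apply/measurable_EFinP; exact: measurable_expVn.
- by move=> x; rewrite lee_fin mulr_ge0 ?invr_ge0// exprn_ge0 ?enorm_ge0 ?sine_ge0.
- by move=> x; rewrite lee_fin invr_ge0 exprn_ge0// ltW.
- move=> x x0; rewrite /r (negbTE x0); congr _%:E.
  by rewrite [in RHS]exprMn [in RHS]exprVn [in RHS]invfM invrK mulrC.
Qed.

Let fine_volB : fine (volume B) = k. Proof. by []. Qed.

(** Both the tangent and the chord have this form, so only the mean of [r] enters their
    integrals. *)
Lemma Rintegral_affine_ratio (c e : R) :
  \int[@volume R n]_(x in B) (c + e * r x) = k * (c + e * g).
Proof.
rewrite RintegralD//; last 2 first.
- by apply: bounded_measurable_integrable => //; exact: bounded_measurable_cst.
- by apply: bounded_measurable_integrable => //; exact: bounded_measurableZ.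
rewrite Rintegral_cst//= RintegralZl//; last exact: bounded_measurable_integrable.
by rewrite Rintegral_sine_ratio [fine _]fine_volB; ring.
Qed.

Lemma bounded_measurable_affine (c e : R) :
  bounded_measurable B (fun x => c + e * r x).
Proof.
apply: bounded_measurableD; first exact: bounded_measurable_cst.
exact: bounded_measurableZ.
Qed.

Let tangent x : R := (g ^- n + n%:R * g ^- n.+1 * g) + - (n%:R * g ^- n.+1) * r x.

Let tangentE x : tangent x = g ^- n - n%:R * g ^- n.+1 * (r x - g).
Proof. by rewrite /tangent; ring. Qed.

Let int_tangent : \int[@volume R n]_(x in B) tangent x = k / g ^+ n.
Proof. by rewrite Rintegral_affine_ratio; ring. Qed.

Lemma volume_sine_ball_lb : ((k / g ^+ n)%:E <= volume (sine_ball mu))%E.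
Proof.
rewrite volume_sine_ball lee_fin -int_tangent; apply: le_Rintegral => //.
- by apply: bounded_measurable_integrable => //; exact: bounded_measurable_affine.
- exact: bounded_measurable_integrable.
- by move=> x _; rewrite tangentE; case: (tangent_expVn n g0 (r0 x)).
Qed.

Lemma volume_sine_ball_ub : (0 < m)%N ->
  (volume (sine_ball mu) <= (k * g ^+ n / alpha R n)%:E)%E.
Proof.
move=> m0; rewrite volume_sine_ball lee_fin.
have Ma : M - a != 0 by rewrite gt_eqF// subr_gt0.
(* [c] and [e] are the intercept and the slope of the chord of s^-n over [a, M]. *)
pose c := (a ^- n * M - M ^- n * a) / (M - a).
pose e := (M ^- n - a ^- n) / (M - a).
apply: (@le_trans _ _ (k * (c + e * g))).
  rewrite -Rintegral_affine_ratio; apply: le_Rintegral => //.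
  - exact: bounded_measurable_integrable.
  - by apply: bounded_measurable_integrable => //; exact: bounded_measurable_affine.
  move=> x _; case/andP: (sine_ratio_bounds x) => r1 r2.
  apply: le_trans (chord_expVn n a0 r1 r2 aM) _.
  rewrite /c /e le_eqVlt; apply/orP; left; apply/eqP.
  move: (r x) (M ^- n) (a ^- n) Ma => u v w.
  by move: M => M'; move: a => a' Ma; field.
rewrite -mulrA ler_pM2l ?kappa_gt0//.
(* The chord decreases and the stated bound increases with gamma, so the lower bound [gl] may
   replace gamma on both sides. *)
pose gl := a * (1 + (2 * n%:R)^-1).
have gl0 : 0 < gl by rewrite mulr_gt0// addr_gt0// invr_gt0 mulr_gt0.
have glg : gl <= g by exact: gamma_lb.
have e0 : e <= 0.
  rewrite /e ler_pdivrMr ?subr_gt0// mul0r subr_le0.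
  rewrite lef_pV2 ?posrE ?exprn_gt0 ?(lt_trans a0 aM)//.
  by apply: lerXn2r; rewrite ?nnegrE ?(ltW aM) ?(ltW (lt_trans a0 aM)).
apply: (@le_trans _ _ (c + e * gl)); first by rewrite lerD2l ler_wnM2l.
have nB1 : n%:R - 1 = a :> R by rewrite -natr1 addrK.
pose G := euler_Gamma (n%:R : R) `^ (n%:R - 1)^-1.
have GE : G = n.-1`!%:R `^ a^-1.
  by rewrite /G nB1 euler_Gamma_fact.
have G0 : 0 < G by rewrite GE powR_gt0// ltr0n fact_gt0.
apply: (@le_trans _ _ (gl ^+ n / alpha R n)); last first.
  rewrite ler_pM2r; last first.
    rewrite invr_gt0 /alpha -/G divr_gt0// mulr_gt0// exprn_gt0//.
  by apply: lerXn2r; rewrite ?nnegrE ?(ltW g0) ?(ltW gl0).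
have := @upper_core R n a M _ (erefl _) (erefl _).
move=> /(_ (_ : (3 <= n)%N)); rewrite -/G -GE => /(_ m0) core.
have aN : a ^+ n != 0 by rewrite expf_neq0// gt_eqF.
have MN : M ^+ n != 0 by rewrite expf_neq0// gt_eqF// (lt_trans a0 aM).
have MM : M ^+ 2 = a * n%:R by rewrite sqr_sqrtr// mulr_ge0.
have nE : n%:R = a + 1 :> R by rewrite natr1.
have -> : c + e * gl = a ^- n *
    ((a / M) ^+ n * ((M + a) / (2 * n%:R)) + (1 - (M + a) / (2 * n%:R))).
  (* The weight of the end [M] of the chord at [gl]: here gl - a = a/(2n) and M^2 - a^2 = a. *)
  have vE : (M + a) / (2 * n%:R) = (gl - a) / (M - a).
    have n2 : 2 * n%:R != 0 :> R by rewrite mulf_neq0.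
    apply/eqP; rewrite (eqr_div _ _ n2 Ma); apply/eqP.
    have -> : (M + a) * (M - a) = a by transitivity (M ^+ 2 - a ^+ 2);
      [ring|rewrite MM nE; ring].
    have nn : n%:R != 0 :> R by rewrite gt_eqF.
    by rewrite /gl; move: (n%:R : R) nn => p p0; field.
  rewrite vE expr_div_n /c /e; move: aN MN Ma.
  move: (a ^+ n) (M ^+ n) (gl) => x y z.
  by move: M => M'; move: a => a' x0 y0 Ma; field; rewrite ?x0 ?y0 ?Ma.
have -> : gl ^+ n / alpha R n =
    a ^- n * ((1 + (2 * n%:R)^-1) ^+ n * G / n%:R).
  rewrite /alpha -/G nB1 /gl exprMn mulnC exprM.
  have nn : n%:R != 0 :> R by rewrite gt_eqF.
  have GG : G != 0 by rewrite gt_eqF.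
  move: (G) GG (n%:R : R) nn ((1 + _) ^+ n) => u u0 p p0 q.
  by move: (a ^+ n) aN => x x0; field; rewrite u0 p0 x0.
by rewrite ler_pM2l// invr_gt0 exprn_gt0.
Qed.

(* If the volume is minimal then [r = gamma] almost everywhere on the ball; as
   [N] is Lipschitz, [N = gamma |.|] everywhere. *)
Lemma volume_sine_ball_eq : volume (sine_ball mu) = (k / g ^+ n)%:E ->
  forall x, N x = g * enorm x.
Proof.
rewrite volume_sine_ball => -[volE].
pose D x := r x ^- n - tangent x.
have D0 x : 0 <= D x.
  by rewrite subr_ge0 tangentE; case: (tangent_expVn n g0 (r0 x)).
have bD : bounded_measurable B D.
  by apply: bounded_measurableB => //; exact: bounded_measurable_affine.
have intD : (\int[@volume R n]_(x in B) `|(D x)%:E| = 0)%E.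
  under eq_integral do rewrite abse_EFin ger0_norm//.
  rewrite -EFin_Rintegral// RintegralB//; last 2 first.
  - exact: bounded_measurable_integrable.
  - by apply: bounded_measurable_integrable => //; exact: bounded_measurable_affine.
  by rewrite volE int_tangent subrr.
have [Z [mZ Z0 DZ]] : ae_eq (@volume R n) B (EFin \o D) (cst 0%E).
  by apply/ae_eq_integral_abs => //; apply/measurable_EFinP; case: bD.
have eqZ y : enorm y <= 1 -> ~ Z y -> y != 0 -> N y = g * enorm y.
  move=> y1 Zy y0; have : D y = 0.
    apply: contrapT => Dy; apply: Zy; apply: DZ => /= DyE; apply: Dy.
    by case: (DyE y1).
  move=> /eqP; rewrite subr_eq0 tangentE eq_sym.
  have [_ ->] := tangent_expVn n g0 (r0 y).
  rewrite orbF => /eqP; rewrite /r (negbTE y0) => <-.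
  by rewrite divfK// enorm_eq0.
have nearZ x e : 0 < e -> exists2 y, enorm (y - x) <= e & ~ Z y.
  move=> e0; apply: contrapT => noy.
  have SZ : [set y | enorm (y - x) <= e] `<=` Z.
    by move=> y ye; apply: contrapT => Zy; apply: noy; exists y.
  have := volume_ball_gt0 x e0; rewrite ltNge -Z0 => /negP; apply.
  by apply: le_measure; rewrite ?inE//; exact: measurable_closed_enorm_ball.
have Mg0 : 0 < M + g by rewrite addr_gt0// (lt_trans a0 aM).
(* At norm 1/2 the points within distance 1/4 stay in the ball and away from 0; homogeneity gives
   the other vectors. *)
have half x : enorm x = 1 / 2 -> N x = g * enorm x.
  move=> x12; apply/eqP; rewrite -subr_eq0 -normr_le0.
  apply/ler_addgt0Pr => d d0; rewrite add0r.
  (* [N] is [M]-Lipschitz and [g * enorm] is [g]-Lipschitz, so moving by [e] costs at most [d]. *)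
  pose e := Num.min (1 / 4) (d / (M + g)).
  have e0 : 0 < e by rewrite lt_min !divr_gt0.
  have [y yx Zy] := nearZ x e e0.
  have e4 : e <= 1 / 4 by rewrite ge_min lexx.
  have ed : (M + g) * e <= d by rewrite mulrC -ler_pdivlMr// ge_min lexx orbT.
  have y1 := ler_enormB_dist y x; have y2 := ler_enormB_dist x y.
  rewrite enormB in y2.
  have yN : N y = g * enorm y.
    apply: eqZ => //; first lra.
    by rewrite -enorm_gt0; lra.
  have L1 := sine_lip mu_isotropic x y (ltn0Sn m).
  have L2 := sine_lip mu_isotropic y x (ltn0Sn m).
  rewrite enormB in L1.
  have Mp := lt_trans a0 aM.
  have K1 := ler_wpM2l (ltW g0) y1; have K2 := ler_wpM2l (ltW g0) y2.
  have K3 := ler_wpM2l (ltW Mg0) yx.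
  apply: (@le_trans _ _ ((M + g) * enorm (y - x))); last exact: le_trans ed.
  move: L1 L2 K1 K2; rewrite yN !mulrBr mulrDl ler_norml.
  move: (N x) (g * enorm x) (g * enorm y) (M * _) (g * enorm (y - x)).
  by move=> p1 p2 p3 p4 p5 *; apply/andP; split; lra.
move=> x; have [->|x0] := eqVneq x 0.
  rewrite enorm0 mulr0; apply/eqP; rewrite eq_le sine_ge0 andbT.
  by have := sine_ub mu_isotropic 0 (ltn0Sn m); rewrite enorm0 mulr0.
have xp : 0 < enorm x by rewrite enorm_gt0.
have s0 : 0 < (2 * enorm x)^-1 by rewrite invr_gt0 mulr_gt0.
have := half ((2 * enorm x)^-1 *: x).
rewrite sineZ// enormZ gtr0_norm// => H.
have {}H : (2 * enorm x)^-1 * N x = g * ((2 * enorm x)^-1 * enorm x).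
  by apply: H; field; rewrite gt_eqF.
by apply: (mulfI (lt0r_neq0 s0)); rewrite H mulrCA.
Qed.

End volume_bounds.

Lemma measurable_antipode (R : realType) (m : nat) :
  measurable_fun setT (@antipode R m : borel_sphere R m -> borel_sphere R m).
Proof.
apply: measurable_to_sphere; apply: measurable_rowP => i.
under eq_fun do rewrite /sphere_row set_valE /= mxE.
apply: measurable_funN.
apply: (@measurable_coord_comp R m.+1 _ _ (@sphere_row R m)).
exact: measurable_sphere_row.
Qed.

(** * Normalized Lebesgue measure as an image of volume *)

Section normalized_measure.
Context (R : realType) (m : nat).
Local Notation n := m.+2.
Local Notation V := 'rV[R]_n.
Local Notation sphere := (borel_sphere R m.+1).
Local Notation B := (@uball R n).

Let mB : measurable B. Proof. exact: measurable_uball. Qed.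
Let B_fin : (volume B < +oo)%E. Proof. exact: volume_uball_lty. Qed.

(** At the origin, a null set, the value is the default [point]. *)
Definition normalize (x : V) : sphere :=
  insubd (point : set_type (unit_sphere R m.+1)) ((enorm x)^-1 *: x).

Lemma normalizeE x : x != 0 -> sphere_row (normalize x) = (enorm x)^-1 *: x.
Proof.
move=> x0; rewrite /sphere_row /normalize set_valE insubdK// inE /unit_sphere /=.
by rewrite enormZ normfV ger0_norm ?enorm_ge0// mulVf// enorm_eq0.
Qed.

Lemma normalizeZ s x : 0 < s -> normalize (s *: x) = normalize x.
Proof.
move=> s0; rewrite /normalize; congr insubd; rewrite enormZ gtr0_norm// scalerA.
by have [->|x0] := eqVneq x 0; rewrite ?scaler0// invfM mulrAC mulVf ?mul1r// gt_eqF.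
Qed.

Lemma normalize_sphere (u : sphere) : normalize (sphere_row u) = u.
Proof.
apply: val_inj; rewrite -!/(sphere_row _); have := set_valP u; rewrite /= => u1.
rewrite -[LHS]/(sphere_row (normalize (sphere_row u))).
have u1' : enorm (sphere_row u) = 1 by exact: u1.
by rewrite normalizeE -?enorm_eq0 ?u1' ?oner_eq0// invr1 scale1r.
Qed.

Lemma measurable_normalize : measurable_fun setT normalize.
Proof.
apply: measurable_to_sphere.
rewrite (_ : (fun z => _) = fun x : V => if x == 0 then sphere_row (normalize 0)
   else (enorm x)^-1 *: x); last first.
  by apply/funext => x; case: eqVneq => [->//|]; exact: normalizeE.
apply: measurable_fun_ifT => //; first exact: measurable_row_neq0.
apply: measurable_rowP => i; under eq_fun do rewrite mxE.
apply: measurable_funM; last exact: measurable_coord.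
by apply: (measurableT_comp (@measurable_inv R)); exact: measurable_enorm.
Qed.

Let c0 : 0 <= n%:R / kappa R n.
Proof. by rewrite divr_ge0// ltW// kappa_gt0. Qed.

(** [normalized_lebesgue] is a bare set function built from cones. This one agrees with it on Borel
    sets and carries the structure of a finite measure. *)
Definition sphere_measure : set sphere -> \bar R :=
  mscale (NngNum c0) (image_measure (mfrestr mB B_fin) measurable_normalize).

HB.instance Definition _ := Measure.on sphere_measure.

Lemma sphere_measureE A :
  sphere_measure A = ((n%:R / kappa R n)%:E * volume (normalize @^-1` A `&` B))%E.
Proof. by []. Qed.

Lemma sphere_measureT : sphere_measure setT = n%:R%:E.
Proof.
rewrite sphere_measureE preimage_setT setTI /= volume_uball -EFinM divfK//.
by rewrite gt_eqF// kappa_gt0.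
Qed.

Let sphere_measure_fin : fin_num_fun sphere_measure.
Proof.
move=> A mA; rewrite ge0_fin_numE//; apply: (@le_lt_trans _ _ (sphere_measure setT)).
  by apply: le_measure; rewrite ?inE.
by rewrite sphere_measureT ltry.
Qed.

HB.instance Definition _ := Measure_isFinite.Build _ _ _ sphere_measure
  sphere_measure_fin.

Lemma ge0_integral_sphere_measure (f : sphere -> \bar R) :
  measurable_fun setT f -> (forall u, 0 <= f u)%E ->
  (\int[sphere_measure]_u f u =
   (n%:R / kappa R n)%:E * \int[@volume R n]_(x in B) f (normalize x))%E.
Proof.
move=> mf f0.
pose nu := image_measure (mfrestr mB B_fin) measurable_normalize.
transitivity ((n%:R / kappa R n)%:E * \int[nu]_u f u)%E.
  by rewrite -(ge0_integral_mscale nu measurableT (NngNum c0))//.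
congr (_ * _)%E.
transitivity (\int[mfrestr mB B_fin]_x f (normalize x))%E.
  exact: (ge0_integral_image_measure _ measurable_normalize mf f0).
transitivity (\int[mfrestr mB B_fin]_(x in B) f (normalize x))%E.
  transitivity (\int[mfrestr mB B_fin]_(x in setT `\` ~` B) f (normalize x))%E;
    last by rewrite setDE setCK setTI.
  apply: ge0_negligible_integral => //.
  - exact: measurableC.
  - exact: measurableT_comp measurable_normalize.
  by rewrite /= /mfrestr /mrestr setICl measure0.
apply: eq_measure_integral => A mA AB.
by rewrite /= /mfrestr /mrestr setIidl.
Qed.

(** The orthogonal matrix -1 preserves the ball and its volume, and off the origin it commutes with
    [normalize] up to [antipode]. *)
Lemma sphere_measure_antipode (A : set sphere) : measurable A ->
  sphere_measure (@antipode R m.+1 @^-1` A) = sphere_measure A.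
Proof.
move=> mA.
have mN := @measurable_antipode R m.+1.
pose f (u : sphere) : \bar R := (\1_A u)%:E.
have mf : measurable_fun setT f by apply/measurable_EFinP/measurable_indic.
have f0 u : (0 <= f u)%E by rewrite lee_fin.
have fE : (\int[sphere_measure]_u f u = sphere_measure A)%E.
  rewrite -[in RHS](setIT A).
  exact: (@integral_indic _ _ _ sphere_measure setT measurableT A mA).
have fNE : (\int[sphere_measure]_u f (antipode u) =
    sphere_measure (@antipode R m.+1 @^-1` A))%E.
  rewrite -[in RHS](setIT (_ @^-1` A)).
  apply: (@integral_indic _ _ _ sphere_measure setT measurableT (@antipode R m.+1 @^-1` A)).
  by rewrite -[X in measurable X]setTI; exact: mN.
have mfN : measurable_fun setT (fun u : sphere => f (antipode u)).
  exact: (measurableT_comp mf mN).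
rewrite -fE -fNE (ge0_integral_sphere_measure mf f0).
rewrite (ge0_integral_sphere_measure mfN)//; congr (_ * _)%E.
have MM : (- 1%:M : 'M[R]_n) *m (- 1%:M)^T = 1%:M.
  by rewrite linearN /= trmx1 mulNmx mulmxN opprK mulmx1.
rewrite [RHS](@integral_mkcondb _ _ _ (@volume R n)
  (fun x : 'rV[R]_n => enorm x <= 1) B)//.
have mfn : measurable_fun setT (fun x => f (normalize x)).
  exact: measurableT_comp measurable_normalize.
rewrite -(ge0_integral_volume_mulmx MM); last 2 first.
- apply: emeasurable_funM => //.
  apply/measurable_EFinP/measurable_fun_natb; apply: measurable_fun_ler => //.
  exact: measurable_enorm.
- by move=> x; rewrite mule_ge0.
under [RHS]eq_integral do rewrite enorm_mulmx//.
rewrite -(@integral_mkcondb _ _ _ (@volume R n)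
  (fun x : 'rV[R]_n => enorm x <= 1) B)//.
apply: ge0_integral_uball_neq0 => //.
- apply: (measurableT_comp mf); apply: (measurableT_comp mN).
  exact: measurable_normalize.
- by apply: (measurableT_comp mfn); exact: measurable_mulmx.
move=> x x0; congr f; apply: val_inj.
rewrite -!/(sphere_row _) mulmxN mulmx1.
transitivity (- sphere_row (normalize x)); first by [].
transitivity (sphere_row (normalize (- x))); last by [].
by rewrite !normalizeE ?oppr_eq0// enormN scalerN.
Qed.

(** For unit vectors |v|u^perp| is symmetric in u and v, so the integral over u is the ball integral
    of [ge0_integral_proj_perp] at v. *)
Lemma sine_sphere_measure x : sine sphere_measure x = gamma R n * enorm x.
Proof.
have [->|x0] := eqVneq x 0.
  rewrite enorm0 mulr0 /sine.
  under eq_Rintegral do rewrite /proj_perp dot0l scale0r subr0 enorm0.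
  by rewrite Rintegral_cst// mul0r.
have xp : 0 < enorm x by rewrite enorm_gt0.
pose v := (enorm x)^-1 *: x.
have v1 : dot v v = 1.
  rewrite /v dotZl dotZr -enorm_sqr expr2 mulrA mulrA -(mulrA _ (enorm x)^-1).
  by rewrite mulrAC mulVf ?mul1r ?mulVf// gt_eqF.
have xE : x = enorm x *: v by rewrite /v scalerA mulfV ?scale1r// gt_eqF.
rewrite {1}xE sineZ// mulrC; congr (_ * _); apply: EFin_inj.
rewrite -sine_transformE /sine_transform -/sphere_row.
rewrite ge0_integral_sphere_measure; last 2 first.
- by apply/measurable_EFinP; case: (bounded_measurable_proj v).
- by move=> u; rewrite lee_fin enorm_ge0.
transitivity ((n%:R / kappa R n)%:E * (kappa R n * gamma R n / n%:R)%:E)%E.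
  congr (_ * _)%E; rewrite -(ge0_integral_proj_perp v1).
  apply: ge0_integral_uball_neq0 => //.
  - apply/measurable_EFinP; apply: (@measurableT_comp _ _ _ _ _ _
      (fun u : sphere => enorm (proj_perp (sphere_row u) v))).
      by case: (bounded_measurable_proj v).
    exact: measurable_normalize.
  - apply/measurable_EFinP; apply: measurable_funM.
      under eq_fun do rewrite enorm_proj_perp//.
      apply: (measurableT_comp (@measurable_sqrt R)); apply: measurable_funB.
        by apply: measurable_funX; exact: measurable_enorm.
      by apply: measurable_funX; apply: measurable_dot.
    by apply: (measurableT_comp (@measurable_inv R)); exact: measurable_enorm.
  - by move=> y; rewrite lee_fin enorm_ge0.
  - by move=> y; rewrite lee_fin divr_ge0 ?enorm_ge0.
  move=> y y0; congr EFin.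
  have yp : 0 < enorm y by rewrite enorm_gt0.
  rewrite !enorm_proj_perp ?dot_sphere// -/(sphere_row _) normalizeE// dotZr.
  rewrite [in LHS]enorm_sqr v1 (dotC v y).
  have : 0 <= enorm y ^+ 2 - dot y v ^+ 2.
    rewrite subr_ge0; apply: le_trans (cauchy_schwarz y v) _.
    by rewrite v1 mulr1 enorm_sqr.
  move: (enorm y) (dot y v) yp => e b e0 eb.
  rewrite -[X in _ / X]ger0_norm ?ltW// -sqrtr_sqr -sqrtrV ?sqr_ge0// -sqrtrM//.
  by congr Num.sqrt; field; rewrite gt_eqF.
rewrite -EFinM; congr _%:E.
have := kappa_gt0 R n; move: (kappa R n) (gamma R n) => k g k0.
have : (n%:R : R) != 0 by [].
move: (n%:R : R) => p p0; field.
by rewrite p0 gt_eqF.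
Qed.

(** The cone over a set is, up to the origin, the part of the ball that [normalize] maps into it. *)
Lemma normalized_lebesgueE A : measurable A ->
  normalized_lebesgue A = sphere_measure A.
Proof.
have coneE (D : set sphere) : measurable D ->
    spherical_lebesgue D = (n%:R%:E * volume (normalize @^-1` D `&` B))%E.
  move=> mD; rewrite /spherical_lebesgue.
  suff -> : volume [set x : V | exists2 u, D u &
      exists2 r : R, 0 < r <= 1 & x = r *: set_val u] =
    volume (normalize @^-1` D `&` B) by [].
  have mX : measurable (normalize @^-1` D `&` B).
    apply: measurableI => //.
    by rewrite -[X in measurable X]setTI; exact: measurable_normalize.
  have m0 := measurable_set1_row (0 : V).
  rewrite [RHS](measureDI _ mX m0).
  rewrite [X in (_ + X)%E](_ : _ = 0%E) ?adde0; last first.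
    apply: (subset_measure0 _ m0) => //; first exact: measurableI.
    exact: volume_set1_0.
  congr (volume _); apply/seteqP; split => [x [u Du [r /andP[r0 r1] ->]]|x].
    rewrite -/(sphere_row u); split; first split.
    - by rewrite /= normalizeZ// normalize_sphere.
    - by rewrite /uball /= enormZ /enorm dot_sphere sqrtr1 mulr1 ger0_norm// ltW.
    - move=> /= /eqP; rewrite scaler_eq0 (gt_eqF r0)/= -enorm_eq0.
      by rewrite /enorm dot_sphere sqrtr1 oner_eq0.
  move=> [[/= Dx x1] /eqP x0]; exists (normalize x) => //; exists (enorm x).
    by rewrite enorm_gt0 x0.
  by rewrite -/(sphere_row _) normalizeE// scalerA mulfV ?scale1r// enorm_eq0.
move=> mA; rewrite /normalized_lebesgue !coneE// preimage_setT setTI /= volume_uball.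
rewrite /= sphere_measureE muleA -EFinM; congr (_%:E * _)%E.
have := kappa_gt0 R n; move: (kappa R n) => k k0.
have : (n%:R : R) != 0 by [].
move: (n%:R : R) => p p0; field.
by rewrite p0 gt_eqF.
Qed.

End normalized_measure.

(** * The equality case *)

Section sqrt_polynomials.
Context (R : realType).

(* [sqrt_poly j] increases to [1 - sqrt (1 - s)] on [0, 1]: the limit [t]
   solves [t = (s + t ^+ 2) / 2]. *)
Fixpoint sqrt_poly (j : nat) : {poly R} :=
  if j is j'.+1 then 2^-1 *: ('X + sqrt_poly j' ^+ 2) else 0.

Lemma coef_sqrt_polyS j k : (sqrt_poly j.+1)`_k =
  2^-1 * ((k == 1)%:R + \sum_(i < k.+1) (sqrt_poly j)`_i * (sqrt_poly j)`_(k - i)).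
Proof. by rewrite /= coefZ coefD coefX expr2 coefM. Qed.

Lemma coef_sqrt_poly_ge0 j k : 0 <= (sqrt_poly j)`_k.
Proof.
elim: j k => [k|j IHj k]; first by rewrite coef0.
rewrite coef_sqrt_polyS mulr_ge0// addr_ge0//.
by apply: sumr_ge0 => i _; rewrite mulr_ge0.
Qed.

Lemma coef_sqrt_poly_leS j k : (sqrt_poly j)`_k <= (sqrt_poly j.+1)`_k.
Proof.
elim: j k => [k|j IHj k]; first by rewrite coef0 coef_sqrt_poly_ge0.
rewrite !coef_sqrt_polyS ler_wpM2l// lerD2l.
by apply: ler_sum => i _; apply: ler_pM; rewrite ?coef_sqrt_poly_ge0.
Qed.

Lemma coef_sqrt_poly_le i j k : (i <= j)%N ->
  (sqrt_poly i)`_k <= (sqrt_poly j)`_k.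
Proof.
elim: j => [|j IHj]; first by rewrite leqn0 => /eqP ->.
rewrite leq_eqVlt => /orP[/eqP ->//|/IHj/le_trans]; apply.
exact: coef_sqrt_poly_leS.
Qed.

Lemma coef_sqrt_poly_gt0 j k : (0 < k <= j)%N -> 0 < (sqrt_poly j)`_k.
Proof.
elim: j k => [[]//|j IHj [//|k]] /= kj.
rewrite coef_sqrt_polyS mulr_gt0// ?invr_gt0//.
have sum0 : 0 <= \sum_(i < k.+2) (sqrt_poly j)`_i * (sqrt_poly j)`_(k.+1 - i).
  by apply: sumr_ge0 => i _; rewrite mulr_ge0 ?coef_sqrt_poly_ge0.
case: k kj sum0 => [_ sum0|k kj sum0].
  by rewrite eqxx ltr_wpDr.
(* The term [i = 1] is already positive: it is the product of the coefficients of degrees 1 and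
   [k.+1] of the previous iterate. *)
rewrite add0r (bigD1 (Ordinal (isT : (1 < k.+3)%N)))//= ltr_wpDr//.
  by apply: sumr_ge0 => i _; rewrite mulr_ge0 ?coef_sqrt_poly_ge0.
by rewrite subSS subn0; apply: mulr_gt0; apply: IHj; move: kj; lia.
Qed.

(** With t the limit and p the iterate, the error e = t - p becomes e (t + p)/2 <= e (2 - e)/2,
    which carries 2/(j+2) to 2/(j+3) uniformly in [s]. *)
Lemma sqrt_poly_bounds j s : 0 <= s <= 1 ->
  0 <= 1 - Num.sqrt (1 - s) - (sqrt_poly j).[s] <= 2 / (j + 2)%:R.
Proof.
move=> /andP[s0 s1].
have s10 : 0 <= 1 - s by rewrite subr_ge0.
set t := 1 - Num.sqrt (1 - s).
have tE : t = (s + t ^+ 2) / 2.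
  have := sqr_sqrtr s10; rewrite /t; move: (Num.sqrt _) => w wE.
  have -> : s = 1 - w ^+ 2 by rewrite wE; ring.
  by field.
have t1 : t <= 1 by rewrite /t gerBl sqrtr_ge0.
have t0 : 0 <= t by rewrite /t subr_ge0 -[leRHS]sqrtr1 ler_wsqrtr// gerBl.
have p0 k : 0 <= (sqrt_poly k).[s].
  by elim: k => [|k IHk]; rewrite /= !hornerE// mulr_ge0// addr_ge0// sqr_ge0.
elim: j => [|j /andP[e0 ej]].
  by rewrite /= horner0 subr0 t0 add0n divff.
have -> : (sqrt_poly j.+1).[s] = (s + (sqrt_poly j).[s] ^+ 2) / 2.
  by rewrite /= !hornerE mulrC.
move: (p0 j) e0 ej; move: ((sqrt_poly j).[s]) => p pp e0 ej.
have -> : t - (s + p ^+ 2) / 2 = (t - p) * (t + p) / 2.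
  by rewrite {1}tE; field.
apply/andP; split; first by rewrite !mulr_ge0// addr_ge0.
have j2 : 0 < (j + 2)%:R :> R by rewrite ltr0n addn2.
set x := 2 / (j + 2)%:R in ej.
have x1 : x <= 1.
  by rewrite ler_pdivrMr// mul1r (ler_nat _ 2) leq_addl.
apply: (@le_trans _ _ (x * (2 - x) / 2)).
  rewrite ler_pM2r ?invr_gt0//.
  apply: (@le_trans _ _ ((t - p) * (2 - (t - p)))).
    by rewrite ler_wpM2l//; move: t1; lra.
  move: e0 ej x1; move: (t - p) => e e0 ex x1.
  rewrite -subr_ge0.
  have -> : x * (2 - x) - e * (2 - e) = (x - e) * (2 - x - e) by ring.
  by rewrite mulr_ge0//; lra.
rewrite /x addSn -[(j + 2).+1%:R]natr1; move: ((j + 2)%:R : R) j2 => q q0.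
rewrite -subr_ge0.
have -> : 2 / (q + 1) - 2 / q * (2 - 2 / q) / 2 = 2 / (q ^+ 2 * (q + 1)).
  by field; rewrite !gt_eqF// addr_gt0.
by rewrite divr_ge0// mulr_ge0// ?sqr_ge0// addr_ge0// ltW.
Qed.

End sqrt_polynomials.

(** * Moments and energies *)

Section moments.
Context (R : realType) (m : nat).
Local Notation n := m.+1.
Local Notation V := 'rV[R]_n.
Local Notation sphere := (borel_sphere R m).
Implicit Types (a b : {finite_measure set sphere -> \bar R}) (u v : sphere).

Let mT : measurable (@setT sphere). Proof. exact: measurableT. Qed.
Let aT a : (a setT < +oo)%E. Proof. exact: fin_num_fun_lty. Qed.
#[local] Hint Extern 0 (is_true (_ < +oo)%E) => exact: aT : core.

(** Indexing by functions [f] expands (u.v)^K without multinomial coefficients, so that energies are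
    diagonal in the moments. *)
Definition monomial K (f : {ffun 'I_K -> 'I_n}) u : R :=
  \prod_(j < K) sphere_row u 0 (f j).

Definition moment a K (f : {ffun 'I_K -> 'I_n}) : R :=
  \int[a]_(u in setT) monomial f u.

Lemma bounded_measurable_monomial K (f : {ffun 'I_K -> 'I_n}) :
  bounded_measurable setT (monomial f).
Proof. by apply: bounded_measurable_prod => j; exact: bounded_measurable_coord. Qed.

Lemma dot_exprn u v K : dot (sphere_row u) (sphere_row v) ^+ K =
  \sum_(f : {ffun 'I_K -> 'I_n}) monomial f u * monomial f v.
Proof.
transitivity (\prod_(j < K) dot (sphere_row u) (sphere_row v)).
  by rewrite prodr_const card_ord.
rewrite /dot bigA_distr_bigA /=.
by apply: eq_bigr => f _; rewrite big_split.
Qed.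

Lemma integral_moment a K u :
  \int[a]_(v in setT) dot (sphere_row u) (sphere_row v) ^+ K =
  \sum_(f : {ffun 'I_K -> 'I_n}) monomial f u * moment a f.
Proof.
under eq_Rintegral do rewrite dot_exprn.
rewrite Rintegral_sum//; last first.
  by move=> f; apply: bounded_measurableZ; exact: bounded_measurable_monomial.
apply: eq_bigr => f _; rewrite RintegralZl//.
apply: bounded_measurable_integrable => //; exact: bounded_measurable_monomial.
Qed.

Definition energy a b (p : {poly R}) : R :=
  \int[a]_(u in setT) \int[b]_(v in setT)
    p.[dot (sphere_row u) (sphere_row v) ^+ 2].

Lemma inner_energyE b (p : {poly R}) u :
  \int[b]_(v in setT) p.[dot (sphere_row u) (sphere_row v) ^+ 2] =
  \sum_(k < size p) p`_k *
    \sum_(f : {ffun 'I_(2 * k) -> 'I_n}) monomial f u * moment b f.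
Proof.
under eq_Rintegral do rewrite horner_coef.
have bm k : bounded_measurable setT
    (fun v => (dot (sphere_row u) (sphere_row v) ^+ 2) ^+ k).
  by do 2!apply: bounded_measurableX; exact: bounded_measurable_dot.
rewrite Rintegral_sum//; last by move=> k; exact: bounded_measurableZ.
apply: eq_bigr => k _; rewrite RintegralZl//; last first.
  exact: bounded_measurable_integrable.
by congr (_ * _); rewrite -integral_moment; under eq_Rintegral do rewrite -exprM.
Qed.

Lemma bounded_measurable_inner_energy b (p : {poly R}) :
  bounded_measurable setT (fun u =>
    \int[b]_(v in setT) p.[dot (sphere_row u) (sphere_row v) ^+ 2]).
Proof.
under eq_fun do rewrite inner_energyE.
apply: bounded_measurable_sum => k; apply: bounded_measurableZ.
apply: bounded_measurable_sum => f; apply: bounded_measurableM.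
  exact: bounded_measurable_monomial.
exact: bounded_measurable_cst.
Qed.

Lemma energyE a b p : energy a b p =
  \sum_(k < size p) p`_k *
    \sum_(f : {ffun 'I_(2 * k) -> 'I_n}) moment a f * moment b f.
Proof.
rewrite /energy; under eq_Rintegral do rewrite inner_energyE.
have bm k (f : {ffun 'I_(2 * k) -> 'I_n}) :
    bounded_measurable setT (fun u => monomial f u * moment b f).
  apply: bounded_measurableM; last exact: bounded_measurable_cst.
  exact: bounded_measurable_monomial.
rewrite Rintegral_sum//; last first.
  by move=> k; apply: bounded_measurableZ; exact: bounded_measurable_sum.
apply: eq_bigr => k _; rewrite RintegralZl//; last first.
  by apply: bounded_measurable_integrable => //; exact: bounded_measurable_sum.
congr (_ * _); rewrite Rintegral_sum//; apply: eq_bigr => f _.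
rewrite RintegralZr//; apply: bounded_measurable_integrable => //.
exact: bounded_measurable_monomial.
Qed.

Section constant_sine.
Variables (g : R) (a b : {finite_measure set sphere -> \bar R}).
Hypotheses (a_mass : a setT = n%:R%:E) (b_mass : b setT = n%:R%:E).
Hypothesis b_sine : forall x, sine b x = g * enorm x.

Let kernel_bounds j u v :
  0 <= 1 - enorm (proj_perp (sphere_row v) (sphere_row u)) -
    (sqrt_poly R j).[dot (sphere_row u) (sphere_row v) ^+ 2] <= 2 / (j + 2)%:R.
Proof.
rewrite enorm_proj_perp ?dot_sphere// enorm_sqr dot_sphere.
apply: sqrt_poly_bounds; rewrite sqr_ge0/=.
by have := dot_sphere_le (sphere_row u) v; rewrite enorm_sqr dot_sphere.
Qed.

(** For every u the kernel 1 - |u|v^perp| has integral n - g against [b], so its double integral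
    depends only on n and [g]; the rest is the uniform error of [sqrt_poly]. *)
Lemma energy_bounds j :
  0 <= n%:R * (n%:R - g) - energy a b (sqrt_poly R j) <= n%:R * (n%:R * (2 / (j + 2)%:R)).
Proof.
pose I u := \int[b]_(v in setT) (sqrt_poly R j).[dot (sphere_row u) (sphere_row v) ^+ 2].
have bp u : bounded_measurable setT
    (fun v => enorm (proj_perp (sphere_row v) (sphere_row u))).
  exact: bounded_measurable_proj.
have bI : bounded_measurable setT I by exact: bounded_measurable_inner_energy.
have bK u : bounded_measurable setT
    (fun v => (sqrt_poly R j).[dot (sphere_row u) (sphere_row v) ^+ 2]).
  under eq_fun do rewrite horner_coef.
  apply: bounded_measurable_sum => k; apply: bounded_measurableZ.
  by do 2!apply: bounded_measurableX; exact: bounded_measurable_dot.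
have bc c : bounded_measurable (@setT sphere) (fun=> c : R).
  exact: bounded_measurable_cst.
have IE u : n%:R - g - I u = \int[b]_(v in setT)
   (1 - enorm (proj_perp (sphere_row v) (sphere_row u)) -
    (sqrt_poly R j).[dot (sphere_row u) (sphere_row v) ^+ 2]).
  rewrite RintegralB//; last 2 first.
  - by apply: bounded_measurable_integrable => //; exact: bounded_measurableB.
  - exact: bounded_measurable_integrable.
  congr (_ - _); rewrite RintegralB//; last 2 first.
  - exact: bounded_measurable_integrable.
  - exact: bounded_measurable_integrable.
  rewrite Rintegral_cst//= b_mass mul1r -/(sine b (sphere_row u)) b_sine.
  by rewrite /enorm dot_sphere sqrtr1 mulr1.
have bk u : bounded_measurable setT (fun v =>
   1 - enorm (proj_perp (sphere_row v) (sphere_row u)) -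
    (sqrt_poly R j).[dot (sphere_row u) (sphere_row v) ^+ 2]).
  by apply: bounded_measurableB => //; exact: bounded_measurableB.
have Ib u : 0 <= n%:R - g - I u <= n%:R * (2 / (j + 2)%:R).
  rewrite IE; apply/andP; split.
    by apply: Rintegral_ge0 => v _; case/andP: (kernel_bounds j u v).
  have -> : n%:R * (2 / (j + 2)%:R) = \int[b]_(v in setT) (2 / (j + 2)%:R) :> R.
    by rewrite Rintegral_cst//= b_mass mulrC.
  apply: le_Rintegral => //; try exact: bounded_measurable_integrable.
  by move=> v _; case/andP: (kernel_bounds j u v).
have -> : n%:R * (n%:R - g) - energy a b (sqrt_poly R j) =
    \int[a]_(u in setT) (n%:R - g - I u).
  rewrite RintegralB//; try exact: bounded_measurable_integrable.
  by rewrite Rintegral_cst//= a_mass mulrC.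
apply/andP; split.
  by apply: Rintegral_ge0 => u _; case/andP: (Ib u).
have -> : n%:R * (n%:R * (2 / (j + 2)%:R)) =
    \int[a]_(u in setT) (n%:R * (2 / (j + 2)%:R)) :> R.
  by rewrite Rintegral_cst//= a_mass mulrC.
apply: le_Rintegral => //; try exact: bounded_measurable_integrable.
  by apply: bounded_measurable_integrable => //; exact: bounded_measurableB.
by move=> u _; case/andP: (Ib u).
Qed.

End constant_sine.

(* [E(a,a) - E(a,b) - E(b,a) + E(b,b)] is a sum of squares of differences of
   even moments with positive weights, and tends to 0 along [sqrt_poly]. *)
Lemma even_moments_unique (g : R) a b :
  a setT = n%:R%:E -> b setT = n%:R%:E ->
  (forall x, sine a x = g * enorm x) -> (forall x, sine b x = g * enorm x) ->
  forall k (f : {ffun 'I_(2 * k) -> 'I_n}), moment a f = moment b f.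
Proof.
move=> a1 b1 ag bg [f|k].
  (* The constant coefficient of [sqrt_poly] is 0, so degree 0 is settled by the equal total
     masses. *)
  rewrite /moment /monomial; under eq_Rintegral do rewrite big_ord0.
  under [in RHS]eq_Rintegral do rewrite big_ord0.
  by rewrite !Rintegral_cst//= a1 b1.
pose D i : R := \sum_(f : {ffun 'I_(2 * i) -> 'I_n}) (moment a f - moment b f) ^+ 2.
have D0 i : 0 <= D i by apply: sumr_ge0 => f _; rewrite sqr_ge0.
have DE j : \sum_(i < size (sqrt_poly R j)) (sqrt_poly R j)`_i * D i =
    energy a a (sqrt_poly R j) + energy b b (sqrt_poly R j) -
    energy a b (sqrt_poly R j) - energy b a (sqrt_poly R j).
  rewrite !energyE -big_split /= -!sumrB; apply: eq_bigr => i _.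
  rewrite -mulrDr -!mulrBr; congr (_ * _).
  rewrite -big_split /= -!sumrB; apply: eq_bigr => f _.
  by move: (moment a f) (moment b f) => s t; ring.
(* The coefficients increase with the iterate, so [c] bounds the weight of [D k.+1] from below in
   all later ones. *)
pose c := (sqrt_poly R k.+1)`_k.+1.
have c0 : 0 < c by apply: coef_sqrt_poly_gt0; rewrite leqnn.
have Dj j : (k < j)%N -> c * D k.+1 <= 2 * (n%:R * (n%:R * (2 / (j + 2)%:R))).
  move=> kj; apply: (@le_trans _ _
      (\sum_(i < size (sqrt_poly R j)) (sqrt_poly R j)`_i * D i)).
    have cj : c <= (sqrt_poly R j)`_k.+1 by exact: coef_sqrt_poly_le.
    have kp : (k.+1 < size (sqrt_poly R j))%N.
      rewrite ltnNge; apply/negP => /leq_sizeP/(_ k.+1 (leqnn _)) p0.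
      by have := lt_le_trans c0 cj; rewrite p0 ltxx.
    rewrite (bigD1 (Ordinal kp))//=.
    apply: (@le_trans _ _ ((sqrt_poly R j)`_k.+1 * D k.+1)); first by rewrite ler_wpM2r.
    rewrite lerDl; apply: sumr_ge0 => i _.
    by rewrite mulr_ge0// coef_sqrt_poly_ge0.
  rewrite DE.
  have /andP[aa _] := energy_bounds a1 a1 ag j.
  have /andP[bb _] := energy_bounds b1 b1 bg j.
  have /andP[_ ab] := energy_bounds a1 b1 bg j.
  have /andP[_ ba] := energy_bounds b1 a1 ag j.
  move: aa bb ab ba.
  move: (energy a a _) (energy b b _) (energy a b _) (energy b a _) => w x y z.
  move: (n%:R * (n%:R - g)) (n%:R * (n%:R * _)) => s t; lra.
have Dk0 : D k.+1 = 0.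
  apply/eqP; rewrite eq_le D0 andbT leNgt; apply/negP => Dpos.
  have cD : 0 < c * D k.+1 by rewrite mulr_gt0.
  pose C : R := 4 * n%:R * n%:R / (c * D k.+1).
  have C0 : 0 <= C by rewrite divr_ge0// ?(ltW cD)// !mulr_ge0.
  (* Beyond [C] the bound 4 n^2/(j+2) of [Dj] falls below [c * D k.+1]. *)
  pose j := maxn k.+1 (Num.bound C).
  have /Dj : (k < j)%N by rewrite leq_max leqnn.
  rewrite leNgt => /negP; apply.
  have Cj : C < (j + 2)%:R.
    apply: lt_le_trans (archi_boundP C0) _.
    by rewrite ler_nat -[leqLHS]addn0 leq_add// leq_maxr.
  have -> : 2 * (n%:R * (n%:R * (2 / (j + 2)%:R))) = C * (c * D k.+1) / (j + 2)%:R :> R.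
    rewrite /C divfK ?gt_eqF//.
    by move: ((j + 2)%:R)^-1 (n%:R : R) => x y; ring.
  rewrite ltr_pdivrMr; last by apply: le_lt_trans Cj.
  by rewrite mulrC ltr_pM2l.
move=> f; apply/eqP; rewrite -subr_eq0 -sqrf_eq0; apply/eqP.
move: Dk0; rewrite /D => /eqP; rewrite psumr_eq0 => [/allP/(_ f)|i _].
  by rewrite mem_index_enum => /(_ isT)/eqP.
exact: sqr_ge0.
Qed.

Lemma odd_moment a K (f : {ffun 'I_K -> 'I_n}) :
  (forall A : set sphere, measurable A -> a (@antipode R m @^-1` A) = a A) ->
  odd K -> moment a f = 0.
Proof.
move=> a_sym oddK; set F := monomial f.
have bF : bounded_measurable setT F by exact: bounded_measurable_monomial.
(* Adding 1 makes the integrand nonnegative, as the formula for image measures requires. *)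
have bF1 : bounded_measurable setT (fun u => F u + 1).
  by apply: bounded_measurableD => //; exact: bounded_measurable_cst.
have F0 u : 0 <= F u + 1.
  suff : `|F u| <= 1 by rewrite ler_norml => /andP[+ _]; rewrite -subr_ge0 opprK.
  rewrite normr_prod; apply: prodr_ile1 => j _.
  by rewrite normr_ge0 sphere_coord_le1.
have FN (u : sphere) : F (antipode u) = - F u.
  rewrite /F /monomial; under eq_bigr do rewrite /sphere_row set_valE /= mxE.
  by rewrite prodrN card_ord -signr_odd oddK mulN1r.
have : \int[a]_(u in setT) (F u + 1) = \int[a]_(u in setT) (- F u + 1).
  rewrite /Rintegral; congr fine.
  transitivity (\int[image_measure a (@measurable_antipode R m)]_u (F u + 1)%:E)%E.
    by apply: eq_measure_integral => A mA _; apply/esym; exact: a_sym.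
  rewrite ge0_integral_image_measure//; last first.
    by apply/measurable_EFinP; case: bF1.
  by apply: eq_integral => u _; rewrite FN.
have bN : bounded_measurable setT (fun u => - F u) by exact: bounded_measurableN.
have b1 : bounded_measurable (@setT sphere) (fun=> 1 : R).
  exact: bounded_measurable_cst.
rewrite !RintegralD//; try exact: bounded_measurable_integrable.
move=> /addIr; under [RHS]eq_Rintegral do rewrite -mulN1r.
rewrite RintegralZl//; last exact: bounded_measurable_integrable.
by rewrite mulN1r -/F => /eqP; rewrite -subr_eq0 opprK -mulr2n mulrn_eq0 => /eqP.
Qed.

Lemma integral_prod_coord_unique (g : R) a b :
  a setT = n%:R%:E -> b setT = n%:R%:E ->
  (forall x, sine a x = g * enorm x) -> (forall x, sine b x = g * enorm x) ->
  (forall A : set sphere, measurable A -> a (@antipode R m @^-1` A) = a A) ->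
  (forall A : set sphere, measurable A -> b (@antipode R m @^-1` A) = b A) ->
  forall s : seq 'I_n,
  \int[a]_(u in setT) (\prod_(i <- s) sphere_row u 0 i) =
  \int[b]_(u in setT) (\prod_(i <- s) sphere_row u 0 i).
Proof.
move=> a1 b1 ag bg aN bN s.
have momentE K (f : {ffun 'I_K -> 'I_n}) : moment a f = moment b f.
  case: (boolP (odd K)) => [oK|eK]; first by rewrite !odd_moment.
  move: f; have -> : K = (2 * K./2)%N by rewrite mul2n even_halfK.
  by move=> f; exact: (even_moments_unique a1 b1 ag bg).
have := momentE (size s) [ffun j => tnth (in_tuple s) j].
rewrite /moment /monomial.
under eq_Rintegral do under eq_bigr do rewrite ffunE.
under [in RHS]eq_Rintegral do under eq_bigr do rewrite ffunE.
under [in RHS]eq_Rintegral do rewrite -(big_tnth _ _ s xpredT).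
by under eq_Rintegral do rewrite -(big_tnth _ _ s xpredT).
Qed.

End moments.

(** * Polynomials approximating a step *)

Section steps.
Context (R : realType).

(* These polynomials tend on [0, 1] to the indicator function of [t < 1/2]. *)
Definition step_poly (k : nat) (t : R) : R := (1 - t ^+ k) ^+ (k * 2 ^ k).

Lemma step_poly_bounds k t : 0 <= t <= 1 -> 0 <= step_poly k t <= 1.
Proof.
move=> /andP[t0 t1]; have tk1 : t ^+ k <= 1 by rewrite exprn_ile1.
have tk0 : 0 <= t ^+ k by rewrite exprn_ge0.
by rewrite exprn_ge0 ?subr_ge0//= exprn_ile1 ?subr_ge0// gerBl.
Qed.

(** With r = q^2, Bernoulli's inequality bounds k q^k, and the remaining factor q^k tends to 0. *)
Lemma cvg_natr_expr (r : R) : 0 <= r < 1 -> k%:R * r ^+ k @[k --> \oo] --> 0.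
Proof.
move=> /andP[]; rewrite le_eqVlt => /orP[/eqP <- _|r0 r1].
  apply: cvg_near_cst; near=> k.
  rewrite expr0n (_ : (k == 0)%N = false) ?mulr0//.
  by apply/negbTE; rewrite -lt0n; near: k; exact: nbhs_infty_gt.
pose q : R := Num.sqrt r.
have q0 : 0 < q by rewrite sqrtr_gt0.
have qq : q ^+ 2 = r by rewrite sqr_sqrtr// ltW.
have q1 : q < 1 by rewrite -[ltRHS]sqrtr1 ltr_sqrt.
pose d := q^-1 - 1.
have d0 : 0 < d by rewrite subr_gt0 invf_gt1.
have kq k : k%:R * q ^+ k <= d^-1.
  rewrite -[d^-1]mul1r ler_pdivlMr// mulrAC -ler_pdivlMr ?exprn_gt0// mul1r.
  have dE : 1 + d = q^-1 by rewrite /d addrC subrK.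
  rewrite -exprVn -dE; apply: le_trans (bernoulli_ineq k (_ : -1 <= d)).
    by rewrite lerDr.
  by rewrite (le_trans _ (ltW d0)).
apply: (@squeeze_cvgr _ _ _ _ (fun=> 0) (fun k => d^-1 * q ^+ k)).
- near=> k; rewrite mulr_ge0 ?exprn_ge0 ?(ltW r0)//=.
  by rewrite -qq -exprM mulnC exprM expr2 mulrA ler_wpM2r ?exprn_ge0 ?(ltW q0).
- exact: cvg_cst.
- rewrite -[X in _ --> X](mulr0 d^-1); apply: cvgM; first exact: cvg_cst.
  by apply: cvg_expr; rewrite gtr0_norm.
Unshelve. all: by end_near. Qed.

(** Below 1/2, Bernoulli's inequality gives at least 1 - k (2t)^k. From 1/2 on, (1 - t^k)(1 + t^k)
    <= 1 gives at most 1/(k+1). The factor k in the exponent forces the limit 0 at t = 1/2, where (1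
    - 2^-k)^(2^k) tends to 1/e. *)
Lemma cvg_step_poly (t : R) : 0 <= t <= 1 ->
  step_poly k t @[k --> \oo] --> ((t < 1 / 2)%R%:R : R).
Proof.
move=> t01; have /andP[t0 t1] := t01; have [t2|t2] := ltP.
- apply: (@squeeze_cvgr _ _ _ _ (fun k => 1 - k%:R * (2 * t) ^+ k) (fun=> 1)).
  + near=> k; have /andP[_ ->] := step_poly_bounds k t01; rewrite andbT.
    rewrite /step_poly; have := @bernoulli_ineq R (- t ^+ k) (k * 2 ^ k)%N.
    rewrite lerN2 exprn_ile1// => /(_ isT); apply: le_trans.
    by rewrite mulrN natrM natrX exprMn mulrA.
  + rewrite -[X in _ --> X]subr0; apply: cvgB; first exact: cvg_cst.
    by apply: cvg_natr_expr; rewrite mulr_ge0//=; move: t2; lra.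
  + exact: cvg_cst.
- apply: (@squeeze_cvgr _ _ _ _ (fun=> 0) harmonic); last exact: cvg_harmonic.
    near=> k; have /andP[-> _] := step_poly_bounds k t01.
    rewrite /= /harmonic /=.
    have tk0 : 0 <= t ^+ k by rewrite exprn_ge0.
    have tk1 : t ^+ k <= 1 by rewrite exprn_ile1.
    have N1 : k.+1%:R <= (1 + t ^+ k) ^+ (k * 2 ^ k).
      apply: le_trans (@bernoulli_ineq R (t ^+ k) (k * 2 ^ k)%N _); last first.
        by apply: le_trans tk0; rewrite oppr_le0.
      rewrite -natr1 addrC lerD2l natrM -mulrA ler_peMr// natrX -exprMn.
      by rewrite exprn_ege1//; move: t2; lra.
    rewrite -[leRHS]mul1r ler_pdivlMr//.
    apply: (@le_trans _ _ (step_poly k t * (1 + t ^+ k) ^+ (k * 2 ^ k))).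
      by rewrite ler_wpM2l// exprn_ge0// subr_ge0.
    rewrite /step_poly -exprMn exprn_ile1//.
      by rewrite mulr_ge0 ?subr_ge0// addr_ge0.
    by rewrite -subr_sqr expr1n gerBl sqr_ge0.
  exact: cvg_cst.
Unshelve. all: by end_near. Qed.

Lemma cvg_prod_seq (I : Type) (s : seq I) (F : nat -> I -> R) (l : I -> R) :
  (forall i, F k i @[k --> \oo] --> l i) ->
  \prod_(i <- s) F k i @[k --> \oo] --> \prod_(i <- s) l i.
Proof.
move=> Fl; elim: s => [|i s IHs].
  under eq_fun do rewrite big_nil; rewrite big_nil; exact: cvg_cst.
by under eq_fun do rewrite big_cons; rewrite big_cons; exact: cvgM.
Qed.

End steps.

(** * Moments determine a measure on the sphere *)

Section moment_uniqueness.
Context (R : realType) (m : nat).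
Local Notation n := m.+1.
Local Notation sphere := (borel_sphere R m).
Implicit Types (u : sphere) (F G : sphere -> R).

(** A monomial is a list of indices with repetition, so that multiplying monomials is
    concatenation. *)
Definition polynomial_function F := exists e : seq (R * seq 'I_n),
  forall u, F u = \sum_(p <- e) p.1 * \prod_(i <- p.2) sphere_row u 0 i.

Lemma polynomial_function_cst c : polynomial_function (fun=> c).
Proof. by exists [:: (c, [::])] => u; rewrite big_seq1 big_nil mulr1. Qed.

Lemma polynomial_function_coord i : polynomial_function (fun u => sphere_row u 0 i).
Proof. by exists [:: (1, [:: i])] => u; rewrite !big_seq1 mul1r. Qed.

Lemma polynomial_functionD F G : polynomial_function F -> polynomial_function G ->
  polynomial_function (fun u => F u + G u).
Proof. by move=> [e Fe] [f Gf]; exists (e ++ f) => u; rewrite big_cat Fe Gf. Qed.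

Lemma polynomial_functionM F G : polynomial_function F -> polynomial_function G ->
  polynomial_function (fun u => F u * G u).
Proof.
move=> [e Fe] [f Gf]; exists [seq (p.1 * q.1, p.2 ++ q.2) | p <- e, q <- f] => u.
rewrite big_allpairs_dep Fe Gf mulr_suml; apply: eq_bigr => p _.
by rewrite mulr_sumr; apply: eq_bigr => q _ /=; rewrite big_cat mulrACA.
Qed.

Lemma polynomial_function_prod (I : Type) (s : seq I) (F : I -> sphere -> R) :
  (forall i, polynomial_function (F i)) ->
  polynomial_function (fun u => \prod_(i <- s) F i u).
Proof.
move=> pF; elim: s => [|i s IHs].
  under eq_fun do rewrite big_nil; exact: polynomial_function_cst.
by under eq_fun do rewrite big_cons; exact: polynomial_functionM.
Qed.

Lemma polynomial_functionX F k : polynomial_function F ->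
  polynomial_function (fun u => F u ^+ k).
Proof.
move=> pF; elim: k => [|k IHk]; first exact: polynomial_function_cst.
by under eq_fun do rewrite exprS; exact: polynomial_functionM.
Qed.

Lemma bounded_measurable_polynomial_function F :
  polynomial_function F -> bounded_measurable setT F.
Proof.
move=> [e /funext ->]; apply: bounded_measurable_sum => p.
apply: bounded_measurableZ; apply: bounded_measurable_prod => i.
exact: bounded_measurable_coord.
Qed.

Variables a b : {finite_measure set sphere -> \bar R}.
Hypothesis moments_eq : forall s : seq 'I_n,
  \int[a]_(u in setT) (\prod_(i <- s) sphere_row u 0 i) =
  \int[b]_(u in setT) (\prod_(i <- s) sphere_row u 0 i).

Let mT : measurable (@setT sphere). Proof. exact: measurableT. Qed.

Let integral_polyE (c : {finite_measure set sphere -> \bar R}) e :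
  \int[c]_(u in setT) (\sum_(p <- e) p.1 * \prod_(i <- p.2) sphere_row u 0 i) =
  \sum_(p <- e) p.1 * \int[c]_(u in setT) (\prod_(i <- p.2) sphere_row u 0 i) :> R.
Proof.
have cT : (c setT < +oo)%E by exact: fin_num_fun_lty.
have bp (s : seq 'I_n) : bounded_measurable (@setT sphere)
    (fun u => \prod_(i <- s) sphere_row u 0 i).
  by apply: bounded_measurable_prod => i; exact: bounded_measurable_coord.
rewrite Rintegral_sum//; last by move=> p; exact: bounded_measurableZ.
by apply: eq_bigr => p _; rewrite RintegralZl//; exact: bounded_measurable_integrable.
Qed.

Lemma integral_polynomial_function F : polynomial_function F ->
  \int[a]_(u in setT) F u = \int[b]_(u in setT) F u.
Proof.
move=> [e /funext ->]; rewrite !integral_polyE.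
by apply: eq_bigr => p _; rewrite moments_eq.
Qed.

Section halfspaces.
Variable h : 'I_n -> R.

Let H : set sphere := [set u | forall i, sphere_row u 0 i < h i].

(** The coordinate is rescaled into [0, 1] with [h i] sent to 1/2, the threshold of [step_poly]. *)
Let t u i : R := 1 / 2 + (sphere_row u 0 i - h i) / (2 * (1 + `|h i|)).

Let t01 u i : 0 <= t u i <= 1.
Proof.
have d0 : 0 < 1 + `|h i| by rewrite ltr_pwDl.
have : `|(sphere_row u 0 i - h i) / (1 + `|h i|)| <= 1.
  rewrite normrM normfV (gtr0_norm d0) ler_pdivrMr// mul1r.
  by apply: le_trans (ler_normB _ _) _; rewrite lerD2r sphere_coord_le1.
rewrite ler_norml /t (_ : _ / (2 * _) = (sphere_row u 0 i - h i) / (1 + `|h i|) / 2).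
  by move: (_ / (1 + _)) => x; lra.
by field; rewrite gt_eqF.
Qed.

Let tE u i : (t u i < 1 / 2) = (sphere_row u 0 i < h i).
Proof.
rewrite /t gtrDl pmulr_llt0 ?subr_lt0// invr_gt0 mulr_gt0// ltr_pwDl//.
Qed.

Let F k u : R := \prod_(i <- enum 'I_n) step_poly k (t u i).

Let pF k : polynomial_function (F k).
Proof.
apply: polynomial_function_prod => i; apply: polynomial_functionX.
apply: polynomial_functionD; first exact: polynomial_function_cst.
under eq_fun do rewrite -mulN1r.
apply: polynomial_functionM; first exact: polynomial_function_cst.
apply: polynomial_functionX; apply: polynomial_functionD.
  exact: polynomial_function_cst.
apply: polynomial_functionM; last exact: polynomial_function_cst.
apply: polynomial_functionD; last exact: polynomial_function_cst.
exact: polynomial_function_coord.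
Qed.

Let F01 k u : `|F k u| <= 1.
Proof.
rewrite normr_prod; apply: prodr_ile1 => i _; rewrite normr_ge0/=.
by have /andP[s0 s1] := step_poly_bounds k (t01 u i); rewrite ger0_norm.
Qed.

Let cvgF u : F k u @[k --> \oo] --> (\1_H u : R).
Proof.
have -> : \1_H u = \prod_(i <- enum 'I_n) ((t u i < 1 / 2)%R%:R : R).
  rewrite indicE; case: (asboolP (H u)) => [Hu|Hu].
    by rewrite mem_set// big1// => i _; rewrite tE Hu.
  rewrite memNset//; have [i hi] : exists i, ~ (sphere_row u 0 i < h i).
    by apply/existsNP.
  apply/esym/eqP; rewrite prodf_seq_eq0; apply/hasP; exists i.
    by rewrite mem_enum.
  by rewrite /= tE; move/negP/negbTE: hi => ->.
by apply: cvg_prod_seq => i; exact: cvg_step_poly.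
Qed.

Let mH : measurable H.
Proof.
rewrite (_ : H = \bigcap_(i in [set: 'I_n])
   ((fun u => sphere_row u 0 i) @^-1` `]-oo, h i[)); last first.
  apply/seteqP; split => [u Hu i _|u Hu i]; have := Hu i; rewrite /= in_itv //=.
  exact.
apply: fin_bigcap_measurable => // i _.
rewrite -[X in measurable X]setTI.
apply: (@measurable_coord_comp R n _ _ (@sphere_row R m)) => //.
exact: measurable_sphere_row.
Qed.

Let cvg_integral (c : {finite_measure set sphere -> \bar R}) :
  (\int[c]_(u in setT) (F k u)%:E @[k --> \oo] --> c H)%E.
Proof.
have cT : (c setT < +oo)%E by exact: fin_num_fun_lty.
rewrite -(setIT H) -(integral_indic c measurableT mH).
have [|||||_ _] := @dominated_convergence _ _ _ c setT measurableT
  (fun k u => (F k u)%:E) (fun u => (\1_H u)%:E) (fun=> 1%E).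
- move=> k; apply/measurable_EFinP.
  by case: (bounded_measurable_polynomial_function (pF k)).
- exact/measurable_EFinP/measurable_indic.
- by apply: aeW => u _; apply/fine_cvgP; split; [exact: nearW|exact: cvgF].
- exact: (bounded_measurable_integrable measurableT cT (bounded_measurable_cst _ 1)).
- by apply: aeW => u k _; rewrite lee_fin F01.
exact.
Qed.

Lemma moments_halfspaces : a H = b H.
Proof.
have E : (fun k => \int[a]_(u in setT) (F k u)%:E)%E =
    (fun k => \int[b]_(u in setT) (F k u)%:E)%E.
  apply/funext => k.
  have bF := bounded_measurable_polynomial_function (pF k).
  rewrite -!EFin_Rintegral//; try exact: fin_num_fun_lty.
  by rewrite integral_polynomial_function.
have ca := @cvg_integral a; rewrite E in ca.
by rewrite -(cvg_lim _ ca)// (cvg_lim _ (@cvg_integral b)).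
Qed.

End halfspaces.

Lemma moments_unique A : measurable A -> a A = b A.
Proof. by apply: sphere_measure_unique => h; exact: moments_halfspaces. Qed.

End moment_uniqueness.

Section equality_case.
Context (R : realType) (m : nat).
Local Notation n := m.+2.
Local Notation sphere := (borel_sphere R m.+1).
Variable mu : {finite_measure set sphere -> \bar R}.
Hypotheses (mu_even : even_measure mu) (mu_isotropic : isotropic mu).

(** Evenness is stated with images; the map is an involution, so preimages serve as well. *)
Let mu_antipode (A : set sphere) : measurable A -> mu (@antipode R m.+1 @^-1` A) = mu A.
Proof.
have antipodeK (u : set_type (unit_sphere R m.+1)) : antipode (antipode u) = u.
  by apply: val_inj; rewrite /= opprK.
move=> mA; rewrite -[RHS]mu_even//; congr (mu _); apply/seteqP; split => u.
  by move=> Au; exists (antipode u) => //; exact: antipodeK.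
by move=> [v Av <-]; rewrite /preimage /= antipodeK.
Qed.

Lemma volume_sine_ball_eqP :
  volume (sine_ball mu) = (kappa R n / gamma R n ^+ n)%:E <->
  (forall A : set sphere, measurable A -> mu A = normalized_lebesgue A).
Proof.
split=> [volE A mA|muE].
  rewrite normalized_lebesgueE//.
  apply: moments_unique mA => s.
  apply: (@integral_prod_coord_unique R m.+1 (gamma R n)).
  - exact: isotropic_mass.
  - exact: sphere_measureT.
  - exact: (volume_sine_ball_eq mu_isotropic volE).
  - exact: sine_sphere_measure.
  - exact: mu_antipode.
  - exact: sphere_measure_antipode.
(* Conversely, [mu] then has the sine transform of [sphere_measure], so its ball is the Euclidean
   ball of radius 1/gamma. *)
have sineE x : sine mu x = gamma R n * enorm x.
  rewrite -sine_sphere_measure /sine /Rintegral; congr fine.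
  apply: eq_measure_integral => A mA _.
  by rewrite [LHS]muE// normalized_lebesgueE.
have g0 := gamma_gt0 R m.
have -> : sine_ball mu = [set x | gamma R n * enorm x <= 1].
  by apply/seteqP; split => x; rewrite /sine_ball /= sine_transformE lee_fin sineE.
have mgx : measurable_fun setT (fun x : 'rV[R]_n => gamma R n * enorm x).
  by apply: measurable_funM => //; exact: measurable_enorm.
rewrite volume_sublevel//; last 2 first.
- by move=> x x0; rewrite mulr_gt0// enorm_gt0.
- by move=> s x s0; rewrite enormZ gtr0_norm// mulrCA.
transitivity (\int[@volume R n]_(x in @uball R n) (gamma R n ^- n)%:E)%E.
  apply: ge0_integral_uball_neq0 => //.
  - apply/measurable_EFinP/measurable_funM; last exact: measurable_expVn.
    by apply: measurable_funX; exact: measurable_enorm.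
  - move=> x; rewrite lee_fin mulr_ge0 ?invr_ge0// exprn_ge0 ?enorm_ge0//.
    by rewrite mulr_ge0 ?enorm_ge0// ltW.
  - by move=> x; rewrite lee_fin invr_ge0 exprn_ge0// ltW.
  move=> x; rewrite -enorm_gt0 => x0; congr EFin.
  by rewrite exprMn invfM mulrCA mulfV ?mulr1// gt_eqF// exprn_gt0.
rewrite integral_cst; last exact: measurable_uball.
by rewrite /= volume_uball -EFinM mulrC.
Qed.

End equality_case.

(* The dimension is n = m.+1, and [mu] is a measure on S^(n-1) = S^m. *)
Theorem theorem1 (R : realType) (m : nat) (hn : (3 <= m.+1)%N)
    (mu : {finite_measure set (borel_sphere R m) -> \bar R})
    (mu_even : even_measure mu) (mu_isotropic : isotropic mu) :
  [/\ ((kappa R m.+1 / gamma R m.+1 ^+ m.+1)%:E <= volume (sine_ball mu))%E,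
      (volume (sine_ball mu) <= (kappa R m.+1 * gamma R m.+1 ^+ m.+1 / alpha R m.+1)%:E)%E
    & volume (sine_ball mu) = (kappa R m.+1 / gamma R m.+1 ^+ m.+1)%:E <->
      (forall A : set (borel_sphere R m), measurable A ->
         mu A = normalized_lebesgue A)].
Proof.
case: m hn mu mu_even mu_isotropic => // m hm mu mu_even mu_isotropic; split.
- exact: volume_sine_ball_lb.
- by apply: volume_sine_ball_ub.
- exact: volume_sine_ball_eqP.
Qed.
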